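(* There exists a numerical constant $0<\varepsilon_1<\frac1{100}$ such that the following holds. For every $0<\varepsilon\le\varepsilon_1$ there is $\alpha>1$ depending on $\varepsilon$ such that, if (1) $Q\subset\mathbb Z^2$ is a box with $\ell(Q)\ge\alpha$, (2) $\Theta\subset Q$ is $\varepsilon$-regular in $Q$, (3) $\bar V\ge2$ and $\lambda_0\in[0,8]$, (4) $V':\Theta\to\{0,\bar V\}$, (5) $\mathcal E_{uc}^{\varepsilon,\alpha}(Q,\Theta)$ denotes the event that, for all $\lambda\in\mathbb R$ and $u:\mathbb Z^2\to\mathbb R$, the three conditions $|\lambda-\lambda_0|\le(\ell(Q)\bar V)^{-\alpha\ell(Q)}$, $\ Hu=\lambda u$ in $Q$, and $|u|\le1$ in a $1-\varepsilon^3$ fraction of $Q\setminus\Theta$ imply $|u|\le(\ell(Q)\bar V)^{\alpha\ell(Q)}$ in $\frac1{100}Q$, then $$\mathbb P\left[\mathcal E_{uc}^{\varepsilon,\alpha}(Q,\Theta)\ \big|\ V|_\Theta=V'\right]\ge1-\exp(-\varepsilon\ell(Q)^{2/3}).$$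
   Context: For $a\in\mathbb Z^2$, $|a|=\|a\|_\infty$; $a\sim b$ means $\|a-b\|_1=1$. $H=-\Delta+V$ with $\Delta u(a)=-4u(a)+\sum_{b\sim a}u(b)$ and $\{V(a)\}_{a\in\mathbb Z^2}$ i.i.d. with $\mathbb P[V(a)=0]=\mathbb P[V(a)=\bar V]=\frac12$. For real $l\ge1$, $Q_l(a)=\{a'\in\mathbb Z^2:|a-a'|\le\frac{l-1}2\}$ is a box with side length $\ell(Q_l(a))=2\lfloor\frac{l-1}2\rfloor$; $kQ_l(a)=Q_{kl}(a)$ for real $k>0$. ''$Hu=\lambda u$ in $Q$'' means $(Hu)(a)=\lambda u(a)$ for all $a\in Q$. A tilted rectangle is $R_{I,J}=\{(x,y)\in\mathbb Z^2:x+y\in I,\ x-y\in J\}$ with $I,J\subset\mathbb Z$ intervals; it is a tilted square if $|I|=|J|$. $\mathcal D_k^\pm=\{(x,y)\in\mathbb Z^2:x\pm y=k\}$. $\Theta$ is $\eta$-sparse in a tilted rectangle $R$ if $|\mathcal D_k^\varsigma\cap\Theta\cap R|\le\eta|\mathcal D_k^\varsigma\cap R|$ for all $k\in\mathbb Z$ and both signs $\varsigma$. $\Theta$ is $\eta$-regular in $E\subset\mathbb Z^2$ if $\sum_k|\tilde Q_k|\le\eta|E|$ whenever $\tilde Q_1,\dots,\tilde Q_n\subset E$ are disjoint tilted squares in each of which $\Theta$ is not $\eta$-sparse. *)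

(* Defs.v *)
From HB Require Import structures.
From mathcomp Require Import all_boot all_order all_algebra finmap.
From mathcomp Require Import all_classical all_reals all_analysis.
Import Order.TTheory GRing.Theory Num.Theory.
Import numFieldNormedType.Exports.

Set Implicit Arguments.
Unset Strict Implicit.
Unset Printing Implicit Defensive.

Local Open Scope classical_set_scope.
Local Open Scope ring_scope.

Notation Z2 := (int * int)%type.

Definition linf_norm (a : Z2) : int := Num.max `|a.1| `|a.2|.

Definition l1_norm (a : Z2) : int := `|a.1| + `|a.2|.

Definition neighbor (a b : Z2) : Prop := l1_norm (a - b) = 1.

(* Cardinality of a finite set; all sets counted in this file are finite in
   actual use ([fset_set] sends infinite sets to the empty one). *)
Definition ncard (T : choiceType) (A : set T) : nat := #|` fset_set A|.

Section Operator.
Variable R : realType.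

Definition laplacian (u : Z2 -> R) (a : Z2) : R :=
  - (4 * u a) + \sum_(b \in [set b | neighbor a b]) u b.

Definition schrodinger (v u : Z2 -> R) (a : Z2) : R :=
  - laplacian u a + v a * u a.

End Operator.

Section Geometry.
Variable R : realType.

Definition box (l : R) (a : Z2) : set Z2 :=
  [set a' | (linf_norm (a - a'))%:~R <= (l - 1) / 2].

(* The dilate [k Q_l(a) = Q_{kl}(a)] depends on [l] and not only on the
   underlying set of points, so boxes are handled through the pair [(l, a)]. *)
Definition scaled_box (k l : R) (a : Z2) : set Z2 := box (k * l) a.

Definition side_length (l : R) : R := 2 * (Num.floor ((l - 1) / 2))%:~R.

Definition tilted_rect (I J : set int) : set Z2 :=
  [set a | I (a.1 + a.2) /\ J (a.1 - a.2)].

Definition tilted_square (S : set Z2) : Prop :=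
  exists I J : set int,
    [/\ is_interval I, is_interval J, (I #= J)%card & S = tilted_rect I J].

(* [true] stands for the sign [+], [false] for the sign [-]. *)
Definition diagonal (sgn : bool) (k : int) : set Z2 :=
  [set a | (if sgn then a.1 + a.2 else a.1 - a.2) = k].

Definition sparse (eta : R) (Theta S : set Z2) : Prop :=
  forall (sgn : bool) (k : int),
    (ncard (diagonal sgn k `&` Theta `&` S))%:R
      <= eta * (ncard (diagonal sgn k `&` S))%:R.

Definition regular (eta : R) (Theta E : set Z2) : Prop :=
  forall (n : nat) (S : 'I_n -> set Z2),
    (forall i, tilted_square (S i)) ->
    (forall i, S i `<=` E) ->
    (forall i j, i != j -> S i `&` S j = set0) ->
    (forall i, ~ sparse eta Theta (S i)) ->
    \sum_(i < n) (ncard (S i))%:R <= eta * (ncard E)%:R.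

End Geometry.

Section Probability.
Context d (T : measurableType d) (R : realType) (P : probability T R).

Definition mutually_independent (I : choiceType) (X : I -> {RV P >-> R}) : Prop :=
  forall (s : {fset I}) (B : I -> set R),
    (forall i, i \in s -> measurable (B i)) ->
    P [set w | forall i, i \in s -> B i (X i w)]
      = (\prod_(i <- s) P (X i @^-1` B i))%E.

(* For [Vbar != 0] the two masses of 1/2 determine the law of each [V a], so
   the variables are identically distributed. *)
Definition iid_bernoulli (Vbar : R) (V : Z2 -> {RV P >-> R}) : Prop :=
  mutually_independent V /\
  forall a, P [set w | V a w = 0] = (2^-1)%:E /\
            P [set w | V a w = Vbar] = (2^-1)%:E.

Definition cond_prob (A B : set T) : R := fine (P (A `&` B)) / fine (P B).

Definition unique_continuation_event (V : Z2 -> {RV P >-> R}) (Vbar lambda0 : R)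
    (eps alpha l : R) (a : Z2) (Theta : set Z2) : set T :=
  [set w | forall (lambda : R) (u : Z2 -> R),
    `|lambda - lambda0|
      <= (side_length l * Vbar) `^ (- (alpha * side_length l)) ->
    (forall b, box l a b -> schrodinger (fun c => V c w) u b = lambda * u b) ->
    (1 - eps ^+ 3) * (ncard (box l a `\` Theta))%:R
      <= (ncard [set b | (box l a `\` Theta) b /\ `|u b| <= 1])%:R ->
    forall b, scaled_box (1 / 100) l a b ->
      `|u b| <= (side_length l * Vbar) `^ (alpha * side_length l)].

End Probability.

(* Main.v *)
Require Import Defs.
From HB Require Import structures.
From mathcomp Require Import all_boot all_order all_algebra perm finmap.
From mathcomp Require Import all_classical all_reals all_analysis.
From mathcomp Require Import ring lra zify.
Import Order.TTheory GRing.Theory Num.Theory.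
Import numFieldNormedType.Exports.

(** The proof grows a bound for [u] from a small tilted square to a fixed part
    of the box. In the coordinates [S = x + y] and [T = x - y] the equation says
    that the sum of [u] over the four corners of a cell is a bounded multiple of
    its value at the centre. Suppose that [|u| <= M] on a tilted square of radius
    [h], and that at most places of two adjacent diagonals at a distance of
    order [h / 3000] from its side one has [|u| <= M] as well. On the strip between
    them [u] is determined by its values on two bottom rows and two left columns,
    and a row costs one factor [W], however long it is ([strip_bound]). The part
    that comes from the left columns is a random linear image of [N - 2] unknowns
    observed at about [h] places of the top, with [N] a small fraction of [h]. If
    no normalized vector of unknowns has a tiny top, then the bound on [u] passes
    to the whole strip at the cost of a power of [W] proportional to the height of
    the strip ([strip_control]), and doing this on the four sides enlarges the
    tilted square ([grow]). The heights add up to a multiple of the side of the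
    box, as the theorem requires.

    That a normalized vector has a tiny top is exponentially unlikely
    ([strip_fail_unlikely]). Flipping the bit of the potential at a site on
    the row of the leading unknown moves the top of the next column by at
    least [2], so each column passed by such a vector costs a factor [1 / 2],
    provided that the vector is fixed before the bit is drawn. There is no
    room for a net over all vectors. Instead a square matrix records the
    columns already observed, rescaled so that it maps a vector with a tiny
    top into the unit cube; the vector probed at a column is any one of norm
    at least [1] with an image in that cube. A column at which the probed
    vector is large replaces a row of the matrix and multiplies its
    determinant by a power of [W] ([setrow_gain]). A bound for its entries
    allows at most [2 (N - 2)] such columns ([successes_le]), while a bad
    vector makes at least a quarter of all columns be probed ([columns_used]).
    An exponential supermartingale compares the two numbers.

    The growth can be iterated from a starting point [p] if at every scale around
    [p] the strips do not fail, the frozen set [Theta] is sparse on diagonals, and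
    few free sites carry a value of [u] above [1]. Tilted squares are balls of
    the [l1] norm, so that regularity of [Theta] and Vitali's covering lemma show
    that the last two conditions fail at a small fraction of all points
    ([start_point]). The failures of strips are the only random obstruction.
    Up to scale [k ^ 2], where [k ^ 3] is about the side of the box, failures at
    points of one class of a grid of mesh [4 k ^ 2 + 1] are independent, so that
    it is exponentially unlikely in the number [c k ^ 2] of points of a class
    that half of the class fails; at larger scales a union bound over points and
    scales suffices ([many_fail_unlikely]). Both probabilities are [exp (- c k ^ 2)],
    which is the rate of the theorem.

    None of these events involves [u] or the energy. To speak of the probability
    of the unique continuation event one also needs that it is measurable
    ([event_measurable]): its complement is a countable union of conditions
    that are closed in finitely many values of the potential, by compactness of
    the set of bounded solutions. *)

Set Implicit Arguments.
Unset Strict Implicit.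
Unset Printing Implicit Defensive.

Local Open Scope classical_set_scope.
Local Open Scope ring_scope.

(** * Averages over independent fair bits *)

Section Average.
Variables (R : realType) (X : eqType).
Implicit Types (v : X -> bool) (f g : (X -> bool) -> R) (p q : X) (L : seq X).

Definition upd v p (c : bool) : X -> bool := fun q => if q == p then c else v q.

Definition avg1 p f v : R := (f (upd v p false) + f (upd v p true)) / 2.

(** A conditional expectation: the bits on [L] are drawn again, fairly and
    independently, while those off [L] are frozen to their values in [v]. *)
Definition avg L f : (X -> bool) -> R := foldr avg1 f L.

Definition dep_on (D : pred X) (A : Type) (f : (X -> bool) -> A) :=
  forall v v', (forall q, D q -> v q = v' q) -> f v = f v'.

Lemma updC v p q c d : p != q -> upd (upd v p c) q d = upd (upd v q d) p c.
Proof.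
move=> pq; apply/funext => x; rewrite /upd; case: (eqVneq x q) => // ->.
by rewrite eq_sym (negbTE pq).
Qed.

Lemma updK v p c d : upd (upd v p c) p d = upd v p d.
Proof. by apply/funext => x; rewrite /upd; case: eqVneq. Qed.

Lemma avg1_le p f g : (forall v, f v <= g v) -> forall v, avg1 p f v <= avg1 p g v.
Proof. by move=> fg v; rewrite /avg1 ler_pM2r ?invr_gt0 // lerD. Qed.

Lemma avg_le L f g : (forall v, f v <= g v) -> forall v, avg L f v <= avg L g v.
Proof. by move=> fg; elim: L => //= p L IH; apply: avg1_le. Qed.

Lemma avgD L f g v : avg L (fun v => f v + g v) v = avg L f v + avg L g v.
Proof.
by elim: L v => //= p L IH v; rewrite /avg1 !IH; field.
Qed.

Lemma avgZ L f v k : avg L (fun v => k * f v) v = k * avg L f v.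
Proof. by elim: L v => //= p L IH v; rewrite /avg1 !IH; field. Qed.

Lemma avg_cst L v k : avg L (fun=> k) v = k.
Proof. by elim: L v => //= p L IH v; rewrite /avg1 !IH; field. Qed.

Lemma avg_sum L (I : Type) (s : seq I) (P : pred I) (F : I -> (X -> bool) -> R) v :
  avg L (fun v => \sum_(i <- s | P i) F i v) v = \sum_(i <- s | P i) avg L (F i) v.
Proof.
elim: s => [|i s IH].
  by under eq_fun do rewrite big_nil; rewrite avg_cst big_nil.
rewrite big_cons -IH; under eq_fun do rewrite big_cons.
by case: ifP => // _; rewrite avgD.
Qed.

Lemma avg1_comm p q f : avg1 p (avg1 q f) = avg1 q (avg1 p f).
Proof.
apply/funext => v; rewrite /avg1; case: (eqVneq p q) => [-> //|pq].
by rewrite !(updC _ _ _ pq); field.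
Qed.

Lemma avg1_avg p L f : avg1 p (avg L f) = avg L (avg1 p f).
Proof. by elim: L => //= q L IH; rewrite avg1_comm IH. Qed.

Lemma avg1_id p f : avg1 p (avg1 p f) = avg1 p f.
Proof. by apply/funext => v; rewrite /avg1 !updK; field. Qed.

(** Averaging once more over a site that is already averaged changes nothing:
    this lets one condition on all the other sites, in any order. *)
Lemma avg_avg1 p L f : p \in L -> avg L (avg1 p f) = avg L f.
Proof.
elim: L => //= q L IH; rewrite inE => /orP[/eqP <-|/IH -> //].
by rewrite -avg1_avg avg1_id.
Qed.

Lemma dep_on_avg D L f : dep_on D f -> dep_on D (avg L f).
Proof.
elim: L => //= p L IH /IH{IH} IH v v' vv'; rewrite /avg1.
by congr ((_ + _) / _); apply: IH => q Dq; rewrite /upd; case: ifP => // _; apply: vv'.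
Qed.

Lemma dep_on_upd D (A : Type) (f : (X -> bool) -> A) p v c :
  dep_on D f -> ~~ D p -> f (upd v p c) = f v.
Proof.
move=> fD Dp; apply: fD => q Dq; rewrite /upd; case: eqP => // qp.
by rewrite -qp Dq in Dp.
Qed.

(** Each bit of [L] is seen by at most one of the two factors, so it can be
    averaged in that factor alone. *)
Lemma avg_indep L f g D D' :
  dep_on D f -> dep_on D' g -> (forall q, D q -> D' q -> False) ->
  forall v, avg L (fun v => f v * g v) v = avg L f v * avg L g v.
Proof.
move=> fD gD' DD'; elim: L => //= p L IH v; rewrite /avg1 !IH.
have fLD := dep_on_avg L fD; have gLD := dep_on_avg L gD'.
case Dp: (D p).
  have nD'p : ~~ D' p by apply/negP => /(DD' _ Dp).
  by rewrite !(dep_on_upd _ _ gLD nD'p); field.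
by rewrite !(dep_on_upd _ _ fLD (negbT Dp)); field.
Qed.

Lemma avg_prod L (I : eqType) (s : seq I) (F : I -> (X -> bool) -> R)
    (D : I -> pred X) :
  uniq s -> (forall i, i \in s -> dep_on (D i) (F i)) ->
  (forall i j q, i \in s -> j \in s -> i != j -> D i q -> D j q -> False) ->
  forall v, avg L (fun v => \prod_(i <- s) F i v) v = \prod_(i <- s) avg L (F i) v.
Proof.
elim: s => [|i s IH] us sD disj v.
  by under eq_fun do rewrite big_nil; rewrite avg_cst big_nil.
move: us => /= /andP[nis us].
rewrite big_cons -IH //; last 2 first.
- by move=> j js; apply: sD; rewrite inE js orbT.
- by move=> j k q js ks; apply: disj; rewrite inE ?js ?ks orbT.
under eq_fun do rewrite big_cons.
apply: (@avg_indep _ _ _ (D i) (fun q => has (fun j => D j q) s)).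
- by apply: sD; rewrite inE eqxx.
- move=> w w' ww'; apply: eq_big_seq => j js; apply: sD; first by rewrite inE js orbT.
  by move=> q Dq; apply: ww'; apply/hasP; exists j.
- move=> q Diq /hasP[j js Djq]; apply: (disj i j q) => //; rewrite ?inE ?eqxx ?js ?orbT //.
  by apply: contraNneq nis => ->.
Qed.

End Average.

Section RowReplacement.
Variable R : realType.

Definition setrow (m : nat) (B : 'M[R]_m) (j : 'I_m) (r : 'rV[R]_m) : 'M[R]_m :=
  \matrix_(i, k) if i == j then r 0 k else B i k.

Lemma det_setrow m (B : 'M[R]_m) j r : \det (setrow B j r) = (r *m \adj B) 0 j.
Proof.
rewrite (expand_det_row _ j) mxE; apply: eq_bigr => k _.
rewrite !mxE eqxx /cofactor; congr (_ * (_ * \det _)).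
by apply/matrixP => a b; rewrite !mxE eq_sym (negbTE (neq_lift _ _)).
Qed.

Lemma det_le m (B : 'M[R]_m) (C : R) :
  (forall i j, `|B i j| <= C) -> `|\det B| <= (m`!)%:R * C ^+ m.
Proof.
move=> BC; apply: (le_trans (ler_norm_sum _ _ _)).
apply: (@le_trans _ _ (\sum_(s : 'S_m) C ^+ m)).
  apply: ler_sum => s _; rewrite normrM normrX normrN1 expr1n mul1r normr_prod.
  rewrite -[X in C ^+ X]card_ord -prodr_const; apply: ler_prod => i _.
  by rewrite normr_ge0 BC.
by rewrite sumr_const mulr_natl -card_Sn.
Qed.

(** Cramer's rule, quantitatively: a functional that is large on a vector on
    which [B] is small can replace a row of [B] with a large gain in
    determinant. *)
Lemma setrow_gain m (B : 'M[R]_m) (r : 'rV[R]_m) (w : 'cV[R]_m) (x : R) :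
  (0 < m)%N -> \det B != 0 -> (forall i, `|(B *m w) i 0| <= 1) ->
  m%:R * x <= `|(r *m w) 0 0| ->
  exists j, x * `|\det B| <= `|\det (setrow B j r)|.
Proof.
move=> m0 dB Bw rw.
have dB0 : 0 < `|\det B| by rewrite normr_gt0.
have rwE : \det B *: (r *m w) = r *m \adj B *m (B *m w).
  by rewrite mulmxA -(mulmxA r) mul_adj_mx mul_mx_scalar scalemxAl.
case: (pselect (exists j, x * `|\det B| <= `|\det (setrow B j r)|)) => // nj.
suff : `|\det B| * `|(r *m w) 0 0| < m%:R * (x * `|\det B|).
  move=> lt; suff : m%:R * (x * `|\det B|) <= `|\det B| * `|(r *m w) 0 0|.
    by rewrite leNgt lt.
  by rewrite mulrA [leRHS]mulrC ler_pM2r.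
have -> : `|\det B| * `|(r *m w) 0 0| = `|(\det B *: (r *m w)) 0 0|.
  by rewrite [in RHS]mxE normrM.
rewrite rwE [X in `|X| < _]mxE; apply: (le_lt_trans (ler_norm_sum _ _ _)).
have -> : m%:R * (x * `|\det B|) = \sum_(i < m) (x * `|\det B|).
  by rewrite sumr_const card_ord mulr_natl.
apply: ltr_sum; first by apply/hasP; exists (Ordinal m0); rewrite ?mem_index_enum.
move=> i _; rewrite normrM.
apply: (@le_lt_trans _ _ `|(r *m \adj B) 0 i|).
  by rewrite ler_piMr.
rewrite -det_setrow ltNge; apply/negP => h; apply: nj; by exists i.
Qed.

End RowReplacement.

(** * Solutions of the equation on a strip *)

Section Strip.
Variable R : realType.
Implicit Types (w F G : nat -> nat -> R) (x : nat -> R).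

(** In tilted coordinates the equation couples the four corners of a cell to its
    centre [(s + 1, t + 1)]. *)
Definition corners F s t := F s t + F s t.+2 + F s.+2 t + F s.+2 t.+2.

(** If the rows [t] and [t + 1] are of the size expected for them, then the
    equation makes consecutive values of row [t + 2] cancel up to an error that
    is smaller by a factor [W / Vb]. As [W] exceeds the length of the strip times
    [18 Vb], the errors add up to less than half of the size expected for row [t + 2]. *)
Lemma alternating_row F w A (W Vb Y : R) t :
  2 <= Vb -> 18 * A.+2%:R * Vb <= W -> 0 <= Y ->
  (forall s t, `|w s t| <= 4 * Vb) ->
  (forall s, (s < A)%N -> `|corners F s t - w s.+1 t.+1 * F s.+1 t.+1| <= Y) ->
  (forall s, (s <= A.+1)%N -> `|F s t| <= 2 * Y * W ^+ t) ->
  (forall s, (s <= A.+1)%N -> `|F s t.+1| <= 2 * Y * W ^+ t.+1) ->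
  forall s j, (s + j.*2 <= A.+1)%N ->
    `|F (s + j.*2)%N t.+2 - (-1) ^+ j * F s t.+2| <= Y * W ^+ t.+2 / 2.
Proof.
move=> Vb2 hW Y0 hw hres h0 h1.
have A2 : 2 <= A.+2%:R :> R by rewrite ler_nat.
have W1 : 1 <= W by nra.
have Wt : 1 <= W ^+ t by rewrite exprn_ege1.
(* One cell: the centre and the two lower corners bound the sum of the upper ones. *)
have step s : (s < A)%N -> `|F s.+2 t.+2 + F s t.+2| <= 11 * Vb * (Y * W ^+ t.+1).
  move=> sA.
  have -> : F s.+2 t.+2 + F s t.+2 = (corners F s t - w s.+1 t.+1 * F s.+1 t.+1)
     + w s.+1 t.+1 * F s.+1 t.+1 - F s t - F s.+2 t by rewrite /corners; ring.
  have e1 := hres s sA.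
  have e2 : `|w s.+1 t.+1 * F s.+1 t.+1| <= 4 * Vb * (2 * Y * W ^+ t.+1).
    by rewrite normrM ler_pM // h1 // ltnW.
  have e3 := h0 s (leq_trans (ltnW sA) (leqnSn _)).
  have e4 := h0 s.+2 sA.
  have tri : forall a b c d : R, `|a + b - c - d| <= `|a| + `|b| + `|c| + `|d|.
    move=> a b c d; rewrite (le_trans (ler_normB _ _)) // lerD2r.
    by rewrite (le_trans (ler_normB _ _)) // lerD2r ler_normD.
  apply: (le_trans (tri _ _ _ _)).
  have : Y * W ^+ t <= Y * W ^+ t.+1 by rewrite ler_wpM2l // exprS ler_peMl // (le_trans _ Wt).
  have : Y <= Y * W ^+ t by rewrite ler_peMr.
  set Z := Y * W ^+ t.+1; set Z' := Y * W ^+ t => hZ' hZ.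
  move: e2 e3 e4; rewrite -!mulrA -/Z -/Z' => e2 e3 e4.
  have : 2 * Z <= Vb * Z by rewrite ler_wpM2r //; lra.
  lra.
suff H s j : (s + j.*2 <= A.+1)%N ->
    `|F (s + j.*2)%N t.+2 - (-1) ^+ j * F s t.+2| <= j%:R * (11 * Vb * (Y * W ^+ t.+1)).
  move=> s j sj; apply: (le_trans (H s j sj)).
  have jA : (j.*2)%:R <= A.+2%:R :> R by rewrite ler_nat; lia.
  have Z0 : 0 <= Y * W ^+ t.+1 by rewrite mulr_ge0 // exprn_ge0 //; lra.
  rewrite -mul2n natrM in jA.
  rewrite [X in _ <= Y * X / 2]exprS (mulrCA Y) -[leRHS]mulrA (mulrC _ 2^-1) [leRHS]mulrA.
  rewrite mulrA ler_wpM2r //.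
  have : A.+2%:R * Vb * 9 <= W / 2 by lra.
  have : j%:R * Vb * 2 <= A.+2%:R * Vb by rewrite mulrAC ler_wpM2r //; lra.
  have : 0 <= A.+2%:R * Vb by rewrite mulr_ge0 //; lra.
  lra.
elim: j => [|j IH] sj.
  by rewrite /= addn0 expr0 !mul1r subrr normr0 mul0r.
have sj' : (s + j.*2 < A)%N by lia.
have {IH} IH := IH ltac:(lia).
have e := step _ sj'.
rewrite doubleS !addnS exprS.
have -> : F (s + j.*2).+2 t.+2 - -1 * (-1) ^+ j * F s t.+2 =
  (F (s + j.*2).+2 t.+2 + F (s + j.*2)%N t.+2) - (F (s + j.*2)%N t.+2 - (-1) ^+ j * F s t.+2) by ring.
rewrite (le_trans (ler_normB _ _)) // -natr1 mulrDl mul1r addrC lerD //.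
Qed.

(** Two small bottom rows and two small left columns control the whole strip:
    each row costs one factor [W], whatever its length. *)
Lemma strip_bound F w A N (W Vb Y : R) :
  2 <= Vb -> 18 * A.+2%:R * Vb <= W -> 0 <= Y ->
  (forall s t, `|w s t| <= 4 * Vb) ->
  (forall s t, (s < A)%N -> (t.+2 <= N)%N ->
     `|corners F s t - w s.+1 t.+1 * F s.+1 t.+1| <= Y) ->
  (forall s t, (s <= A.+1)%N -> (t <= 1)%N -> `|F s t| <= Y) ->
  (forall s t, (s <= 1)%N -> (t <= N)%N -> `|F s t| <= Y * W ^+ t) ->
  forall s t, (s <= A.+1)%N -> (t <= N)%N -> `|F s t| <= 2 * Y * W ^+ t.
Proof.
move=> Vb2 hW Y0 hw hres hbot hleft s t.
have A2 : 2 <= A.+2%:R :> R by rewrite ler_nat.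
have W1 : 1 <= W by nra.
elim/ltn_ind: t s => -[|[|t]] IH s sA tN.
- by rewrite expr0 mulr1 (le_trans (hbot _ _ _ _)) //; lra.
- rewrite expr1 (le_trans (hbot _ _ _ _)) //; nra.
have h0 s' : (s' <= A.+1)%N -> `|F s' t| <= 2 * Y * W ^+ t by move=> ?; apply: IH => //; lia.
have h1 s' : (s' <= A.+1)%N -> `|F s' t.+1| <= 2 * Y * W ^+ t.+1
  by move=> ?; apply: IH => //; lia.
have := alternating_row Vb2 hW Y0 hw (fun s sA => hres s t sA tN) h0 h1
  (s := odd s) (j := s./2).
rewrite odd_double_half => /(_ sA) e1.
have e2 := hleft (odd s) t.+2 (leq_b1 _) tN.
have -> : F s t.+2 = (F s t.+2 - (-1) ^+ s./2 * F (odd s) t.+2) + (-1) ^+ s./2 * F (odd s) t.+2 by ring.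
apply: (le_trans (ler_normD _ _)).
rewrite [X in _ + X]normrM normrX normrN1 expr1n mul1r.
have : 0 <= Y * W ^+ t.+2 by rewrite mulr_ge0 // exprn_ge0 //; lra.
lra.
Qed.

Definition next_col (w0 c0 c1 : nat -> R) : nat -> R :=
  fix nx t := match t with
  | t'.+2 => w0 t'.+1 * c1 t'.+1 - c0 t'.+2 - nx t' - c0 t'
  | _ => 0
  end.

(** The solution that vanishes on the bottom rows [0] and [1], with [x t] in
    row [t] on the one of the two left columns that has the parity of [t]. *)
Fixpoint sol w x s : nat -> R :=
  match s with
  | s'.+1 => match s' with
             | s''.+1 => next_col (w s') (sol w x s'') (sol w x s')
             | _ => fun t => if odd t && (1 < t)%N then x t else 0
             end
  | _ => fun t => if ~~ odd t && (1 < t)%N then x t else 0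
  end.

Lemma sol_corners w x s t :
  corners (sol w x) s t = w s.+1 t.+1 * sol w x s.+1 t.+1.
Proof. by rewrite /corners /=; ring. Qed.

Lemma sol_bottom w x s t : (t <= 1)%N -> sol w x s t = 0.
Proof.
by case: t => [|[|//]] _; case: s => [|[|s]].
Qed.

Lemma sol_left w x s t : (s <= 1)%N ->
  sol w x s t = if (odd t == odd s) && (1 < t)%N then x t else 0.
Proof. by case: s => [|[|//]] _ /=; case: (odd t). Qed.

Lemma sol_dep w w' x s t :
  (forall s' t', (0 < s' < s)%N -> (0 < t' < t)%N -> w s' t' = w' s' t') ->
  sol w x s t = sol w' x s t.
Proof.
elim/ltn_ind: s t => -[|[|s]] IH t hw //.
elim/ltn_ind: t hw => -[|[|t]] IHt hw //.
have e0 := sol_corners w x s t; have e1 := sol_corners w' x s t.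
have es t' : (t' <= t.+2)%N -> sol w x s t' = sol w' x s t'.
  by move=> ht; apply: IH => // a c ? ?; apply: hw; lia.
have es1 t' : (t' <= t.+2)%N -> sol w x s.+1 t' = sol w' x s.+1 t'.
  by move=> ht; apply: IH => // a c ? ?; apply: hw; lia.
have et : sol w x s.+2 t = sol w' x s.+2 t.
  by apply: IHt => // a c ? ?; apply: hw; lia.
have ht : (t <= t.+2)%N by lia.
have ew : w s.+1 t.+1 = w' s.+1 t.+1 by apply: hw; rewrite ?ltnSn.
rewrite /corners -(es t ht) -(es t.+2 (leqnn _)) -(es1 t.+1 (leqnSn _)) -et -ew in e1.
rewrite /corners in e0; lra.
Qed.

Lemma sol_dep_col w w' x s :
  (forall s', (0 < s' < s)%N -> w s' =1 w' s') -> sol w x s =1 sol w' x s.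
Proof. by move=> hw t; apply: sol_dep => s' t' hs' _; apply: hw. Qed.

(** When a single site is changed, the recursion carries the perturbation up the next
    column with alternating sign, since all other terms stay the same. *)
Lemma sol_site w w' x s tau j : (0 < tau)%N ->
  (forall s', (0 < s' <= s)%N -> w s' =1 w' s') ->
  (forall t, t != tau -> w s.+1 t = w' s.+1 t) ->
  `|sol w' x s.+2 (tau + j.*2).+1 - sol w x s.+2 (tau + j.*2).+1| =
  `|w' s.+1 tau - w s.+1 tau| * `|sol w x s.+1 tau|.
Proof.
case: tau => // tau _ hw hw1.
have es : sol w' x s =1 sol w x s by apply/fsym/sol_dep_col => s' ?; apply: hw; lia.
have es1 : sol w' x s.+1 =1 sol w x s.+1 by apply/fsym/sol_dep_col => s' ?; apply: hw; lia.
have rec t : sol w' x s.+2 t.+2 - sol w x s.+2 t.+2 =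
   (w' s.+1 t.+1 - w s.+1 t.+1) * sol w x s.+1 t.+1 - (sol w' x s.+2 t - sol w x s.+2 t).
  have e0 := sol_corners w x s t; have e1 := sol_corners w' x s t.
  rewrite /corners !es !es1 in e1; rewrite /corners in e0; lra.
have low t : (t <= tau.+1)%N -> sol w' x s.+2 t - sol w x s.+2 t = 0.
  elim/ltn_ind: t => -[|[|t]] IH ht; [by rewrite !sol_bottom ?subrr..|].
  by rewrite rec IH ?hw1 //; [rewrite subrr mul0r subr0 | lia | lia].
elim: j => [|j IH].
  by rewrite double0 addn0 rec low ?subr0 ?normrM // leqnSn.
rewrite doubleS !addnS rec hw1; last lia.
by rewrite subrr mul0r sub0r normrN -IH addSn.
Qed.

End Strip.

Arguments sol : simpl never.

(** * A random strip *)

Lemma sol_sum (R : realType) (I : Type) (r : seq I) w (y : I -> R) (x : I -> nat -> R) s t :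
  sol w (fun t => \sum_(i <- r) y i * x i t) s t = \sum_(i <- r) y i * sol w (x i) s t.
Proof.
elim/ltn_ind: s t => -[|[|s]] IH t.
- under eq_bigr do rewrite sol_left //.
  by rewrite sol_left //; case: ifP => // _; rewrite big1 // => i _; rewrite mulr0.
- under eq_bigr do rewrite sol_left //.
  by rewrite sol_left //; case: ifP => // _; rewrite big1 // => i _; rewrite mulr0.
elim/ltn_ind: t => -[|[|t]] IHt; [rewrite sol_bottom // big1 // => i _; by rewrite sol_bottom // mulr0..|].
have e0 := sol_corners w (fun t => \sum_(i <- r) y i * x i t) s t.
rewrite /corners !(IH s) ?(IH s.+1) ?(IHt t) // in e0.
have e1 : \sum_(i <- r) y i * corners (sol w (x i)) s t =
    w s.+1 t.+1 * (\sum_(i <- r) y i * sol w (x i) s.+1 t.+1).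
  by rewrite mulr_sumr; apply: eq_bigr => i _; rewrite sol_corners mulrCA.
have dist (F : I -> nat -> nat -> R) : \sum_(i <- r) y i * corners (F i) s t =
    \sum_(i <- r) y i * F i s t + \sum_(i <- r) y i * F i s t.+2 +
    \sum_(i <- r) y i * F i s.+2 t + \sum_(i <- r) y i * F i s.+2 t.+2.
  by rewrite -!big_split /=; apply: eq_bigr => i _; rewrite /corners; ring.
by move: e1; rewrite -e0 dist => /addrI ->.
Qed.

(** The upper one of the rows [N - 1] and [N] in which column [s] has a lattice
    point, that is, a point of even parity. *)
Definition top_row (N s : nat) := if odd (s + N) then N.-1 else N.

Lemma top_row_le N s : (top_row N s <= N)%N.
Proof. by rewrite /top_row; case: ifP; rewrite ?leq_pred. Qed.

Lemma top_row_above N s i : (i < N.-2)%N -> odd s.+1 = odd i ->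
  exists j, top_row N s = (i.+2 + j.*2).+1.
Proof.
move=> iN /= si.
have Ti : odd (top_row N s) != odd i.
  rewrite /top_row; case: ifP; rewrite oddD; move: si; case: (odd i); lia.
have : (i.+2 < top_row N s)%N.
  by move: Ti; rewrite /top_row; case: ifP => _ /eqP; [|lia];
    case: (eqVneq i.+2 N.-1) => [e|]; [rewrite -e /= negbK|lia].
exists ((top_row N s - i.+3)./2).
have : ~~ odd (top_row N s - i.+3).
  by rewrite oddB //= negbK; move: Ti; case: (odd i); case: (odd _).
lia.
Qed.

Lemma columns_of_parity n b : (n <= (\sum_(s < n) (odd s.+1 == b)).*2 + 1)%N.
Proof.
suff -> : (\sum_(s < n) (odd s.+1 == b) = if b then uphalf n else n./2)%N by case: b; lia.
elim: n => [|n IH]; first by rewrite big_ord0; case: b.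
by rewrite big_ord_recr /= IH; case: b IH => _; case o: (odd n) => /=; lia.
Qed.

Section RandomStrip.
Variables (R : realType) (X : eqType) (site : nat -> nat -> X) (L : seq X).
Variables (A N : nat) (Vb lam W : R).
Implicit Types (v : X -> bool) (y : 'cV[R]_N.-2).

(** The potential of a configuration of bits, read on the strip; only the
    points of even parity carry a site. *)
Definition pot (v : X -> bool) s t : R :=
  4 - lam + (if odd (s + t) then 0 else (v (site s t))%:R * Vb).

(** The weights [W ^ t] make unknowns of modulus at most [1] produce values of
    the size that [strip_bound] propagates. *)
Definition unit_data (i : 'I_N.-2) t : R := (t == i.+2)%:R * W ^+ i.+2.

Definition data (y : 'cV[R]_N.-2) t : R := \sum_i y i 0 * unit_data i t.

(** Sums of two neighbours on the top, rather than single values: the rows below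
    determine a row only up to an alternating sequence, which these sums do not
    see. *)
Definition top_form v s : 'rV[R]_N.-2 :=
  \row_i (sol (pot v) (unit_data i) s (top_row N s) +
          sol (pot v) (unit_data i) s.+2 (top_row N s)).

(** A normalized solution on the strip, vanishing on the two bottom rows, is
    tiny at almost all places of the two top rows. *)
Definition strip_fail v : Prop := exists (S : {set 'I_A}) (y : 'cV[R]_N.-2),
  [/\ (#|~: S|)%:R <= A%:R / 1000 :> R, forall i, `|y i 0| <= 1,
      exists i, `|y i 0| = 1
    & forall s : 'I_A, s \in S -> `|(top_form v s *m y) 0 0| <= W ^- (4 * N)].

Hypothesis Vb2 : 2 <= Vb.
Hypothesis lam08 : 0 <= lam <= 8.
Hypothesis hW : 18 * A.+2%:R * Vb <= W.
Hypothesis NA : N%:R <= A%:R / 1000 :> R.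
Hypothesis site_inj : forall s t s' t', ~~ odd (s + t) -> ~~ odd (s' + t') ->
  site s t = site s' t' -> s = s' /\ t = t'.

Lemma A2 : 2 <= A.+2%:R :> R. Proof. by rewrite ler_nat. Qed.
Lemma W72 : 72 <= W.
Proof. by move: A2 Vb2 hW => a b c; nra. Qed.
Lemma W1 : 1 < W. Proof. by move: W72 => ?; lra. Qed.
Lemma W0 : 0 < W. Proof. by move: W72 => ?; lra. Qed.
Lemma NW : (4 * N)%:R <= W.
Proof.
have h1 : A%:R <= A.+2%:R :> R by rewrite ler_nat; lia.
have h2 : 0 <= A%:R :> R by [].
have h3 : A.+2%:R * 1 <= A.+2%:R * Vb by rewrite ler_wpM2l //; move: Vb2; lra.
set Z := A.+2%:R * Vb in h3.
have h4 : 18 * Z <= W by rewrite /Z mulrA.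
have h5 : 1000 * N%:R <= A%:R :> R by move: NA => ?; lra.
rewrite natrM; lra.
Qed.

Lemma data_i y (i : 'I_N.-2) : data y i.+2 = y i 0 * W ^+ i.+2.
Proof.
rewrite /data (bigD1 i) //= /unit_data eqxx mul1r big1 ?addr0 // => j ji.
by rewrite eqSS eqSS eq_sym (inj_eq val_inj) (negbTE ji) mul0r mulr0.
Qed.

Lemma data_out y t : ~~ (1 < t < N)%N -> data y t = 0.
Proof.
move=> ht; rewrite /data big1 // => i _; rewrite /unit_data.
case: eqP => [e|]; last by rewrite mul0r mulr0.
by exfalso; move/negP: ht; apply; rewrite e; have := ltn_ord i; lia.
Qed.

Lemma data_le y c t : 0 <= c -> (forall i, `|y i 0| <= c) -> `|data y t| <= c * W ^+ t.
Proof.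
move=> c0 yc; case: (boolP (1 < t < N)%N) => [ht|/data_out ->]; last first.
  by rewrite normr0 mulr_ge0 // exprn_ge0 // (ltW W0).
have hi : (t.-2 < N.-2)%N by lia.
have -> : t = (Ordinal hi).+2 by rewrite /=; lia.
by rewrite data_i normrM ler_pM ?yc // ger0_norm // exprn_ge0 // (ltW W0).
Qed.

Lemma pot_le v s t : `|pot v s t| <= 4 * Vb.
Proof.
move: Vb2; rewrite /pot; case/andP: lam08 => l0 l8 ?; rewrite ler_norml.
by apply/andP; case: ifP => _; [|case: (v _)]; rewrite ?mul1r ?mul0r ?addr0; split; lra.
Qed.

Lemma sol_data_le v y c s t : 0 <= c -> (forall i, `|y i 0| <= c) ->
  (s <= A.+1)%N -> (t <= N)%N -> `|sol (pot v) (data y) s t| <= 2 * c * W ^+ t.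
Proof.
move=> c0 yc sA tN; apply: (strip_bound Vb2 hW c0 (pot_le v) _ _ _ sA tN).
- by move=> s' t' _ _; rewrite sol_corners subrr normr0.
- by move=> s' t' _ t1; rewrite sol_bottom // normr0.
- move=> s' t' s1 _; rewrite sol_left //; case: ifP => _; first exact: data_le.
  by rewrite normr0 mulr_ge0 // exprn_ge0 // (ltW W0).
Qed.

(** On the row of its weighted leading coordinate a solution has almost constant
    modulus, on all columns of the right parity. *)
Lemma leading_row v y (i : 'I_N.-2) s : (forall j, `|y j 0| <= `|y i 0|) ->
  (s <= A.+1)%N -> odd s = odd i ->
  `|y i 0| * W ^+ i.+2 / 2 <= `|sol (pot v) (data y) s i.+2|.
Proof.
move=> yi sA si; have c0 := normr_ge0 (y i 0).
have iN := ltn_ord i.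
have := alternating_row (F := sol (pot v) (data y)) (w := pot v) (t := i) Vb2 hW c0 (pot_le v).
have h1 s' : (s' < A)%N -> `|corners (sol (pot v) (data y)) s' i -
    pot v s'.+1 i.+1 * sol (pot v) (data y) s'.+1 i.+1| <= `|y i 0|.
  by move=> _; rewrite sol_corners subrr normr0.
move/(_ h1); have h2 s' : (s' <= A.+1)%N -> `|sol (pot v) (data y) s' i| <= 2 * `|y i 0| * W ^+ i.
  by move=> ?; apply: sol_data_le => //; clear -iN; lia.
have h3 s' : (s' <= A.+1)%N -> `|sol (pot v) (data y) s' i.+1| <= 2 * `|y i 0| * W ^+ i.+1.
  by move=> ?; apply: sol_data_le => //; clear -iN; lia.
move/(_ h2 h3 (odd s) s./2); rewrite odd_double_half => /(_ sA).
rewrite (sol_left _ _ _ (leq_b1 (odd s))) oddb si /= negbK eqxx /= data_i.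
set a := sol _ _ _ _ => h.
have : `|(-1) ^+ s./2 * (y i 0 * W ^+ i.+2)| = `|y i 0| * W ^+ i.+2.
  by rewrite normrM normrX normrN1 expr1n mul1r normrM [X in _ * X]ger0_norm // exprn_ge0 // (ltW W0).
set b := _ * (_ * _) in h * => hb.
have : `|b| <= `|a - b| + `|a| by rewrite -{1}(subKr a b) [leRHS]addrC ler_normB.
rewrite hb; move: h; set Z := _ * W ^+ _; lra.
Qed.

Lemma top_formE v s y : (top_form v s *m y) 0 0 =
  sol (pot v) (data y) s (top_row N s) + sol (pot v) (data y) s.+2 (top_row N s).
Proof.
rewrite /data !sol_sum -big_split /= mxE; apply: eq_bigr => i _.
by rewrite mxE mulrC mulrDr.
Qed.

Lemma top_form_le v s i : (s < A)%N -> `|top_form v s 0 i| <= 4 * W ^+ N.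
Proof.
move=> sA.
have -> : top_form v s 0 i = (top_form v s *m (delta_mx i 0 : 'cV_ _)) 0 0.
  by rewrite -colE [RHS]mxE.
rewrite top_formE.
have d1 j : `|(delta_mx i 0 : 'cV[R]_N.-2) j 0| <= 1.
  by rewrite mxE; case: (_ && _); rewrite ?normr1 ?normr0.
have Ts := top_row_le N s.
have WT : W ^+ top_row N s <= W ^+ N by rewrite ler_eXn2l // W1.
have a1 := @sol_data_le v _ _ s (top_row N s) ler01 d1 (leq_trans (ltnW sA) (leqnSn _)) Ts.
have a2 := @sol_data_le v _ _ s.+2 (top_row N s) ler01 d1 sA Ts.
apply: (le_trans (ler_normD _ _)); lra.
Qed.

(** The sites in the first [n] columns; these sets form the filtration along
    which the bits are revealed. *)
Definition cols (n : nat) : pred X :=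
  fun q => `[< exists s t, [/\ (0 < s <= n)%N, ~~ odd (s + t) & q = site s t] >].

Lemma pot_dep n v v' s : (forall q, cols n q -> v q = v' q) -> (0 < s <= n)%N ->
  pot v s =1 pot v' s.
Proof.
move=> vv' sn t; rewrite /pot; case: ifPn => // st; rewrite vv' //.
by apply/asboolP; exists s, t.
Qed.

Lemma cols_notin n s t : (n < s)%N -> ~~ odd (s + t) -> ~~ cols n (site s t).
Proof.
move=> ns st; apply/asboolPn => -[s' [t' [s'n st' /(site_inj st st')[e _]]]].
by move: s'n; rewrite -e; lia.
Qed.

Lemma top_form_dep v v' s : (forall q, cols s.+1 q -> v q = v' q) ->
  top_form v s = top_form v' s.
Proof.
move=> vv'; apply/rowP => i; rewrite !mxE.
rewrite (@sol_dep_col _ (pot v) (pot v') _ s) ?(@sol_dep_col _ (pot v) (pot v') _ s.+2) // => s' hs';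
  apply: (pot_dep vv'); lia.
Qed.

Lemma strip_fail_dep v v' :
  (forall s t, (0 < s <= A)%N -> (0 < t < N)%N -> ~~ odd (s + t) ->
     v (site s t) = v' (site s t)) ->
  strip_fail v -> strip_fail v'.
Proof.
move=> vv' [S [y [hS yle yi ytop]]]; exists S, y; split=> // s sS.
suff <- : top_form v s = top_form v' s by apply: ytop.
have hp s' t' : (0 < s' < s.+2)%N -> (0 < t' < N)%N -> pot v s' t' = pot v' s' t'.
  move=> hs ht; rewrite /pot; case: ifPn => // st; rewrite vv' //.
  by have := ltn_ord s; clear -hs; lia.
have hT t' : (t' < top_row N s)%N -> (t' < N)%N by move/leq_trans; apply; exact: top_row_le.
apply/rowP => i; rewrite !mxE; congr (_ + _); apply: sol_dep => s' t' hs ht; apply: hp.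
- by clear -hs; lia.
- by case/andP: ht => -> /hT.
- by [].
- by case/andP: ht => -> /hT.
Qed.

(** Re-randomizing the bit at a point of the leading row changes the value at
    the top by a definite amount. *)
Lemma two_values v y (i : 'I_N.-2) s : (forall j, `|y j 0| <= `|y i 0|) ->
  1 <= `|y i 0| -> (s < A)%N -> odd s.+1 = odd i ->
  1 <= `|(top_form (upd v (site s.+1 i.+2) false) s *m y) 0 0| \/
  1 <= `|(top_form (upd v (site s.+1 i.+2) true) s *m y) 0 0|.
Proof.
move=> yi y1 sA si; set p := site _ _.
set v0 := upd v p false; set v1 := upd v p true.
have iN := ltn_ord i.
have par : ~~ odd (s.+1 + i.+2) by rewrite oddD si /= negbK addbb.
have agree q : q != p -> v0 q = v1 q by rewrite /v0 /v1 /upd => /negbTE ->.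
have hw s' : (0 < s' <= s)%N -> pot v0 s' =1 pot v1 s'.
  move=> hs'; apply: (pot_dep (n := s)) => // q; apply: contraTeq => qp.
  case: (eqVneq q p) => [->|/agree e]; last by rewrite e eqxx in qp.
  exact: cols_notin.
have hw1 t : t != i.+2 -> pot v0 s.+1 t = pot v1 s.+1 t.
  move=> ti; rewrite /pot; case: ifPn => // st; rewrite agree //.
  by apply: contraNneq ti => /(site_inj st par)[_ ->].
have [j jT] := top_row_above iN si.
have e := sol_site (data y) (tau := i.+2) j isT hw hw1.
have pv : pot v1 s.+1 i.+2 - pot v0 s.+1 i.+2 = Vb.
  rewrite /pot (negbTE par) /v0 /v1 /upd -/p eqxx mul1r mul0r; ring.
have lead : `|y i 0| * W ^+ i.+2 / 2 <= `|sol (pot v0) (data y) s.+1 i.+2|.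
  by apply: leading_row => //; rewrite ltnS ltnW.
have Wi : 2 <= W ^+ i.+2.
  rewrite exprS; have : 1 <= W ^+ i.+1 by rewrite exprn_ege1 // (ltW W1).
  move: W72; nra.
(* Only column [s + 1] differs, and only at the leading site, so the change of the
   top is the change of the potential times the leading value. *)
have diff : 2 <= `|(top_form v1 s *m y) 0 0 - (top_form v0 s *m y) 0 0|.
  rewrite !top_formE (@sol_dep_col _ (pot v0) (pot v1) _ s) //; last first.
    by move=> s' hs'; apply: hw; clear -hs'; lia.
  rewrite opprD addrACA subrr add0r jT e pv ger0_norm; last by move: Vb2; lra.
  have lead1 : 1 <= `|sol (pot v0) (data y) s.+1 i.+2|.
    have : 1 * 2 <= `|y i 0| * W ^+ i.+2 by rewrite ler_pM.
    move: lead; set Z := `|y i 0| * _; lra.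
  have : 2 * 1 <= Vb * `|sol (pot v0) (data y) s.+1 i.+2| by rewrite ler_pM.
  by rewrite mulr1.
have tri := ler_normB ((top_form v1 s *m y) 0 0) ((top_form v0 s *m y) 0 0).
case: (lerP 1 `|(top_form v0 s *m y) 0 0|) => [|h0]; first by left.
right; move: (le_trans diff tri) h0; set a := `|_|; set b := `|_|; lra.
Qed.

Definition at_step (S : {set 'I_A}) s := oapp (fun a => a \in S) false (insub s : option 'I_A).

(** A vector [iw.2] with leading coordinate [iw.1] may be probed at column [s] if it
    passes the tests collected in [B] and if the site that its leading row meets
    in column [s + 1] carries a free bit. *)
Definition admissible (S : {set 'I_A}) (B : 'M[R]_N.-2) s (iw : 'I_N.-2 * 'cV[R]_N.-2) :=
  [/\ at_step S s, odd s.+1 = odd iw.1,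
     site s.+1 iw.1.+2 \in L, forall j, `|(B *m iw.2) j 0| <= 1
   & (forall j, `|iw.2 j 0| <= `|iw.2 iw.1 0|) /\ 1 <= `|iw.2 iw.1 0|].

Definition probe S B s : option ('I_N.-2 * 'cV[R]_N.-2) :=
  if pselect (exists iw, admissible S B s iw) is left h then Some (projT1 (cid h))
  else None.

(** The row to be replaced is one for which the determinant grows; it exists by
    [setrow_gain] whenever the probed vector has a large image. *)
Definition absorb (B : 'M[R]_N.-2) (r : 'rV[R]_N.-2) : 'M[R]_N.-2 :=
  if [pick j | W ^+ (4 * N).-1 * `|\det B| <= `|\det (setrow B j r)|] is Some j
  then setrow B j r else B.

(** The adaptive elimination. In a state [(B, k, c)] the matrix [B] collects tests
    that a tiny top forces a vector to pass, [k] counts the tests added and [c] the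
    columns probed. *)
Definition step S v s (st : 'M[R]_N.-2 * nat * nat) :=
  let: (B, k, c) := st in
  if probe S B s is Some iw then
    if 1 <= `|(top_form v s *m iw.2) 0 0|
    then (absorb B (W ^+ (4 * N) *: top_form v s), k.+1, c.+1) else (B, k, c.+1)
  else st.

Fixpoint state S v n : 'M[R]_N.-2 * nat * nat :=
  if n is n'.+1 then step S v n' (state S v n') else (1%:M, 0%N, 0%N).

(** A test that is added multiplies the weight by [2 / 3], a probe without effect by
    [4 / 3]: the mean is [1] if both are equally likely. *)
Definition weight (st : 'M[R]_N.-2 * nat * nat) : R :=
  (1 / 2) ^+ st.1.2 * (4 / 3) ^+ st.2.

Lemma weight_ge0 st : 0 <= weight st.
Proof. by rewrite mulr_ge0 // exprn_ge0 //; lra. Qed.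

Lemma probe_some S B s iw : probe S B s = Some iw -> admissible S B s iw.
Proof.
by rewrite /probe; case: pselect => // h [<-]; case: (cid h).
Qed.

Lemma probe_none S B s iw : admissible S B s iw -> probe S B s <> None.
Proof. by move=> h; rewrite /probe; case: pselect => // -[]; exists iw. Qed.

Lemma state_dep S n : dep_on (cols n) (fun v => state S v n).
Proof.
elim: n => [//|n IH] v v' vv' /=.
have -> : state S v n = state S v' n.
  apply: IH => q /asboolP[s [t [sn st ->]]]; apply: vv'.
  by apply/asboolP; exists s, t; split=> //; clear -sn; lia.
by rewrite /step (top_form_dep vv').
Qed.

(** The supermartingale property. The vector probed at column [n] depends only on
    the columns up to [n]; given all bits but the one on its leading row, one of
    the two values of that bit adds a test, by [two_values]. *)
Lemma avg_weight_step S n v : (n < A)%N ->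
  avg L (fun v => weight (state S v n.+1)) v <= avg L (fun v => weight (state S v n)) v.
Proof.
move=> nA.
pose pk v := probe S (state S v n).1.1 n.
have split_pk (h : (X -> bool) -> R) v' : h v' =
    (if pk v' is None then h v' else 0) +
    \sum_(i : 'I_N.-2) (if omap fst (pk v') == Some i then h v' else 0).
  case: (pk v') => [[i w]|] /=; last by rewrite big1 ?addr0.
  rewrite add0r (bigD1 i) //= eqxx big1 ?addr0 // => j ji.
  by case: eqP => // -[e]; rewrite e eqxx in ji.
rewrite (funext (split_pk (fun v => weight (state S v n.+1)))).
rewrite (funext (split_pk (fun v => weight (state S v n)))).
rewrite !avgD !avg_sum lerD //.
  apply: avg_le => v'; case e: (pk v') => [//|] /=.
  by rewrite /step; move: e; rewrite /pk; case: (state S v' n) => [[B k] c] /= ->.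
apply: ler_sum => i _.
case: (boolP ((site n.+1 i.+2 \in L) && (odd n.+1 == odd i))) => [|nin]; last first.
  apply: avg_le => v'; case: ifP => [/eqP|//]; case e: (pk v') => [[j w]|] //= -[ij].
  have [_ /= par inL _ _] := probe_some e.
  by rewrite -ij inL -par eqxx in nin.
case/andP=> inL /eqP par; set p := site _ _ in inL.
have even_p : ~~ odd (n.+1 + i.+2) by rewrite oddD par /= negbK addbb.
have np : ~~ cols n p by apply: cols_notin.
(* Condition on all bits except the one at the leading site [p]. *)
rewrite -[X in X v <= _](avg_avg1 _ inL); apply: avg_le => {}v.
have stu c : state S (upd v p c) n = state S v n by apply: (dep_on_upd _ _ (@state_dep S n)).
have pku c : pk (upd v p c) = pk v by rewrite /pk stu.
rewrite /avg1 !pku; case e: (pk v) => [[j w]|] /=; last by rewrite addr0 mul0r.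
case: eqP => [[ji]|_]; last by rewrite addr0 mul0r.
have [_ _ _ _ /=] := probe_some e; rewrite ji => -[wi w1].
have gt0 := weight_ge0 (state S v n).
have succ c : weight (step S (upd v p c) n (state S (upd v p c) n)) = weight (state S v n) *
   (if 1 <= `|(top_form (upd v p c) n *m w) 0 0| then 2 / 3 else 4 / 3).
  rewrite stu /step; move: e; rewrite /pk; case: (state S v n) => [[B k] c'] /= ->.
  by rewrite /weight; case: ifP => _ /=; rewrite !exprS; field.
rewrite !succ.
have [h|h] := two_values v wi w1 nA par; rewrite -/p in h; rewrite h.
  by case: ifP => _; lra.
by case: ifP => _; lra.
Qed.

Lemma avg_weight S n v : (n <= A)%N -> avg L (fun v => weight (state S v n)) v <= 1.
Proof.
elim: n => [|n IH] nA.
  have -> : (fun v => weight (state S v 0)) = (fun=> 1).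
    by apply/funext => ?; rewrite /weight /= !expr0 mulr1.
  by rewrite avg_cst.
by apply: (le_trans (avg_weight_step _ _ nA)); apply: IH; rewrite ltnW.
Qed.

Lemma absorb_gain S B s iw r : probe S B s = Some iw -> \det B != 0 ->
  1 <= `|(r *m iw.2) 0 0| ->
  exists j, absorb B (W ^+ (4 * N) *: r) = setrow B j (W ^+ (4 * N) *: r) /\
    W ^+ (4 * N).-1 * `|\det B| <= `|\det (setrow B j (W ^+ (4 * N) *: r))|.
Proof.
move=> e dB r1; have [_ _ _ Bw _] := probe_some e.
have iN := ltn_ord iw.1; have m0 : (0 < N.-2)%N by lia.
have [|j hj] := setrow_gain (r := W ^+ (4 * N) *: r) (x := W ^+ (4 * N).-1) m0 dB Bw.
  rewrite -scalemxAl mxE normrM ger0_norm ?exprn_ge0 ?(ltW W0) //.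
  have -> : W ^+ (4 * N) = W * W ^+ (4 * N).-1 by rewrite -exprS prednK // muln_gt0; clear -m0; lia.
  have Wk : 0 <= W ^+ (4 * N).-1 by rewrite exprn_ge0 // (ltW W0).
  have mW : (N.-2)%:R <= W.
    by apply: le_trans NW; rewrite ler_nat; clear; lia.
  by rewrite -[leLHS]mulr1 ler_pM // ?mulr_ge0 // ler_wpM2r.
rewrite /absorb; case: pickP => [j' hj'|/(_ j)]; last by rewrite hj.
by exists j'.
Qed.

(** The rows of the matrix stay bounded by a fixed power of [W], while each
    test multiplies the determinant by [W ^ (4 N - 1)]. *)
Lemma state_det S v n : (n <= A)%N ->
  W ^+ ((4 * N).-1 * (state S v n).1.2) <= `|\det (state S v n).1.1| /\
  forall i j, `|(state S v n).1.1 i j| <= 4 * W ^+ (5 * N).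
Proof.
have one_le k : 1 <= W ^+ k by rewrite exprn_ege1 // (ltW W1).
elim: n => [|n IH] nA.
  rewrite /= muln0 expr0 det1 normr1; split=> // i j; rewrite mxE.
  have := one_le (5 * N)%N; case: (_ == _); rewrite ?normr1 ?normr0; lra.
have := IH (ltnW nA); rewrite /= /step.
case: (state S v n) => [[B k] c] /= [dB eB].
case e: (probe S B n) => [iw|] //=; case: ifP => // s1 /=.
have dB0 : \det B != 0.
  by rewrite -normr_gt0; apply: lt_le_trans dB; apply: lt_le_trans (one_le _).
have [j [-> hj]] := absorb_gain e dB0 s1; split.
  by apply: le_trans hj; rewrite mulnS exprD ler_pM2l // exprn_gt0 // W0.
move=> a b; rewrite mxE; case: eqP => // _; rewrite mxE normrM ger0_norm ?exprn_ge0 ?(ltW W0) //.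
have -> : (5 * N = 4 * N + N)%N by clear; lia.
by rewrite exprD mulrCA ler_pM2l ?exprn_gt0 ?W0 // top_form_le.
Qed.

(** A matrix of size [N - 2] with entries at most [4 W ^ (5 N)] has determinant less
    than [W ^ ((4 N - 1) k)] as soon as [k] exceeds [2 (N - 2)]. *)
Lemma successes_le S v n : (n <= A)%N -> (0 < N.-2)%N ->
  ((state S v n).1.2 <= 2 * N.-2)%N.
Proof.
move=> nA m0; have [dB eB] := state_det S v nA.
have := le_trans dB (det_le eB).
have fW : (N.-2`!)%:R <= W ^+ N.-2.
  have mW : (N.-2)%:R <= W by apply: le_trans NW; rewrite ler_nat; clear; lia.
  apply: (@le_trans _ _ ((N.-2)%:R ^+ N.-2)); last by rewrite lerXn2r ?nnegrE ?(ltW W0).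
  rewrite -natrX ler_nat; elim: (N.-2) => // -[//|q] IH.
  by rewrite factS expnS leq_mul // (leq_trans IH) // leq_exp2r.
set k := (state S v n).1.2; set q := N.-2 in m0 fW *.
move=> h; have : W ^+ ((4 * N).-1 * k) <= W ^+ (q * (5 * N + 2)).
  apply: (le_trans h).
  have -> : (q * (5 * N + 2) = q + (5 * N).+1 * q)%N by clear; lia.
  have C0 : 0 <= 4 * W ^+ (5 * N) by rewrite mulr_ge0 // exprn_ge0 // (ltW W0).
  rewrite exprD; apply: ler_pM => //; first by rewrite exprn_ge0.
  rewrite [leRHS]exprM lerXn2r ?nnegrE ?exprn_ge0 ?(ltW W0) //.
  have Ck : 0 <= W ^+ (5 * N) by rewrite exprn_ge0 // (ltW W0).
  have W4 : 4 <= W by apply: le_trans W72; rewrite ler_nat.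
  by rewrite [leRHS]exprS; exact: ler_wpM2r.
rewrite ler_eXn2l ?W1 // => {}h.
have qN : (q + 2 = N)%N by rewrite /q; clear -m0; lia.
move: h m0; rewrite -qN; clear; nia.
Qed.

Section BadSolution.
Variables (S : {set 'I_A}) (v : X -> bool) (y : 'cV[R]_N.-2) (i : 'I_N.-2).
Hypothesis yle : forall j, `|y j 0| <= 1.
Hypothesis yi : `|y i 0| = 1.
Hypothesis ytop : forall s : 'I_A, s \in S -> `|(top_form v s *m y) 0 0| <= W ^- (4 * N).

(** The rows of [B] are rows of the identity or top sums enlarged by [W ^ (4 N)];
    the bad vector is at most [1] on both kinds. *)
Lemma tests_passed n : (n <= A)%N -> forall j, `|((state S v n).1.1 *m y) j 0| <= 1.
Proof.
elim: n => [|n IH] nA j; first by rewrite /= mul1mx.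
have := IH (ltnW nA); rewrite /= /step.
case: (state S v n) => [[B k] c] /= By.
case e: (probe S B n) => [iw|] //=; case: ifP => // s1 /=.
rewrite /absorb; case: pickP => //= a _; rewrite mxE.
under eq_bigr do rewrite mxE.
case: (j == a); last by have := By j; rewrite mxE.
under eq_bigr do rewrite mxE -mulrA.
rewrite -mulr_sumr normrM ger0_norm ?exprn_ge0 ?(ltW W0) //.
have [inS _ _ _ _] := probe_some e.
move: inS; rewrite /at_step; case: insubP => //= s _ sn /ytop; rewrite sn mxE => h.
by rewrite -(@mulfV _ (W ^+ (4 * N))) ?expf_neq0 ?gt_eqF ?W0 // ler_pM2l // exprn_gt0 // W0.
Qed.

(** The bad vector itself passes all tests and can be probed at every column of the
    right parity, unless its top is not tiny there or its row meets a frozen site. *)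
Lemma columns_used n : (n <= A)%N ->
  (\sum_(s < n) [&& at_step S s, odd s.+1 == odd i & site s.+1 i.+2 \in L] <= (state S v n).2)%N.
Proof.
elim: n => [|n IH] nA; first by rewrite big_ord0.
rewrite big_ord_recr /=.
have := IH (ltnW nA); have := @tests_passed n (ltnW nA); rewrite /step.
case: (state S v n) => [[B k] c] /= By h.
case: and3P => [[hS /eqP par inL]|_] /=; last first.
  rewrite addn0; case: (probe S B n) => [iw|] //=; case: ifP => _ /=; exact: leqW.
rewrite addn1; case e: (probe S B n) => [iw|]; first by case: ifP.
by exfalso; apply: (@probe_none S B n (i, y)) => //; split=> //=; rewrite yi.
Qed.

End BadSolution.

(* Frozen sites are rare on every row, so that a row cannot hide from the probes. *)
Hypothesis sparseL : forall i : 'I_N.-2,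
  (\sum_(s < A) ((odd s.+1 == odd i) && (site s.+1 i.+2 \notin L)))%:R <= A%:R / 1000 :> R.

(** At least [A / 4] probes with at most [2 (N - 2) <= A / 500] tests make the
    weight exponentially large: [ln (4 / 3) / 4 > 1 / 17] leaves room for the tests. *)
Lemma weight_bad S v y : (#|~: S|)%:R <= A%:R / 1000 :> R ->
  (forall i, `|y i 0| <= 1) -> (exists i, `|y i 0| = 1) ->
  (forall s : 'I_A, s \in S -> `|(top_form v s *m y) 0 0| <= W ^- (4 * N)) ->
  1 <= expR (- (A%:R / 17)) * weight (state S v A).
Proof.
have key (a b c n : R) : 0 <= a -> c <= 2 * n -> n <= a / 1000 -> a / 4 <= b ->
  0 <= - (a / 17) + (c * -1 + b * (1 / 4)) by move=> *; lra.
move=> hS yle [i yi] ytop.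
have used := columns_used yle yi ytop (leqnn A).
have m0 : (0 < N.-2)%N by apply: leq_ltn_trans (ltn_ord i).
have succ := successes_le S v (leqnn A) m0.
have par := columns_of_parity A (odd i).
have count : (\sum_(s < A) (odd s.+1 == odd i) <=
   \sum_(s < A) [&& at_step S s, odd s.+1 == odd i & site s.+1 i.+2 \in L] + #|~: S| +
   \sum_(s < A) ((odd s.+1 == odd i) && (site s.+1 i.+2 \notin L)))%N.
  have -> : #|~: S| = (\sum_(s < A) (s \notin S))%N.
    by rewrite -sum1_card big_mkcond; apply: eq_bigr => s _; rewrite inE; case: (s \in S).
  rewrite -!big_split /=; apply: leq_sum => s _; rewrite /at_step valK /=.
  by case: (s \in S); case: (_ == _); case: (_ \in L).
have cA : A%:R / 4 <= ((state S v A).2)%:R :> R.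
  have A3 : 3000 <= A%:R :> R.
    have : 3%:R <= N%:R :> R by rewrite ler_nat; clear -m0; lia.
    by move: NA; lra.
  have := sparseL i; move: hS.
  have : A%:R <= ((\sum_(s < A) (odd s.+1 == odd i)).*2 + 1)%:R :> R by rewrite ler_nat.
  have : ((\sum_(s < A) (odd s.+1 == odd i))%N%:R : R) <= ((state S v A).2)%:R + (#|~: S|)%:R +
     (\sum_(s < A) ((odd s.+1 == odd i) && (site s.+1 i.+2 \notin L)))%:R.
    by rewrite -!natrD ler_nat; apply: (leq_trans count); rewrite !leq_add2r.
  rewrite natrD -mul2n natrM; lra.
rewrite /weight.
have h43 : expR (1 / 4) <= 4 / 3 :> R.
  rewrite -[4 / 3]invrK -[expR _]invrK lef_pV2 ?posrE ?invr_gt0 ?expR_gt0 //.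
  by rewrite -expRN; apply: le_trans (expR_ge1Dx _); lra.
have h12 : expR (-1) <= 1 / 2 :> R.
  rewrite -[1 / 2]invrK expRN lef_pV2 ?posrE ?expR_gt0 ?invr_gt0 //.
  by apply: le_trans (expR_ge1Dx _); lra.
have e1 : expR (- 1) ^+ (2 * N.-2) <= (1 / 2) ^+ (state S v A).1.2 :> R.
  apply: (@le_trans _ _ ((1 / 2) ^+ (2 * N.-2))).
    by rewrite lerXn2r ?nnegrE ?expR_ge0.
  by apply: ler_wiXn2l => //; lra.
have e2 : expR (1 / 4) ^+ (state S v A).2 <= (4 / 3) ^+ (state S v A).2 :> R.
  by rewrite lerXn2r ?nnegrE ?expR_ge0.
apply: (@le_trans _ _ (expR (- (A%:R / 17)) *
    (expR (- 1) ^+ (2 * N.-2) * expR (1 / 4) ^+ (state S v A).2))); last first.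
  by rewrite ler_pM2l ?expR_gt0 // ler_pM // exprn_ge0 // expR_ge0.
rewrite -!expRM_natl -!expRD -[leLHS]expR0 ler_expR.
by apply: (key _ _ _ _ _ _ NA cA) => //; rewrite natrM ler_wpM2l // ler_nat; clear; lia.
Qed.

(** Markov's inequality for [exp (- 7 |~: S|)], whose sum over all sets factorizes:
    sets that omit at most one place in a thousand are few. *)
Lemma few_sets : (\sum_(S : {set 'I_A} | (#|~: S|)%:R <= A%:R / 1000 :> R) 1 : R) <=
  expR (A%:R * (15 / 1000)).
Proof.
apply: (@le_trans _ _ (\sum_(S : {set 'I_A}) expR (7 * A%:R / 1000) * (expR (- 7) ^+ #|~: S|))).
  rewrite [leLHS]big_mkcond; apply: ler_sum => S _; case: ifP => [hS|_]; last first.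
    by rewrite mulr_ge0 ?exprn_ge0 ?expR_ge0.
  by rewrite -expRM_natl -expRD -[leLHS]expR0 ler_expR; lra.
rewrite -mulr_sumr.
have -> : \sum_(S : {set 'I_A}) expR (- 7) ^+ #|~: S| = (1 + expR (- 7)) ^+ A :> R.
  rewrite -[in RHS](card_ord A) -prodr_const.
  rewrite (eq_bigl predT) // bigA_distr; apply: eq_bigr => S _.
  rewrite (bigID (mem S)) /= big1 ?mul1r; last by move=> s ->.
  rewrite -prodr_const; apply: eq_big => [s|s hs]; first by rewrite inE.
  by move: hs; rewrite inE => /negbTE ->.
have e7 : expR (- 7) <= 1 / 128 :> R.
  have h2 : 2 <= expR 1 :> R by apply: le_trans (expR_ge1Dx _); lra.
  have h7 : 2 ^+ 7 <= expR 7 :> R.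
    have -> : 7 = 7%:R * 1 :> R by lra.
    by rewrite expRM_natl lerXn2r ?nnegrE ?expR_ge0.
  by rewrite expRN div1r lef_pV2 ?posrE ?expR_gt0 //; move: h7; rewrite !exprS; lra.
apply: (@le_trans _ _ (expR (7 * A%:R / 1000) * expR (1 / 128) ^+ A)).
  rewrite ler_pM2l ?expR_gt0 // lerXn2r ?nnegrE ?addr_ge0 ?expR_ge0 //.
  by apply: le_trans (expR_ge1Dx _); lra.
rewrite -expRM_natl -expRD ler_expR; have : 0 <= A%:R :> R by []; lra.
Qed.

(** Large deviations for the strip: with at most [2 * (N - 2)] successes among
    at least [A / 4] fair trials, a bad solution is exponentially unlikely. *)
Lemma strip_fail_unlikely v :
  avg L (fun v => (`[< strip_fail v >])%:R) v <= expR (- (A%:R / 25)) :> R.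
Proof.
apply: (@le_trans _ _ (avg L (fun v => \sum_(S : {set 'I_A} | (#|~: S|)%:R <= A%:R / 1000 :> R)
    expR (- (A%:R / 17)) * weight (state S v A)) v)).
  apply: avg_le => v'; case: asboolP => [[S [y [hS yle yi ytop]]]|_] /=; last first.
    by apply: sumr_ge0 => S _; rewrite mulr_ge0 ?expR_ge0 ?weight_ge0.
  rewrite (bigD1 S) //= ler_wpDr ?(weight_bad hS yle yi ytop) //.
  by apply: sumr_ge0 => S' _; rewrite mulr_ge0 ?expR_ge0 ?weight_ge0.
rewrite avg_sum.
apply: (@le_trans _ _ (expR (- (A%:R / 17)) *
    \sum_(S : {set 'I_A} | (#|~: S|)%:R <= A%:R / 1000 :> R) 1)).
  rewrite mulr_sumr; apply: ler_sum => S _; rewrite avgZ ler_pM2l ?expR_gt0 //.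
  exact: avg_weight.
apply: (@le_trans _ _ (expR (- (A%:R / 17)) * expR (A%:R * (15 / 1000)))).
  by rewrite ler_pM2l ?expR_gt0 // few_sets.
rewrite -expRD ler_expR; have : 0 <= A%:R :> R by []; lra.
Qed.

End RandomStrip.

(** * Solutions on a strip with small top *)

Section StripControl.
Variables (R : realType) (X : eqType) (site : nat -> nat -> X).

Definition top_bad A N (F : nat -> nat -> R) (M : R) : {set 'I_A} :=
  [set s : 'I_A | ~~ ((`|F s (top_row N s)| <= M) && (`|F s.+2 (top_row N s)| <= M))].

Lemma pot_norm (Vb lam lam0 : R) v s t : 2 <= Vb -> 0 <= lam0 <= 8 -> `|lam - lam0| <= 1 ->
  `|pot site Vb lam v s t| <= 4 * Vb.
Proof.
move=> Vb2 /andP[l0 l8]; rewrite ler_norml => /andP[l1 l2].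
rewrite /pot ler_norml; apply/andP.
by case: ifP => _; [|case: (v _)]; rewrite ?mul1r ?mul0r ?addr0; split; lra.
Qed.

(** A solution on a strip, known on the bottom rows and small at most places of
    the top rows, differs from its leading part (the solution with energy [lam0]
    and zero bottom) by an error that is negligible if the solution is large;
    so it is controlled unless the strip fails. *)
Lemma strip_control A N (Vb lam0 lam W M : R) v F :
  2 <= Vb -> 0 <= lam0 <= 8 -> 18 * A.+2%:R * Vb <= W -> (2 <= N)%N ->
  `|lam - lam0| <= W ^- (8 * N) -> 0 < M ->
  ~ strip_fail site A N Vb lam0 W v ->
  (forall s t, (s < A)%N -> (t.+2 <= N)%N ->
     corners F s t = pot site Vb lam v s.+1 t.+1 * F s.+1 t.+1) ->
  (forall s t, odd (s + t) -> F s t = 0) ->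
  (forall s t, (s <= A.+1)%N -> (t <= 1)%N -> `|F s t| <= M) ->
  (#|top_bad A N F M|)%:R <= A%:R / 1000 :> R ->
  forall s t, (s <= A.+1)%N -> (t < N)%N -> `|F s t| <= M * W ^+ (8 * N).
Proof.
move=> Vb2 lam08 hW N2 hlam M0 nofail eqF Fodd Fbot Ftop.
have A2 : 2 <= A.+2%:R :> R by rewrite ler_nat.
have W72 : 72 <= W by nra.
have W36 : 36 * Vb <= W by nra.
have W1 : 1 < W by lra.
have W0 : 0 < W by lra.
have WN0 k : 0 < W ^+ k by rewrite exprn_gt0.
have one_le k : 1 <= W ^+ k by rewrite exprn_ege1 // ltW.
have leW j k : (j <= k)%N -> W ^+ j <= W ^+ k by move=> jk; rewrite ler_weXn2l // ltW.
have three_le k : (0 < k)%N -> 36 <= W ^+ k.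
  by move=> k0; apply: le_trans (leW 1%N k k0); rewrite expr1; lra.
have lam1 : `|lam - lam0| <= 1.
  by apply: (le_trans hlam); rewrite invf_le1.
have potl s t : `|pot site Vb lam v s t| <= 4 * Vb by apply: pot_norm lam08 lam1.
have pot0 s t : `|pot site Vb lam0 v s t| <= 4 * Vb.
  by apply: pot_norm lam08 _ => //; rewrite subrr normr0.
(* The unknowns are the values of [F] on the two left columns. *)
pose y : 'cV[R]_N.-2 := \col_i (F (odd i) i.+2 / W ^+ i.+2).
have Fleft (Y : R) : M <= Y -> (forall i, `|y i 0| <= Y) ->
    forall s t, (s <= 1)%N -> (t <= N.-1)%N -> `|F s t| <= Y * W ^+ t.
  move=> MY yY s t s1 tN; have Y0 : 0 <= Y by apply: le_trans MY; exact: ltW.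
  case: (leqP t 1) => t1.
    apply: (le_trans (Fbot s t _ t1)); first by case: s s1 => [|[|]].
    by apply: (le_trans MY); rewrite ler_peMr.
  have [ht|ht] := boolP (odd (s + t)); first by rewrite Fodd // normr0 mulr_ge0 // ltW.
  have hi : (t.-2 < N.-2)%N by clear -t1 tN; lia.
  have [j e] : exists j : 'I_N.-2, t = j.+2 by exists (Ordinal hi); rewrite /=; clear -t1; lia.
  have := yY j; rewrite mxE normrM normfV (gtr0_norm (WN0 _)) ler_pdivrMr //.
  rewrite e; congr (`|F _ _| <= _).
  move: ht; rewrite e oddD /= negbK; case: s s1 => [|[|//]] _; by case: (odd j).
have Fbound (Y : R) : M <= Y -> (forall i, `|y i 0| <= Y) ->
    forall s t, (s <= A.+1)%N -> (t <= N.-1)%N -> `|F s t| <= 2 * Y * W ^+ t.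
  move=> MY yY; have Y0 : 0 <= Y by apply: le_trans MY; exact: ltW.
  apply: (strip_bound Vb2 hW Y0 potl) => [s t sA tN|s t sA t1|]; last exact: Fleft.
    by rewrite eqF ?subrr ?normr0 //; clear -tN; lia.
  exact: (le_trans (Fbot s t sA t1)).
have WNN : 2 * W ^+ N <= W ^+ (2 * N).
  rewrite mul2n -addnn exprD ler_wpM2r ?(ltW (WN0 _)) //.
  by apply: le_trans (three_le N _); [lra | clear -N2; lia].
have [small|] := pselect (forall i, `|y i 0| <= M * W ^+ (6 * N)).
  have MY : M <= M * W ^+ (6 * N) by rewrite ler_peMr // ltW.
  move=> s t sA tN; apply: (le_trans (Fbound _ MY small s t sA _)); first by clear -tN; lia.
  have -> : 2 * (M * W ^+ (6 * N)) * W ^+ t = M * W ^+ (6 * N) * (2 * W ^+ t) by ring.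
  have -> : (8 * N = 6 * N + 2 * N)%N by clear; lia.
  rewrite exprD [leRHS]mulrA ler_wpM2l //; first by rewrite mulr_ge0 // ltW.
  by apply: le_trans WNN; rewrite ler_wpM2l // leW // ltnW.
(* Otherwise the largest unknown [Y] dwarfs the bottom and the error of the energy,
   and the normalized unknowns witness a failure of the strip. *)
move=> /existsNP[i0 /negP]; rewrite -ltNge => big; exfalso; apply: nofail.
pose i := [arg max_(j > i0) `|y j 0|]%O.
have imax j : `|y j 0| <= `|y i 0| by rewrite /i; case: arg_maxP => // k _ /(_ j isT).
set Y := `|y i 0| in imax.
have bigY : M * W ^+ (6 * N) < Y by apply: lt_le_trans big (imax _).
have Y0 : 0 < Y by apply: lt_trans bigY; rewrite mulr_gt0.
have [Z eZ] : exists Z, Z = Y * W ^- (6 * N) by eexists.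
have Z0 : 0 < Z by rewrite eZ mulr_gt0 // invr_gt0.
have MZ : M <= Z by rewrite eZ ler_pdivlMr // ltW.
have MY : M <= Y.
  by apply: (le_trans MZ); rewrite eZ ger_pMr // invf_le1.
have FY := Fbound Y MY imax.
have pert s t : (s <= A.+1)%N -> (t <= N.-1)%N -> `|(lam0 - lam) * F s t| <= Z.
  move=> sA tN; rewrite normrM distrC.
  apply: (@le_trans _ _ (W ^- (8 * N) * (2 * Y * W ^+ N))).
    apply: ler_pM => //; apply: (le_trans (FY s t sA tN)).
    by rewrite ler_wpM2l ?mulr_ge0 ?(ltW Y0) // leW //; clear -tN; lia.
  rewrite mulrC ler_pdivrMr // eZ.
  have -> : (8 * N = 6 * N + 2 * N)%N by clear; lia.
  rewrite exprD mulrA divfK ?gt_eqF // -mulrA mulrCA ler_wpM2l // ltW //.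
(* [E] solves the equation at energy [lam0] up to the error [Z], with no data on the
   left except in the two bottom rows. *)
pose E s t := F s t - sol (pot site Vb lam0 v) (data W y) s t.
have eqE s t : (s < A)%N -> (t.+2 <= N)%N ->
    corners E s t - pot site Vb lam0 v s.+1 t.+1 * E s.+1 t.+1 = (lam0 - lam) * F s.+1 t.+1.
  move=> sA tN; have e1 := eqF s t sA tN.
  have e2 := sol_corners (pot site Vb lam0 v) (data W y) s t.
  have e3 : pot site Vb lam v s.+1 t.+1 = pot site Vb lam0 v s.+1 t.+1 + (lam0 - lam).
    by rewrite /pot; ring.
  move: e1 e2; rewrite e3 /corners /E; set a := sol _ _; set p := pot _ _ _ _ _ _ => e1 e2.
  rewrite mulrBr mulrDl in e1 *; rewrite -e2; lra.
have EZ : forall s t, (s <= A.+1)%N -> (t <= N.-1)%N -> `|E s t| <= 2 * Z * W ^+ t.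
  apply: (strip_bound Vb2 hW (ltW Z0) pot0) => [s t sA tN|s t sA t1|s t s1 tN].
  - rewrite eqE //; last by clear -tN; lia.
    by apply: pert; clear -sA tN; lia.
  - by rewrite /E sol_bottom // subr0; apply: le_trans MZ; apply: Fbot.
  - have Zt : 0 <= Z * W ^+ t by rewrite mulr_ge0 // ltW.
    have [ht|ht] := boolP (odd (s + t)).
      rewrite /E Fodd // sub0r normrN sol_left //.
      by move: ht; rewrite oddD; case: (odd t); case: (odd s); rewrite ?normr0.
    case: (leqP t 1) => t1.
      rewrite /E sol_bottom // subr0; apply: le_trans (_ : Z <= _); last by rewrite ler_peMr // ltW.
      by apply: le_trans MZ; apply: Fbot => //; case: s s1 {ht} => [|[|]].
    have hi : (t.-2 < N.-2)%N by clear -t1 tN; lia.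
    have [j e] : exists j : 'I_N.-2, t = j.+2 by exists (Ordinal hi); rewrite /=; clear -t1; lia.
    have par : odd t = odd s by move: ht; rewrite oddD; case: (odd t); case: (odd s).
    rewrite /E sol_left // par eqxx t1 /= e data_i mxE divfK ?gt_eqF //.
    suff -> : nat_of_bool (odd j) = s by rewrite subrr normr0 -e.
    have -> : odd j = odd t by rewrite e /= negbK.
    by rewrite par; case: s s1 {par ht} => [|[|]].
exists (~: top_bad A N F M), (Y^-1 *: y); split.
- by rewrite finset.setCK.
- by move=> j; rewrite mxE normrM normfV [X in X^-1]gtr0_norm // ler_pdivrMl // mulr1.
- by exists i; rewrite mxE normrM normfV [X in X^-1]gtr0_norm // mulVf // gt_eqF.
move=> s; rewrite !inE negbK => /andP[F1 F2].
rewrite -scalemxAr mxE normrM normfV [X in X^-1]gtr0_norm // ler_pdivrMl // top_formE.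
set T := top_row N s; have TN : (T <= N)%N := top_row_le N s.
have sA : (s < A)%N := ltn_ord s.
(* The bound on [E] stops at row [N - 1]; on row [N] the equation still bounds sums
   of two neighbours. *)
have Esum : `|E s T + E s.+2 T| <= Z * W ^+ N.
  case: (leqP T N.-1) => TN1.
    have e1 := EZ s T (leq_trans (ltnW sA) (leqnSn _)) TN1; have e2 := EZ s.+2 T sA TN1.
    apply: (le_trans (ler_normD _ _)).
    have : W * (Z * W ^+ T) <= Z * W ^+ N.
      by rewrite mulrCA -exprS ler_wpM2l ?(ltW Z0) // leW //; clear -TN1 N2; lia.
    have ZT : 0 <= Z * W ^+ T by rewrite mulr_ge0 // ltW.
    have : 36 * (Z * W ^+ T) <= W * (Z * W ^+ T).
      by rewrite ler_wpM2r // (le_trans _ W72) // ler_nat.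
    move: ZT.
    move: e1 e2; rewrite -!mulrA; set a := Z * _; set b := Z * W ^+ N; set c := W * a; clear; lra.
  have -> : T = N.-2.+2 by clear -TN TN1 N2; lia.
  have N22 : (N.-2.+2 <= N)%N by clear -N2; lia.
  have e := eqE s N.-2 sA N22.
  have -> : E s N.-2.+2 + E s.+2 N.-2.+2 = pot site Vb lam0 v s.+1 N.-2.+1 * E s.+1 N.-2.+1 +
      (lam0 - lam) * F s.+1 N.-2.+1 - E s N.-2 - E s.+2 N.-2.
    by rewrite -e /corners; ring.
  have e1 : `|pot site Vb lam0 v s.+1 N.-2.+1 * E s.+1 N.-2.+1| <= 4 * Vb * (2 * Z * W ^+ N.-2.+1).
    by rewrite normrM ler_pM // EZ //; clear -sA N2; lia.
  have e2 : `|(lam0 - lam) * F s.+1 N.-2.+1| <= Z by apply: pert; clear -sA N2; lia.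
  have e3 : `|E s N.-2| <= 2 * Z * W ^+ N.-2 by apply: EZ; clear -sA N2; lia.
  have e4 : `|E s.+2 N.-2| <= 2 * Z * W ^+ N.-2 by apply: EZ; clear -sA N2; lia.
  have tri (a b c d : R) : `|a + b - c - d| <= `|a| + `|b| + `|c| + `|d|.
    rewrite (le_trans (ler_normB _ _)) // lerD2r.
    by rewrite (le_trans (ler_normB _ _)) // lerD2r ler_normD.
  apply: (le_trans (tri _ _ _ _)).
  have -> : (N = N.-2.+2)%N by clear -N2; lia.
  move: e1 e2 e3 e4; rewrite /= !exprS -!mulrA; set a := `|_|; set b := `|_|; set c := `|_|; set d := `|_|.
  set P := W ^+ N.-2 => e1 e2 e3 e4.
  have P1 : 1 <= P by apply: one_le.
  have ZP : Z <= Z * P by rewrite ler_peMr // ltW.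
  have h1 : 36 * (Z * P) <= Z * (W * P).
    have P0 : 0 <= P by apply: le_trans P1.
    by rewrite mulrCA; apply: ler_wpM2l; rewrite ?(ltW Z0) // ler_wpM2r // (le_trans _ W72) // ler_nat.
  have p2 : 0 <= Z * (W * P) by rewrite mulr_ge0 ?(ltW Z0) // mulr_ge0 ?(ltW W0) // (le_trans _ P1).
  have h2 : 36 * (Vb * (Z * (W * P))) <= Z * (W * (W * P)).
    by rewrite mulrA [X in _ <= X]mulrCA ler_wpM2r.
  have h3 : 2 * (Z * (W * P)) <= Vb * (Z * (W * P)) by rewrite ler_wpM2r.
  have h0 : 0 <= Z * P by rewrite mulr_ge0 ?(ltW Z0) // (le_trans _ P1).
  move: e1 e2 e3 e4 ZP h1 h2 h3 h0; clear.
  set x1 := Z * P; set x2 := Z * (W * P); set x3 := Z * (W * (W * P)); lra.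
have -> : sol (pot site Vb lam0 v) (data W y) s T + sol (pot site Vb lam0 v) (data W y) s.+2 T =
   F s T + F s.+2 T - (E s T + E s.+2 T) by rewrite /E; ring.
apply: (@le_trans _ _ (2 * M + Z * W ^+ N)).
  apply: (le_trans (ler_normB _ _)); rewrite lerD //.
  by apply: (le_trans (ler_normD _ _)); rewrite mulr_natl mulr2n lerD.
apply: (@le_trans _ _ (Z * W ^+ (2 * N))).
  apply: (@le_trans _ _ (2 * Z + Z * W ^+ N)); first by rewrite lerD2r ler_pM2l.
  rewrite mulrC -mulrDr ler_wpM2l ?(ltW Z0) //; apply: le_trans WNN.
  have := three_le N (leq_trans (isT : 0 < 2)%N N2); set a := W ^+ N; clear; lra.
rewrite eZ -mulrA ler_wpM2l ?(ltW Y0) //.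
have -> : (6 * N = 4 * N + 2 * N)%N by clear; lia.
by rewrite exprD invfM mulfVK ?gt_eqF.
Qed.

End StripControl.

(** * Tilted coordinates *)

(** Tilted coordinates: the point with [x + y = S] and [x - y = T]. *)
Definition tilted (S T : int) : Z2 := (((S + T) %/ 2)%Z, ((S - T) %/ 2)%Z).

Definition even_sum (S T : int) : bool := (2 %| S + T)%Z.

Lemma tilted_step S T : even_sum S T ->
  [/\ tilted (S + 1) (T + 1) = tilted S T + (1, 0),
      tilted (S - 1) (T - 1) = tilted S T - (1, 0),
      tilted (S + 1) (T - 1) = tilted S T + (0, 1) &
      tilted (S - 1) (T + 1) = tilted S T - (0, 1)].
Proof.
rewrite /even_sum => ST.
split; apply/eqP; rewrite -pair_eqE /= /tilted /=; apply/andP; split; apply/eqP => /=; lia.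
Qed.

Lemma l1_tilted (S T : int) : even_sum S T -> l1_norm (tilted S T) = Num.max `|S| `|T|.
Proof. by rewrite /even_sum /l1_norm /tilted /= => ST; lia. Qed.

Lemma tilted_sum S T : even_sum S T -> (tilted S T).1 + (tilted S T).2 = S.
Proof. by rewrite /even_sum /tilted /= => ST; lia. Qed.

Lemma tilted_diff S T : even_sum S T -> (tilted S T).1 - (tilted S T).2 = T.
Proof. by rewrite /even_sum /tilted /= => ST; lia. Qed.

Lemma tiltedK (a : Z2) : tilted (a.1 + a.2) (a.1 - a.2) = a.
Proof. by case: a => x y; rewrite /tilted /=; congr pair; lia. Qed.

Lemma neighborsE (a : Z2) : [set b | neighbor a b] =
  [set` [:: a + (1, 0); a - (1, 0); a + (0, 1); a - (0, 1)]].
Proof.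
apply/seteqP; split=> b; rewrite /= /neighbor /l1_norm; case: a b => x y [z t] /=.
  move=> h; rewrite !inE -!pair_eqE /= /pair_eq /=; lia.
rewrite !inE -!pair_eqE /= /pair_eq /=; lia.
Qed.

Lemma sum_neighbors (R : realType) (u : Z2 -> R) a :
  \sum_(b \in [set b | neighbor a b]) u b =
  u (a + (1, 0)) + u (a - (1, 0)) + u (a + (0, 1)) + u (a - (0, 1)).
Proof.
rewrite neighborsE -fsbig_seq /=; last first.
  case: a => x y; rewrite !inE -!pair_eqE /= /pair_eq /=; lia.
by rewrite !big_cons big_nil addr0 !addrA.
Qed.

(** In tilted coordinates the four neighbours of a point are the corners of the
    cell around it. *)
Lemma schrodinger_tilted (R : realType) (V u : Z2 -> R) (lam : R) (p : Z2) S T :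
  even_sum S T -> schrodinger V u (p + tilted S T) = lam * u (p + tilted S T) ->
  u (p + tilted (S + 1) (T + 1)) + u (p + tilted (S - 1) (T - 1)) +
  u (p + tilted (S + 1) (T - 1)) + u (p + tilted (S - 1) (T + 1)) =
  (4 + V (p + tilted S T) - lam) * u (p + tilted S T).
Proof.
move=> ST; rewrite /schrodinger /laplacian sum_neighbors.
have [-> -> -> ->] := tilted_step ST; rewrite !addrA => h.
lra.
Qed.

(** * Strips beside a tilted square *)

Definition ball (p : Z2) (r : nat) (a : Z2) : bool := l1_norm (a - p) <= r%:Z.

(** The four ways of laying a strip next to a tilted square: [d.1] tells whether
    its rows are the diagonals [x + y = const], [d.2] whether they are counted
    downwards. *)
Definition turn (d : bool * bool) (sg tau : int) : int * int :=
  let tau' := if d.2 then - tau else tau in if d.1 then (tau', sg) else (sg, tau').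

Definition turned (d : bool * bool) (p : Z2) (sg tau : int) : Z2 :=
  p + tilted (turn d sg tau).1 (turn d sg tau).2.

(** The lattice point at place [(s, t)] of the strip of half width [hw] whose row
    [0] is at signed distance [base] from [p]. *)
Definition strip_site d p (hw base s t : nat) : Z2 :=
  turned d p (s%:Z - hw%:Z) (base%:Z + t%:Z).

Definition row_of (d : bool * bool) (p a : Z2) : int :=
  let b := a - p in
  let r := if d.1 then b.1 + b.2 else b.1 - b.2 in if d.2 then - r else r.

Definition col_of (d : bool * bool) (p a : Z2) : int :=
  let b := a - p in if d.1 then b.1 - b.2 else b.1 + b.2.

Lemma even_turn d sg tau : even_sum (turn d sg tau).1 (turn d sg tau).2 = even_sum sg tau.
Proof. by rewrite /even_sum /turn; case: d => -[] -[] /=; lia. Qed.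

Lemma row_of_turned d p sg tau : even_sum sg tau -> row_of d p (turned d p sg tau) = tau.
Proof.
rewrite -(even_turn d) /row_of /turned (addrC p) addrK => e.
rewrite tilted_sum // tilted_diff // /turn; case: d {e} => -[] -[] /=; lia.
Qed.

Lemma col_of_turned d p sg tau : even_sum sg tau -> col_of d p (turned d p sg tau) = sg.
Proof.
rewrite -(even_turn d) /col_of /turned (addrC p) addrK => e.
rewrite tilted_sum // tilted_diff // /turn; case: d {e} => -[] -[] /=; lia.
Qed.

Lemma turned_of d p a : turned d p (col_of d p a) (row_of d p a) = a.
Proof.
rewrite /turned -[RHS](subrK p) [RHS]addrC; congr (p + _).
rewrite /row_of /col_of /turn; move: (a - p) => b.
by case: d => -[] -[] /=; rewrite ?opprK tiltedK.
Qed.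

Lemma even_of d p a : even_sum (col_of d p a) (row_of d p a).
Proof. by rewrite /even_sum /row_of /col_of; case: d => -[] -[] /=; lia. Qed.

Lemma ball_turned d p r sg tau : even_sum sg tau ->
  ball p r (turned d p sg tau) = (Num.max `|sg| `|tau| <= r%:Z).
Proof.
rewrite -(even_turn d) /ball /turned (addrC p) addrK => e.
rewrite l1_tilted // /turn; case: d {e} => -[] -[] /=; lia.
Qed.

Lemma ball_of d p r a : ball p r a = (Num.max `|col_of d p a| `|row_of d p a| <= r%:Z).
Proof. by rewrite -{1}(turned_of d p a) ball_turned // even_of. Qed.

Lemma strip_even hw base s t : ~~ odd (hw + base) -> ~~ odd (s + t) ->
  even_sum (s%:Z - hw%:Z) (base%:Z + t%:Z).
Proof. by rewrite /even_sum; lia. Qed.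

Lemma strip_site_inj d p hw base : ~~ odd (hw + base) ->
  forall s t s' t', ~~ odd (s + t) -> ~~ odd (s' + t') ->
  strip_site d p hw base s t = strip_site d p hw base s' t' -> s = s' /\ t = t'.
Proof.
move=> hb s t s' t' st st' e.
have e1 := congr1 (col_of d p) e; have e2 := congr1 (row_of d p) e.
rewrite /strip_site !col_of_turned ?strip_even // in e1.
rewrite /strip_site !row_of_turned ?strip_even // in e2.
lia.
Qed.

Lemma strip_site_row d p hw base s t : ~~ odd (hw + base) -> ~~ odd (s + t) ->
  row_of d p (strip_site d p hw base s t) = (base + t)%:Z.
Proof. by move=> hb st; rewrite row_of_turned ?strip_even //; lia. Qed.

Lemma strip_site_ball d p hw base s t r : ~~ odd (hw + base) -> ~~ odd (s + t) ->
  (s <= 2 * hw)%N -> (hw <= r)%N -> (base + t <= r)%N -> ball p r (strip_site d p hw base s t).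
Proof. by move=> hb st sh hr bt; rewrite ball_turned ?strip_even //; lia. Qed.

Lemma ball_le p r r' a : (r <= r')%N -> ball p r a -> ball p r' a.
Proof. by move=> rr'; rewrite /ball => /le_trans; apply; lia. Qed.

Section Extension.
Variable R : realType.

(** Points of odd parity are off the lattice; giving them the value [0] keeps the
    equation on all cells. *)
Definition on_strip (u : Z2 -> R) (site : nat -> nat -> Z2) s t : R :=
  if odd (s + t) then 0 else u (site s t).

Lemma corners_turned (V u : Z2 -> R) (lam : R) d p sg tau : even_sum sg tau ->
  schrodinger V u (turned d p sg tau) = lam * u (turned d p sg tau) ->
  u (turned d p (sg - 1) (tau - 1)) + u (turned d p (sg - 1) (tau + 1)) +
  u (turned d p (sg + 1) (tau - 1)) + u (turned d p (sg + 1) (tau + 1)) =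
  (4 + V (turned d p sg tau) - lam) * u (turned d p sg tau).
Proof.
move=> st; rewrite /turned => /schrodinger_tilted; rewrite even_turn => /(_ st) <-.
rewrite /turn; case: d => -[] -[] /=; rewrite ?opprD ?opprK; ring.
Qed.

Lemma on_strip_corners (V u : Z2 -> R) (Vb lam : R) (v : Z2 -> bool) d p hw base s t :
  ~~ odd (hw + base) ->
  (~~ odd (s + t) -> let a := strip_site d p hw base s.+1 t.+1 in
     schrodinger V u a = lam * u a /\ V a = (v a)%:R * Vb) ->
  corners (on_strip u (strip_site d p hw base)) s t =
  pot (strip_site d p hw base) Vb lam v s.+1 t.+1 *
  on_strip u (strip_site d p hw base) s.+1 t.+1.
Proof.
move=> hb hyp; rewrite /corners /on_strip /pot !addSn !addnS /= !negbK.
case: ifPn => [_|st]; first by rewrite !addr0 mulr0.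
have [heq Va] := hyp st.
have ev : even_sum (s.+1%:Z - hw%:Z) (base%:Z + t.+1%:Z) by apply: strip_even => //; lia.
have := corners_turned ev heq.
rewrite -/(strip_site d p hw base s.+1 t.+1) Va.
have -> : s.+1%:Z - hw%:Z - 1 = s%:Z - hw%:Z by lia.
have -> : s.+1%:Z - hw%:Z + 1 = s.+2%:Z - hw%:Z by lia.
have -> : base%:Z + t.+1%:Z - 1 = base%:Z + t%:Z by lia.
have -> : base%:Z + t.+1%:Z + 1 = base%:Z + t.+2%:Z by lia.
rewrite -!/(strip_site d p hw base _ _) => ->.
by rewrite [4 - lam + _]addrAC.
Qed.

Lemma count_inj (A : nat) (P : pred nat) (f : nat -> Z2) (Q : pred Z2) (r : seq Z2) :
  (forall s, (s < A)%N -> P s -> f s \in r /\ Q (f s)) ->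
  (forall s s', P s -> P s' -> f s = f s' -> s = s') ->
  (\sum_(s < A) P s <= count Q r)%N.
Proof.
move=> fr finj.
have -> : (\sum_(s < A) P s = size (seq.filter P (iota 0 A)))%N.
  rewrite size_filter -sum1_count -(big_mkord xpredT (fun s => nat_of_bool (P s))).
  by rewrite /index_iota subn0 [RHS]big_mkcond; apply: eq_bigr => s _; case: (P s).
rewrite -(size_map f) -size_filter; apply: uniq_leq_size.
  rewrite map_inj_in_uniq ?filter_uniq ?iota_uniq // => s s'.
  by rewrite !mem_filter => /andP[Ps _] /andP[Ps' _]; apply: finj.
move=> a /mapP[s]; rewrite mem_filter mem_iota add0n => /andP[Ps /= sA] ->.
by have [fsr Qfs] := fr s sA Ps; rewrite mem_filter fsr Qfs.
Qed.

End Extension.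

(** * Failure at a point and a scale *)

(** The width by which the tilted square grows, about [h / 3000]; it is even, so
    that all strips have the same parity. *)
Definition bstep (h : nat) : nat := ((h %/ 100) %/ 60).*2.

(** The strips with [d.1] are laid beside the square when it has already been
    widened in the other direction. *)
Definition half_width (d : bool * bool) h := if d.1 then (h + bstep h)%N else h.
Definition strip_len d h := (2 * half_width d h).-1.
(** The [bstep h] candidates for the height of the strip use disjoint pairs of
    top rows, so that one of them meets few exceptional sites. *)
Definition strip_height h i := (bstep h + 3 + 2 * i)%N.
Definition strip_at d p h := strip_site d p (half_width d h) h.-2.

Lemma sum_count_disjoint (b : nat) (Q : nat -> pred Z2) (P : pred Z2) (r : seq Z2) :
  (forall i a, Q i a -> P a) -> (forall i j a, Q i a -> Q j a -> i = j) ->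
  (\sum_(i < b) count (Q i) r <= count P r)%N.
Proof.
move=> QP disj; elim: r => [|a r IH] /=; first by rewrite big1.
rewrite big_split leq_add //=.
have [[i ib]|nq] := pselect (exists i : 'I_b, Q i a).
  rewrite (bigD1 i) //= ib (QP _ _ ib) big1 // => j ji.
  case e: (Q j a) => //; exfalso; move/eqP: ji; apply; apply/val_inj.
  exact: disj e ib.
rewrite big1 // => i _; case e: (Q i a) => //; exfalso; apply: nq; by exists i.
Qed.

Section Growth.
Variable R : realType.

Lemma bstep_prop h : 12000 <= h%:R :> R ->
  [/\ (0 < bstep h)%N, ~~ odd (bstep h), 3000 * (bstep h)%:R <= h%:R :> R,
      h%:R <= 6000 * (bstep h)%:R :> R & (5 <= h)%N].
Proof.
move=> h0; rewrite /bstep.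
have [h1 h2] : (100 * (h %/ 100) <= h < 100 * (h %/ 100) + 100)%N /\
    (60 * (h %/ 100 %/ 60) <= h %/ 100 < 60 * (h %/ 100 %/ 60) + 60)%N by split; lia.
move: h1 h2; set q := (h %/ 100)%N; set k := (q %/ 60)%N => /andP[a1 a2] /andP[a3 a4].
have {}a1 : 100 * q%:R <= h%:R :> R by rewrite -natrM ler_nat.
have {}a2 : h%:R + 1 <= 100 * q%:R + 100 :> R by rewrite -natrM -natrD natr1 ler_nat.
have {}a3 : 60 * k%:R <= q%:R :> R by rewrite -natrM ler_nat.
have {}a4 : q%:R + 1 <= 60 * k%:R + 60 :> R by rewrite -natrM -natrD natr1 ler_nat.
have k1 : 1 < k%:R :> R by lra.
have e : k.*2%:R = 2 * k%:R :> R by rewrite -mul2n natrM.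
rewrite e; split; [|by rewrite odd_double|lra|lra|].
  by rewrite double_gt0 -(ltr_nat R); lra.
by rewrite -(ler_nat R); lra.
Qed.

Lemma strip_dims d h i : 12000 <= h%:R :> R -> (i < bstep h)%N ->
  [/\ ~~ odd (half_width d h + h.-2), (half_width d h <= 2 * h)%N,
      (h.-2 + strip_height h i <= 2 * h)%N, (strip_height h i <= 4 * bstep h)%N &
      (strip_height h i <= h)%N] /\
  [/\ (strip_len d h).+2 = (2 * half_width d h).+1, (h <= half_width d h)%N,
      (strip_height h i)%:R <= (strip_len d h)%:R / 1000 :> R,
      (2 <= strip_height h i)%N & h%:R <= (strip_len d h)%:R :> R].
Proof.
move=> h0 ib; have [b0 bo b3 b6 h5] := bstep_prop h0.
have b3n : (3000 * bstep h <= h)%N by rewrite -(ler_nat R) natrM.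
have b3n' : (300 * bstep h <= h)%N.
  by apply: leq_trans b3n; rewrite leq_mul2r orbC.
have hw0 : (h <= half_width d h)%N by rewrite /half_width; case: ifP => _; rewrite ?leq_addr.
have hA : (2 * h <= (strip_len d h).+1)%N.
  rewrite /strip_len prednK ?leq_mul2l //; move: hw0 h5; clear; lia.
have hAR : 2 * h%:R <= (strip_len d h)%:R + 1 :> R by rewrite -natrM natr1 ler_nat.
have hN : (strip_height h i <= 3 * bstep h + 1)%N by rewrite /strip_height; clear -ib; lia.
have hNR : (strip_height h i)%:R <= 3 * (bstep h)%:R + 1 :> R.
  by rewrite -natrM natr1 -addn1 ler_nat.
split; split.
- rewrite /half_width; case: ifP => _; move: bo h5; clear; lia.
- rewrite /half_width; move: b3n'; clear; case: ifP => _; lia.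
- move: hN b3n' h5; clear; lia.
- move: hN b0; clear; lia.
- move: hN b3n' b0; clear; lia.
- rewrite /strip_len; move: hw0 h5; clear; lia.
- by [].
- move: h0 hAR hNR b3; clear; lra.
- by rewrite /strip_height; clear; lia.
- move: h0 hAR; clear; lra.
Qed.

Variables (Vb lam0 : R).

Definition strip_scale d h : R := 18 * (strip_len d h).+2%:R * Vb.

Definition fail_at p h v := exists d i, (i < bstep h)%N /\
  strip_fail (strip_at d p h) (strip_len d h) (strip_height h i) Vb lam0 (strip_scale d h) v.

(** All strips at scale [h] lie in the ball of radius [2 h]: failures at distant
    points are independent. *)
Lemma fail_at_dep p h v v' : 12000 <= h%:R :> R ->
  (forall a, ball p (2 * h) a -> v a = v' a) -> fail_at p h v -> fail_at p h v'.
Proof.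
move=> h0 vv' [d [i [ib f]]]; exists d, i; split=> //.
have [[par hw2 hN _ _] [lenE _ _ _ _]] := strip_dims d h0 ib.
apply: strip_fail_dep f => s t sA tN st; apply: vv'; apply: strip_site_ball => //.
  by move: sA lenE; clear; lia.
by move: tN hN; clear; lia.
Qed.

(** A union bound over the [4 * bstep h] strips. *)
Lemma fail_at_unlikely p h L (Th : seq Z2) v :
  2 <= Vb -> 0 <= lam0 <= 8 -> 12000 <= h%:R :> R ->
  (forall a, ball p (2 * h) a -> a \notin L -> a \in Th) ->
  (forall d r, (count (fun a => ball p (2 * h) a && (row_of d p a == r)) Th)%:R <= h%:R / 20000 :> R) ->
  avg L (fun v => (`[< fail_at p h v >])%:R) v <= expR (- (h%:R / 30)) :> R.
Proof.
move=> Vb2 lam08 h0 hL hTh.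
have [b0 bo b3 b6 h5] := bstep_prop h0.
apply: (@le_trans _ _ (avg L (fun v => \sum_(d : bool * bool) \sum_(i < bstep h)
    (`[< strip_fail (strip_at d p h) (strip_len d h) (strip_height h i) Vb lam0 (strip_scale d h) v >])%:R) v)).
  apply: avg_le => v'; case: asboolP => [[d [i [ib f]]]|_] /=; last first.
    by apply: sumr_ge0 => d _; apply: sumr_ge0.
  rewrite (bigD1 d) //= (bigD1 (Ordinal ib)) //=.
  case: asboolP => // _; rewrite -addrA ler_wpDr // addr_ge0 //.
    exact: sumr_ge0.
  by apply: sumr_ge0 => d' _; apply: sumr_ge0.
rewrite avg_sum.
apply: (@le_trans _ _ (\sum_(d : bool * bool) \sum_(i < bstep h) expR (- (h%:R / 25)))).
  apply: ler_sum => d _; rewrite avg_sum; apply: ler_sum => i _.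
  have ib := ltn_ord i.
  have [[par hw2 hN _ _] [lenE hwh NA _ hA]] := strip_dims d h0 ib.
  apply: (@le_trans _ _ (expR (- ((strip_len d h)%:R / 25)))); last first.
    by rewrite ler_expR; move: hA; clear; lra.
  apply: strip_fail_unlikely => //; first exact: strip_site_inj.
  move=> j; apply: (@le_trans _ _ (h%:R / 20000)); last by move: hA h0; clear; lra.
  apply: le_trans (hTh d (h.-2 + j.+2)%N%:Z); rewrite ler_nat.
  apply: (@count_inj _ (fun s => (odd s.+1 == odd j) && (strip_at d p h s.+1 j.+2 \notin L))
     (fun s => strip_at d p h s.+1 j.+2)).
    move=> s sA /andP[/eqP sj nL].
    have ev : ~~ odd (s.+1 + j.+2) by rewrite oddD sj /= negbK addbb.
    have inb : ball p (2 * h) (strip_at d p h s.+1 j.+2).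
      apply: strip_site_ball => //; first by move: sA lenE; clear; lia.
      by have := ltn_ord j; move: hN; clear; lia.
    split; first exact: hL.
    by rewrite inb /= strip_site_row.
  move=> s s' /andP[/eqP sj _] /andP[/eqP sj' _] e.
  have [] // : s.+1 = s'.+1 /\ j.+2 = j.+2.
    by apply: strip_site_inj e => //; rewrite oddD ?sj ?sj' /= negbK addbb.
  by move=> [].
rewrite !sumr_const card_ord card_prod card_bool -mulrnA -[leLHS]mulr_natl.
apply: (@le_trans _ _ (expR (1 / 750 * h%:R) * expR (- (h%:R / 25)))).
  rewrite ler_pM2r ?expR_gt0 //; apply: le_trans (expR_ge1Dx _).
  have : (bstep h * (2 * 2))%:R <= 1 + 1 / 750 * h%:R :> R.
    by rewrite (_ : 2 * 2 = 4)%N // natrM; move: b3; clear; lra.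
  exact.
by rewrite -expRD ler_expR; move: h0; clear; lra.
Qed.

End Growth.

(** * Growth of a tilted square *)

Section GoodHeight.
Variable R : realType.

(** Pigeonhole on the exceptional sites [Bd], whose number is of order [h ^ 2] times
    a small constant, and row by row counting for the frozen sites [Th]. *)
Lemma good_height d p h (u : Z2 -> R) (M : R) (Bd Th : seq Z2) :
  12000 <= h%:R :> R -> 1 <= M ->
  (forall a, ball p (2 * h) a -> a \notin Bd -> a \notin Th -> `|u a| <= 1) ->
  (count (ball p (2 * h)) Bd)%:R <= h%:R ^+ 2 / (6000 * 5000) :> R ->
  (forall d r, (count (fun a => ball p (2 * h) a && (row_of d p a == r)) Th)%:R <= h%:R / 20000 :> R) ->
  exists2 i, (i < bstep h)%N & (#|top_bad (strip_len d h) (strip_height h i)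
    (on_strip u (strip_at d p h)) M|)%:R <= (strip_len d h)%:R / 1000 :> R.
Proof.
move=> h0 M1 hu hBd hTh.
have [b0 bo b3 b6 h5] := bstep_prop h0.
pose r0 i := (h.-2 + (strip_height h i).-1)%N%:Z.
pose Q i a := ball p (2 * h) a && ((row_of d p a == r0 i) || (row_of d p a == r0 i + 1)).
have [i ib hi] : exists2 i, (i < bstep h)%N &
    (bstep h * count (Q i) Bd <= count (ball p (2 * h)) Bd)%N.
  have sumQ : (\sum_(i < bstep h) count (Q i) Bd <= count (ball p (2 * h)) Bd)%N.
    apply: sum_count_disjoint; first by move=> i a /andP[].
    move=> i j a /andP[_ h1] /andP[_ h2].
    by move: h1 h2; rewrite /r0 /strip_height; clear; lia.
  apply/not_exists2P => nex; move: sumQ; apply/negP; rewrite -ltnNge.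
  have big i : (i < bstep h)%N -> (count (ball p (2 * h)) Bd < bstep h * count (Q i) Bd)%N.
    by move=> ib; case: (nex i) => // /negP; rewrite -ltnNge.
  rewrite -(ltn_pmul2l b0) big_distrr /=.
  apply: (@leq_trans (bstep h * (count (ball p (2 * h)) Bd).+1)%N).
    by rewrite ltn_pmul2l.
  rewrite -[X in (X * _)%N]card_ord -sum_nat_const; apply: leq_sum => i _; exact: big.
exists i => //.
have [[par hw2 hN _ _] [lenE hwh NA N2 hA]] := strip_dims d h0 ib.
set A := strip_len d h in lenE NA hA *; set N := strip_height h i in hN NA N2 *.
set F := on_strip u _.
have bound (f : nat -> nat) : (forall s, (s < A)%N -> (f s <= A.+1)%N) -> injective f ->
   (forall s, ~~ odd (f s + top_row N s)) ->
   (\sum_(s < A) (M < `|F (f s) (top_row N s)|)%R <= count (Q i) Bd + count (Q i) Th)%N.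
  move=> fA finj fpar; rewrite -count_cat.
  apply: (@count_inj _ (fun s => (M < `|F (f s) (top_row N s)|)%R)
     (fun s => strip_at d p h (f s) (top_row N s))).
    move=> s sA; rewrite /F /on_strip (negbTE (fpar s)) => big.
    have inb : ball p (2 * h) (strip_at d p h (f s) (top_row N s)).
      apply: strip_site_ball => //; first by move: (fA s sA) lenE; clear; lia.
      by have := top_row_le N s; move: hN; clear; lia.
    split.
      rewrite mem_cat; apply/negPn/negP; rewrite negb_or => /andP[nB nT].
      by have := hu _ inb nB nT; rewrite leNgt (le_lt_trans M1 big).
    rewrite /Q inb strip_site_row //= /r0 -/N.
    by rewrite /top_row; case: ifP => _; move: N2; clear; lia.
  move=> s s' _ _ e; apply: finj.
  by have [] := strip_site_inj par (fpar s) (fpar s') e.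
have parT s : odd (top_row N s) = odd s.
  by rewrite /top_row; case: ifP; rewrite oddD; move: N2; clear; case os: (odd s); lia.
(* An exceptional site spoils at most the two sums that contain it. *)
have bad_le : (#|top_bad A N F M| <= 2 * (count (Q i) Bd + count (Q i) Th))%N.
  rewrite mul2n -addnn.
  apply: (@leq_trans (\sum_(s < A) (M < `|F s (top_row N s)|)%R +
     \sum_(s < A) (M < `|F s.+2 (top_row N s)|)%R)%N); last first.
    apply: leq_add.
      by apply: (bound id) => // s; [move=> ?; apply: ltnW; apply: ltnW|rewrite oddD parT addbb].
    by apply: (bound (fun s => s.+2)) => // [s s' []//|s]; rewrite oddD parT /= negbK addbb.
  rewrite -sum1_card big_mkcond -big_split; apply: leq_sum => s _ /=.
  by rewrite inE negb_and -!ltNge; case: (M < _); case: (M < _).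
have cTh : (count (Q i) Th)%:R <= h%:R / 20000 + h%:R / 20000 :> R.
  apply: le_trans (lerD (hTh d (r0 i)) (hTh d (r0 i + 1))).
  rewrite -natrD ler_nat -count_predUI.
  apply: leq_trans (leq_addr _ _); apply: sub_count => a /=.
  by rewrite /Q -andb_orr.
have cBd : (count (Q i) Bd)%:R <= h%:R / 5000 :> R.
  have bpos : 0 < (bstep h)%:R :> R by rewrite ltr0n.
  have hi' : (bstep h)%:R * (count (Q i) Bd)%:R <= h%:R ^+ 2 / (6000 * 5000) :> R.
    by rewrite -natrM; apply: le_trans hBd; rewrite ler_nat.
  rewrite -(ler_pM2l bpos); apply: (le_trans hi').
  have : h%:R * h%:R <= 6000 * (bstep h)%:R * h%:R :> R by rewrite ler_wpM2r.
  rewrite expr2; move: (h%:R * h%:R) => x; rewrite -mulrA [_ * (_ / _)]mulrA.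
  move: (_ * h%:R) => y; clear; lra.
have : (#|top_bad A N F M|)%:R <= 2 * ((count (Q i) Bd)%:R + (count (Q i) Th)%:R) :> R.
  by rewrite -natrD -natrM ler_nat.
by move: cTh cBd hA h0; clear; lra.
Qed.

End GoodHeight.

Section Grow.
Variables (R : realType) (Vb lam0 lam K : R) (v : Z2 -> bool) (V u : Z2 -> R).
Variables (p : Z2) (h : nat) (Bd Th : seq Z2).
Hypothesis Vb2 : 2 <= Vb.
Hypothesis lam08 : 0 <= lam0 <= 8.
Hypothesis h0 : 12000 <= h%:R :> R.
Hypothesis K1 : 1 <= K.
Hypothesis KW : 18 * (5 * h)%:R * Vb <= K.
Hypothesis hlam : `|lam - lam0| <= K ^- (8 * h).
Hypothesis heq : forall a, ball p (2 * h) a ->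
  schrodinger V u a = lam * u a /\ V a = (v a)%:R * Vb.
Hypothesis nofail : ~ fail_at Vb lam0 p h v.
Hypothesis hu : forall a, ball p (2 * h) a -> a \notin Bd -> a \notin Th -> `|u a| <= 1.
Hypothesis hBd : (count (ball p (2 * h)) Bd)%:R <= h%:R ^+ 2 / (6000 * 5000) :> R.
Hypothesis hTh : forall d r,
  (count (fun a => ball p (2 * h) a && (row_of d p a == r)) Th)%:R <= h%:R / 20000 :> R.

(** The strip at a good height covers the part to be added on the side [d], and its
    bottom rows lie in the known part. *)
Lemma extend_side d (M : R) : 1 <= M ->
  (forall a, `|col_of d p a| <= (half_width d h)%:Z -> `|row_of d p a| <= h%:Z -> `|u a| <= M) ->
  forall a, `|col_of d p a| <= (half_width d h)%:Z -> h%:Z <= row_of d p a <= (h + bstep h)%:Z ->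
  `|u a| <= M * K ^+ (32 * bstep h).
Proof.
have V1 : 1 <= Vb by move: Vb2; lra.
have V0 : 0 <= Vb by apply: le_trans V1.
move=> M1 known a ca ra.
have [i ib top] := good_height d h0 M1 hu hBd hTh.
have [[par hw2 hN hN4 hNh] [lenE hwh NA N2 hA]] := strip_dims d h0 ib.
have [b0 bo b3 b6 h5] := bstep_prop h0.
set A := strip_len d h in top lenE NA hA; set N := strip_height h i in top hN hN4 hNh NA N2.
pose W := strip_scale Vb d h.
have hw_le : (half_width d h <= 2 * h)%N by [].
have WK : W <= K.
  apply: le_trans KW; rewrite /W /strip_scale ler_wpM2r //.
  rewrite ler_wpM2l // ler_nat -/A lenE; move: hw_le h5; clear; lia.
have W0 : 0 <= W by rewrite /W /strip_scale !mulr_ge0.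
have W1 : 1 <= W.
  have A1 : 1 <= A.+2%:R :> R by rewrite ler1n.
  have h18 : 1 <= 18 :> R by rewrite ler1n.
  by rewrite /W /strip_scale -/A !mulr_ege1.
have WKN : W ^+ (8 * N) <= K ^+ (8 * N) by rewrite lerXn2r // nnegrE (le_trans W0).
have hl : `|lam - lam0| <= W ^- (8 * N).
  apply: (le_trans hlam); rewrite lef_pV2 ?posrE ?exprn_gt0 ?(lt_le_trans ltr01) //.
  apply: (le_trans WKN); rewrite ler_weXn2l // leq_mul2l hNh orbT //.
have nf : ~ strip_fail (strip_at d p h) A N Vb lam0 W v.
  by move=> f; apply: nofail; exists d, i.
have site_in s t : ~~ odd (s + t) -> (s <= A.+1)%N -> (t <= N)%N ->
    ball p (2 * h) (strip_at d p h s t).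
  move=> st sA tN; apply: strip_site_ball => //; first by move: sA lenE; clear; lia.
  by move: tN hN; clear; lia.
have ctl := strip_control (F := on_strip u (strip_at d p h)) (lam := lam) Vb2 lam08 (lexx W)
  N2 hl (lt_le_trans ltr01 M1) nf.
have : forall s t, (s <= A.+1)%N -> (t < N)%N ->
    `|on_strip u (strip_at d p h) s t| <= M * W ^+ (8 * N).
  apply: ctl => //.
  - move=> s t sA tN; apply: (on_strip_corners (V := V)) => // st.
    apply: heq; apply: site_in; first by rewrite addSn addnS /= negbK.
      by move: sA; clear; lia.
    by move: tN; clear; lia.
  - by move=> s t st; rewrite /on_strip st.
  - move=> s t sA t1; rewrite /on_strip; case: ifPn => st.
      by rewrite normr0 (le_trans ler01).
    have ev : even_sum (s%:Z - (half_width d h)%:Z) (h.-2%:Z + t%:Z) by apply: strip_even.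
    apply: known; rewrite /strip_at /strip_site ?col_of_turned ?row_of_turned //.
      by move: sA lenE; clear; lia.
    by move: t1 h5; clear; lia.
pose s := absz (col_of d p a + (half_width d h)%:Z).
pose t := absz (row_of d p a - h.-2%:Z).
have es : s%:Z = col_of d p a + (half_width d h)%:Z by rewrite /s; move: ca; clear; lia.
have et : t%:Z = row_of d p a - h.-2%:Z by rewrite /t; move: ra h5; clear; lia.
have ea : strip_at d p h s t = a.
  rewrite /strip_at /strip_site es et addrK [h.-2%:Z + _]addrC subrK; exact: turned_of.
have st : ~~ odd (s + t).
  by have := even_of d p a; rewrite /even_sum; move: par es et; clear; lia.
move/(_ s t); rewrite /on_strip (negbTE st) ea => /(_ _ _)/le_trans -> //.
- by move: es ca lenE; clear; lia.
- by rewrite /N /strip_height; move: et ra h5; clear; lia.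
rewrite ler_wpM2l ?(le_trans ler01) //; apply: (le_trans WKN).
by rewrite ler_weXn2l // -[32%N]/(8 * 4)%N -mulnA leq_mul2l hN4 orbT.
Qed.

(** One growth step of a tilted square: first along the diagonals [x - y], both
    ways, then along the other ones. *)
Lemma grow (M : R) : 1 <= M -> (forall a, ball p h a -> `|u a| <= M) ->
  forall a, ball p (h + bstep h) a -> `|u a| <= M * K ^+ (64 * bstep h).
Proof.
move=> M1 known.
set M' := M * K ^+ (32 * bstep h).
have MM' : M <= M' by rewrite ler_peMr ?exprn_ege1 // (le_trans ler01).
have M'1 : 1 <= M' by apply: le_trans MM'.
have known1 a : `|col_of (false, false) p a| <= h%:Z ->
    `|row_of (false, false) p a| <= (h + bstep h)%:Z -> `|u a| <= M'.
  move=> ca ra.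
  have side (d : bool * bool) : ~~ d.1 -> h%:Z <= row_of d p a <= (h + bstep h)%:Z -> `|u a| <= M'.
    case: d => -[] // d2 _ rd; apply: (extend_side (d := (false, d2))) rd => //.
    by move=> a' ca' ra'; apply: known; rewrite (ball_of (false, d2)) ge_max ca' ra'.
  case: (lerP `|row_of (false, false) p a| h%:Z) => [ra'|ra'].
    by apply: le_trans MM'; apply: known; rewrite (ball_of (false, false)) ge_max ca ra'.
  case: (lerP 0 (row_of (false, false) p a)) => r0.
    by apply: (side (false, false)) => //; move: ra ra' r0; clear; lia.
  apply: (side (false, true)) => //; move: ra ra' r0; rewrite /row_of /=; clear; lia.
move=> a; rewrite (ball_of (false, false)) ge_max => /andP[ca ra].
have -> : M * K ^+ (64 * bstep h) = M' * K ^+ (32 * bstep h).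
  by rewrite /M' -mulrA -exprD -mulnDl.
have le_M' : M' <= M' * K ^+ (32 * bstep h).
  by rewrite ler_peMr ?exprn_ege1 // (le_trans ler01).
case: (lerP `|col_of (false, false) p a| h%:Z) => ca'; first by apply: le_trans le_M'; apply: known1.
have side (d : bool * bool) : d.1 -> h%:Z <= row_of d p a <= (h + bstep h)%:Z ->
    `|u a| <= M' * K ^+ (32 * bstep h).
  case: d => -[] // d2 _ rd; apply: (extend_side (d := (true, d2))) rd => //.
  by move=> a'; move: (known1 a'); rewrite /half_width /row_of /col_of /=; case: d2; clear; lia.
case: (lerP 0 (col_of (false, false) p a)) => c0.
  by apply: (side (true, false)) => //; move: ca ca' c0; rewrite /row_of /col_of /=; clear; lia.
by apply: (side (true, true)) => //; move: ca ca' c0; rewrite /row_of /col_of /=; clear; lia.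
Qed.

End Grow.

(** * Counting and covering *)

Lemma ncard_count (A : set Z2) (r : seq Z2) : uniq r -> (forall a, A a -> a \in r) ->
  ncard A = count (fun a => `[< A a >]) r.
Proof.
move=> ur Ar.
have finA : finite_set A.
  by apply: (sub_finite_set (B := [set` r])) => //; exact: finite_seq.
rewrite /ncard -size_filter; apply/eqP; rewrite eqn_leq; apply/andP; split.
  apply: uniq_leq_size; first exact: fset_uniq.
  move=> a; rewrite in_fset_set // inE => Aa.
  by rewrite mem_filter Ar // andbT; apply/asboolP.
apply: uniq_leq_size; first exact: filter_uniq.
move=> a; rewrite mem_filter => /andP[/asboolP Aa _].
by rewrite in_fset_set // inE.
Qed.

Definition square_pts (p : Z2) (r : nat) : seq Z2 :=
  [seq p + (i%:Z - r%:Z, j%:Z - r%:Z) | i <- iota 0 (2 * r).+1, j <- iota 0 (2 * r).+1].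
Arguments square_pts : simpl never.

Definition cube (p : Z2) (r : nat) (a : Z2) : bool := linf_norm (p - a) <= r%:Z.

Lemma size_square_pts p r : size (square_pts p r) = ((2 * r).+1 ^ 2)%N.
Proof. by rewrite size_allpairs !size_iota -mulnn. Qed.

Lemma uniq_square_pts p r : uniq (square_pts p r).
Proof.
apply: allpairs_uniq; rewrite ?iota_uniq // => -[i j] [i' j'] _ _ /addrI [] e1 e2.
by congr (_, _); lia.
Qed.

Lemma mem_square_pts p r a : (a \in square_pts p r) = cube p r a.
Proof.
apply/allpairsP/idP => [[[i j] []]|].
  rewrite !mem_iota /= => hi hj ->; rewrite /cube /linf_norm /=.
  by move: hi hj; clear; case: p => x y /=; lia.
have hmem k : (k < (2 * r).+1)%N -> k \in iota 0 (2 * r).+1 by rewrite mem_iota.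
rewrite /cube /linf_norm /= => h.
exists (absz (a.1 - p.1 + r%:Z), absz (a.2 - p.2 + r%:Z)); split.
- by apply: hmem => /=; move: h; clear; lia.
- by apply: hmem => /=; move: h; clear; lia.
case: a p h => x y [z t] /= h; congr pair => /=; move: h; clear; lia.
Qed.

Lemma ball_cube p r a : ball p r a -> cube p r a.
Proof. by rewrite /ball /cube /l1_norm /linf_norm /=; lia. Qed.

Lemma count_ball_le p r s : uniq s -> (count (ball p r) s <= (2 * r).+1 ^ 2)%N.
Proof.
move=> us; rewrite -(size_square_pts p) -size_filter; apply: uniq_leq_size; first exact: filter_uniq.
by move=> a; rewrite mem_filter mem_square_pts => /andP[/ball_cube].
Qed.

Lemma ball_card_ge p r s : (forall a, ball p r a -> a \in s) -> uniq s -> (r ^ 2 <= count (ball p r) s)%N.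
Proof.
move=> hs us.
pose q := [seq p + (i%:Z - r./2%:Z, j%:Z - r./2%:Z) | i <- iota 0 r, j <- iota 0 r].
have uq : uniq q.
  apply: allpairs_uniq; rewrite ?iota_uniq // => -[i j] [i' j'] _ _ /addrI [] e1 e2.
  by congr (_, _); lia.
have -> : (r ^ 2 = size q)%N by rewrite size_allpairs !size_iota mulnn.
rewrite -size_filter; apply: uniq_leq_size => // a /allpairsP[[i j] []].
rewrite !mem_iota /= => hi hj ea.
have ba : ball p r a.
  by rewrite ea /ball /l1_norm (addrC p) addrK /=; move: hi hj; clear; lia.
by rewrite mem_filter ba hs.
Qed.

Lemma l1_triangle (x y z : Z2) : l1_norm (x - z) <= l1_norm (x - y) + l1_norm (y - z).
Proof. by rewrite /l1_norm /=; lia. Qed.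

Lemma ball_center p r : ball p r p.
Proof. by rewrite /ball subrr. Qed.

Lemma l1_distC (x y : Z2) : l1_norm (x - y) = l1_norm (y - x).
Proof. by rewrite /l1_norm /=; lia. Qed.

Definition meet_balls (r : Z2 -> nat) x y := exists a, ball x (r x) a /\ ball y (r y) a.

(** Vitali: take a ball of largest radius, discard those it meets, repeat. The
    centres discarded lie within twice the radius. *)
Lemma vitali (r : Z2 -> nat) (s : seq Z2) : uniq s ->
  exists s' : seq Z2, [/\ uniq s', {subset s' <= s},
    (forall x y, x \in s' -> y \in s' -> x != y -> ~ meet_balls r x y) &
    (forall x, x \in s -> exists2 y, y \in s' & ball y (2 * r y) x)].
Proof.
move: {2}(size s) (leqnn (size s)) => n; elim: n s => [|n IH] s.
  by rewrite leqn0 size_eq0 => /eqP -> _; exists [::].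
move=> sn us; case: (eqVneq s [::]) => [->|s0]; first by exists [::].
have [y ys ymax] : exists2 y, y \in s & forall x, x \in s -> (r x <= r y)%N.
  elim: s s0 {sn us} => [//|x s IHs] _; case: (eqVneq s [::]) => [->|/IHs[y ys ymax]].
    by exists x; rewrite ?inE // => z; rewrite inE => /eqP ->.
  case: (leqP (r x) (r y)) => xy.
    exists y; first by rewrite inE ys orbT.
    by move=> z; rewrite inE => /orP[/eqP ->//|]; apply: ymax.
  exists x; first by rewrite inE eqxx.
  move=> z; rewrite inE => /orP[/eqP ->//|/ymax h].
  by apply: leq_trans h _; apply: ltnW.
pose s1 := [seq x <- s | ~~ `[< meet_balls r x y >]].
have yy : meet_balls r y y by exists y; rewrite !ball_center.
have [||s' [us' sub' disj' cov']] := IH s1; [|exact: filter_uniq|].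
  rewrite -ltnS; apply: leq_trans sn; rewrite size_filter -(size_map id s) map_id.
  rewrite -[X in (_ < X)%N](count_predC (fun x => `[< meet_balls r x y >])).
  rewrite -[X in (X < _)%N]add0n ltn_add2r -has_count.
  by apply/hasP; exists y => //; apply/asboolP.
have s1P x : x \in s1 -> x \in s /\ ~ meet_balls r x y.
  by rewrite mem_filter => /andP[/asboolPn].
exists (y :: s'); split.
- rewrite /= us' andbT; apply/negP => /sub' /s1P[_]; exact.
- by move=> x; rewrite inE => /orP[/eqP -> //|/sub'/s1P[]].
- have sym a b : meet_balls r a b -> meet_balls r b a by move=> [c []]; exists c.
  move=> a b; rewrite !inE => /orP[/eqP ->|as'] /orP[/eqP ->|bs'] ab.
  + by rewrite eqxx in ab.
  + by move/sym; have [_] := s1P _ (sub' _ bs').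
  + by have [_] := s1P _ (sub' _ as').
  + exact: disj'.
- move=> x xs; have [xy|nxy] := pselect (meet_balls r x y).
    exists y; first by rewrite inE eqxx.
    have [a [ax ay]] := xy; have := ymax x xs; have := l1_triangle x a y.
    by move: ax ay; rewrite /ball (l1_distC a x); clear; lia.
  have [|z zs' zx] := cov' x; first by rewrite mem_filter xs andbT; apply/asboolPn.
  by exists z => //; rewrite inE zs' orbT.
Qed.

Lemma size_le_cover (s s' : seq Z2) (R : Z2 -> nat) :
  (forall x, x \in s -> exists2 y, y \in s' & ball y (R y) x) ->
  (size s <= \sum_(y <- s') count (ball y (R y)) s)%N.
Proof.
move=> cov.
have -> : (\sum_(y <- s') count (ball y (R y)) s = \sum_(x <- s) \sum_(y <- s') ball y (R y) x)%N.
  by rewrite exchange_big /=; apply: eq_bigr => y _; rewrite -sumn_count sumnE big_map.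
rewrite -sum1_size big_seq [leqRHS]big_seq; apply: leq_sum => x xs.
have [y ys' yx] := cov x xs.
by rewrite (perm_big _ (perm_to_rem ys')) big_cons yx.
Qed.

Lemma disjoint_counts (s' : seq Z2) (r : Z2 -> nat) (B : seq Z2) : uniq s' ->
  (forall x y, x \in s' -> y \in s' -> x != y -> ~ meet_balls r x y) ->
  (\sum_(y <- s') count (ball y (r y)) B <= size B)%N.
Proof.
move=> us' disj.
have -> : (\sum_(y <- s') count (ball y (r y)) B = \sum_(b <- B) \sum_(y <- s') ball y (r y) b)%N.
  by rewrite exchange_big /=; apply: eq_bigr => y _; rewrite -sumn_count sumnE big_map.
rewrite -sum1_size; apply: leq_sum => b _.
have [[y ys' yb]|no] := pselect (exists2 y, y \in s' & ball y (r y) b).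
  rewrite (perm_big _ (perm_to_rem ys')) big_cons yb big_seq big1 // => z.
  rewrite (mem_rem_uniq _ us') inE => /andP[zy zs']; case zb: (ball z (r z) b) => //.
  by exfalso; apply: (disj z y zs' ys' zy); exists b.
rewrite big_seq big1 // => y ys'; case yb: (ball y (r y) b) => //.
by exfalso; apply: no; exists y.
Qed.

(** * Regular sets inside tilted squares *)

(** Doubled balls cover, and a doubled ball has at most [25 r ^ 2] lattice points. *)
Lemma vitali_card (s : seq Z2) (r : Z2 -> nat) : uniq s ->
  (forall x, x \in s -> (0 < r x)%N) ->
  exists s' : seq Z2, [/\ uniq s', {subset s' <= s},
    (forall x y, x \in s' -> y \in s' -> x != y -> ~ meet_balls r x y) &
    (size s <= \sum_(y <- s') 25 * r y ^ 2)%N].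
Proof.
move=> us r0; have [s' [us' sub disj cov]] := vitali r us.
exists s'; split=> //.
apply: (leq_trans (size_le_cover cov)); rewrite big_seq [leqRHS]big_seq.
apply: leq_sum => y /sub/r0 ry; apply: (leq_trans (count_ball_le _ _ us)).
rewrite (_ : 25 = 5 ^ 2)%N // -expnMn leq_exp2r //; move: ry; clear; lia.
Qed.

Definition strip_interval (c : int) (r : nat) : set int := [set k | `|k - c| <= r%:Z].

Lemma ball_tilted p r : [set b | ball p r b] =
  tilted_rect (strip_interval (p.1 + p.2) r) (strip_interval (p.1 - p.2) r).
Proof.
apply/seteqP; split=> b; rewrite /tilted_rect /strip_interval /ball /l1_norm /=.
  by move=> h; split; move: h; clear; lia.
by case; clear; lia.
Qed.

Lemma card_strip_interval c c' r : (strip_interval c r #= strip_interval c' r)%card.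
Proof.
have -> : strip_interval c' r = (fun k => k + (c' - c)) @` strip_interval c r.
  apply/seteqP; split=> k; rewrite /strip_interval /=.
    by move=> h; exists (k - (c' - c)); [move: h; clear; lia | rewrite subrK].
  by move=> [k' h <-]; move: h; clear; lia.
rewrite card_eq_sym; apply: inj_card_eq => x y _ _; exact: addIr.
Qed.

(** Balls of the [l1] norm are tilted squares, so regularity speaks about them. *)
Lemma ball_tilted_square p r : tilted_square [set b | ball p r b].
Proof.
exists (strip_interval (p.1 + p.2) r), (strip_interval (p.1 - p.2) r); split.
- by move=> x y; rewrite /strip_interval /= => hx hy z; move: hx hy; clear; lia.
- by move=> x y; rewrite /strip_interval /= => hx hy z; move: hx hy; clear; lia.
- exact: card_strip_interval.
- exact: ball_tilted.
Qed.

Section Covering.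
Variables (R : realType) (eps : R) (a : Z2) (n : nat) (Theta : set Z2).
Hypothesis eps0 : 0 < eps.
Hypothesis eps1 : eps <= 1 / (1000 * 1000).
Hypothesis ThetaQ : Theta `<=` [set b | cube a n b].
Hypothesis regTheta : regular eps Theta [set b | cube a n b].

Let Q := square_pts a n.
Definition theta_pts : seq Z2 := [seq b <- square_pts a n | `[< Theta b >]].

Lemma uniq_Q : uniq Q. Proof. exact: uniq_square_pts. Qed.

Lemma mem_theta b : (b \in theta_pts) = `[< Theta b >].
Proof.
rewrite mem_filter mem_square_pts andb_idr // => /asboolP; exact: ThetaQ.
Qed.

Lemma regular_balls (s' : seq Z2) (r : Z2 -> nat) : uniq s' ->
  (forall x y, x \in s' -> y \in s' -> x != y -> ~ meet_balls r x y) ->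
  (forall y, y \in s' -> forall b, ball y (r y) b -> cube a n b) ->
  (forall y, y \in s' -> ~ sparse eps Theta [set b | ball y (r y) b]) ->
  (\sum_(y <- s') count (ball y (r y)) Q)%:R <= eps * (size Q)%:R.
Proof.
move=> us' disj sub nsp.
have := @regTheta (size s') (fun i => [set b | ball (nth a s' i) (r (nth a s' i)) b]).
have mem (i : 'I_(size s')) : nth a s' i \in s' by rewrite mem_nth.
move=> H; have {}H := H (fun i => ball_tilted_square _ _) (fun i b => sub _ (mem i) b).
have {}H : \sum_(i < size s') (ncard [set b | ball (nth a s' i) (r (nth a s' i)) b])%:R <=
    eps * (ncard [set b | cube a n b])%:R.
  apply: H; last by move=> i; apply: nsp.
  move=> i j ij; apply/seteqP; split=> // b [bi bj].
  apply: (disj _ _ (mem i) (mem j)); last by exists b.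
  by rewrite nth_uniq.
rewrite natr_sum (big_nth a) big_mkord.
have cE (A : pred Z2) : (forall b, A b -> cube a n b) -> ncard [set b | A b] = count A Q.
  move=> Ac; rewrite (ncard_count uniq_Q); last by move=> b /Ac; rewrite mem_square_pts.
  by apply: eq_count => b; rewrite asboolb.
rewrite cE // in H.
rewrite -[size Q](@count_predT _ Q).
have -> : count predT Q = count (cube a n) Q.
  by apply: eq_in_count => b; rewrite mem_square_pts => ->.
apply: le_trans H; apply: ler_sum => i _; rewrite cE //; exact: (sub _ (mem i)).
Qed.

(** A point of [Theta] is a tilted square of side one in which [Theta] is not sparse;
    regularity for these squares bounds the size of [Theta]. *)
Lemma size_theta : (size theta_pts)%:R <= eps * (size Q)%:R.
Proof.
have uT : uniq theta_pts by apply: filter_uniq; exact: uniq_Q.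
have ball0 x b : ball x 0 b -> b = x.
  by case: x b => x1 x2 [b1 b2]; rewrite /ball /l1_norm /= => h; congr pair; move: h; clear; lia.
apply: le_trans (regular_balls (s' := theta_pts) (r := fun=> 0%N) _ _ _ _) => //.
- rewrite ler_nat -sum1_size big_seq [leqRHS]big_seq; apply: leq_sum => x xT.
  rewrite -has_count; apply/hasP; exists x; last exact: ball_center.
  by move: xT; rewrite mem_filter => /andP[].
- by move=> x y _ _ xy [b [/ball0 bx /ball0 bY]]; rewrite -bx -bY eqxx in xy.
- by move=> y yT b /ball0 ->; apply: ThetaQ; apply/asboolP; rewrite -mem_theta.
move=> y yT /(_ true (y.1 + y.2)).
have Ty : Theta y by apply/asboolP; rewrite -mem_theta.
have one (A : set Z2) : A = [set y] -> ncard A = 1%N.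
  move=> ->; rewrite (@ncard_count _ [:: y]) //=; last by move=> b ->; rewrite inE.
  by case: asboolP.
rewrite !one; first by move: eps1; lra.
  apply/seteqP; split=> b; first by case=> _ /ball0.
  by move=> ->; split; [|exact: ball_center].
apply/seteqP; split=> b; first by case=> _ /ball0.
by move=> ->; split; [split|exact: ball_center].
Qed.

Lemma sparse_rows p h : (1 <= h)%N -> (forall b, ball p (2 * h) b -> cube a n b) ->
  sparse eps Theta [set b | ball p (2 * h) b] ->
  forall d r, (count (fun b => ball p (2 * h) b && (row_of d p b == r)) theta_pts)%:R
    <= h%:R / 20000 :> R.
Proof.
move=> h1 sub sp d r.
pose k := (if d.2 then - r else r) + (if d.1 then p.1 + p.2 else p.1 - p.2).
have rowk b : (row_of d p b == r) = `[< Defs.diagonal d.1 k b >].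
  apply/eqP/asboolP; rewrite /row_of /Defs.diagonal /k /=; case: (d) => -[] -[] /=; clear; lia.
have := sp d.1 k.
rewrite (ncard_count uniq_Q); last by move=> b [_ /sub]; rewrite mem_square_pts.
rewrite (ncard_count uniq_Q); last by move=> b [_ /sub]; rewrite mem_square_pts.
have -> : count (fun b => `[< (Defs.diagonal d.1 k `&` Theta `&` [set b | ball p (2 * h) b]) b >]) Q =
   count (fun b => ball p (2 * h) b && (row_of d p b == r)) theta_pts.
  rewrite /theta_pts count_filter; apply: eq_count => b /=; rewrite rowk.
  by apply/asboolP/andP => [[[kb Tb] bb]|[/andP[bb /asboolP kb] /asboolP Tb]]; do ?split=> //;
    [apply/andP; split=> //|]; apply/asboolP.
move=> /le_trans; apply.
have cle : (count (fun b => `[< (Defs.diagonal d.1 k `&` [set b | ball p (2 * h) b]) b >]) Q <= (4 * h).+1)%N.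
  rewrite -size_filter -(size_iota 0 (4 * h).+1) -(size_map (fun b => absz (col_of d p b + (2 * h)%N%:Z))).
  apply: uniq_leq_size.
    rewrite map_inj_in_uniq ?filter_uniq ?uniq_Q // => b c.
    rewrite !mem_filter => /andP[/asboolP[kb bb] _] /andP[/asboolP[kc bc] _] e.
    have eb : row_of d p b = row_of d p c.
      by transitivity r; [|symmetry]; apply/eqP; rewrite rowk; apply/asboolP.
    have ec : col_of d p b = col_of d p c.
      move: bb bc e; rewrite /= !(ball_of d) !ge_max => /andP[bb _] /andP[bc _].
      by move: bb bc; clear; lia.
    by rewrite -(turned_of d p b) -(turned_of d p c) eb ec.
  move=> i /mapP[b]; rewrite mem_filter => /andP[/asboolP[_ bb] _] ->.
  have {bb} : ball p (2 * h) b by [].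
  rewrite (ball_of d) ge_max mem_iota => /andP[bb _].
  by move: bb; clear; lia.
have {}cle : (count (fun b => `[< (Defs.diagonal d.1 k `&` [set b | ball p (2 * h) b]) b >]) Q)%:R <= 5 * h%:R :> R.
  by rewrite -natrM ler_nat; apply: (leq_trans cle); move: h1; clear; lia.
have hh : 0 <= h%:R :> R by [].
have : eps * (5 * h%:R) <= 1 / (1000 * 1000) * (5 * h%:R) by rewrite ler_wpM2r // mulr_ge0.
have : eps * (count (fun b => `[< (Defs.diagonal d.1 k `&` [set b | ball p (2 * h) b]) b >]) Q)%:R <= eps * (5 * h%:R).
  by rewrite ler_wpM2l // ltW.
set c := (count _ _)%:R; set x := h%:R in hh *; set y := eps * c; set z := eps * (5 * x).
lra.
Qed.

End Covering.

(** * From a good starting point to the bound *)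

Section Deterministic.
Variables (R : realType) (C eps Vb lam0 lam K : R) (a : Z2) (n H0 : nat) (Theta : set Z2).
Variables (v : Z2 -> bool) (V u : Z2 -> R) (P0 Bd : seq Z2).
Hypothesis C0 : 0 < C.
Hypothesis eps0 : 0 < eps.
Hypothesis eps1 : eps <= 1 / (1000 * 1000).
Hypothesis ThetaQ : Theta `<=` [set b | cube a n b].
Hypothesis regTheta : regular eps Theta [set b | cube a n b].
Hypothesis H012 : 12000 <= H0%:R :> R.
(* [Bd] stands for the free sites with [|u| > 1], and [P0] for the starting points. *)
Hypothesis Bd_small : (size Bd)%:R <= eps * (size (square_pts a n))%:R.
Hypothesis hu : forall b, cube a n b -> b \notin Bd -> ~ Theta b -> `|u b| <= 1.
Hypothesis H4n : (4 * H0 <= n)%N.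
Hypothesis uP0 : uniq P0.
Hypothesis P0_central : forall p b h, p \in P0 -> (4 * h <= n)%N -> ball p (2 * h) b -> cube a n b.
Hypothesis few_fail : (count (fun p =>
  `[< exists h, [/\ (H0 <= h)%N, (4 * h <= n)%N &
    sparse eps Theta [set b | ball p (2 * h) b] /\ fail_at Vb lam0 p h v] >]) P0)%:R
  <= (size P0)%:R / 2 :> R.
Hypothesis hnum : eps * (size (square_pts a n))%:R *
  (2 * ((2 * H0).+1 ^ 2)%:R + 100 * C + 25) < (size P0)%:R / 2.

Let Q := square_pts a n.

Lemma H0_gt0 : (0 < H0)%N.
Proof. by rewrite -(ltr_nat R); move: H012; lra. Qed.

Lemma count_near (B : seq Z2) :
  (count (fun p => has (ball p H0) B) P0 <= (2 * H0).+1 ^ 2 * size B)%N.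
Proof.
elim: B => [|b B IH] /=; first by rewrite count_pred0.
apply: (@leq_trans (count (ball b H0) P0 + count (fun p => has (ball p H0) B) P0)).
  rewrite -count_predUI; apply: leq_trans (leq_addr _ _); apply: sub_count => p /=.
  by rewrite /ball l1_distC.
by rewrite mulnS leq_add // count_ball_le.
Qed.

(** Disjoint balls that are crowded by [Bd] contain together at most [size Bd] of its
    points; Vitali's lemma passes from these balls to all centres. *)
Lemma count_crowded : (count (fun p => `[< exists h, [/\ (H0 <= h)%N, (4 * h <= n)%N &
   h%:R ^+ 2 / C < (count (ball p (2 * h)) Bd)%:R :> R] >]) P0)%:R
  <= 100 * C * (size Bd)%:R :> R.
Proof.
have H1 := H0_gt0.
set A := fun p => _; pose s := [seq p <- P0 | A p].
pose hh p := if pselect (exists h, [/\ (H0 <= h)%N, (4 * h <= n)%N &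
   h%:R ^+ 2 / C < (count (ball p (2 * h)) Bd)%:R :> R]) is left e
   then projT1 (cid e) else 0%N.
have hhP p : p \in s -> [/\ (H0 <= hh p)%N, (4 * hh p <= n)%N &
   (hh p)%:R ^+ 2 / C < (count (ball p (2 * hh p)) Bd)%:R :> R].
  rewrite mem_filter => /andP[/asboolP ex _].
  by rewrite /hh; case: pselect => // e; case: (cid e).
have us : uniq s by apply: filter_uniq.
have [|s' [us' sub disj le]] := @vitali_card s (fun p => 2 * hh p)%N us.
  by move=> x /hhP[h1 _ _]; rewrite muln_gt0 /= (leq_trans H1).
rewrite -size_filter -/s.
apply: (@le_trans _ _ (\sum_(y <- s') 25 * (2 * hh y) ^ 2)%N%:R); first by rewrite ler_nat.
rewrite natr_sum.
apply: (@le_trans _ _ (\sum_(y <- s') 100 * C * (count (ball y (2 * hh y)) Bd)%:R)).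
  rewrite big_seq [leRHS]big_seq; apply: ler_sum => y /sub/hhP[_ _ h].
  rewrite natrM natrX natrM; move: h; set x := (hh y)%:R; set c := (count _ _)%:R.
  rewrite ltr_pdivrMr // exprMn => h.
  have -> : 25 * (2 ^+ 2 * x ^+ 2) = 100 * x ^+ 2 :> R by ring.
  by rewrite -mulrA ler_wpM2l // ltW // mulrC.
rewrite -mulr_sumr; apply: ler_wpM2l; first by rewrite mulr_ge0 // ltW.
by rewrite -natr_sum ler_nat; apply: disjoint_counts.
Qed.

(** The same covering argument, with regularity of [Theta] in place of the size
    of [Bd]. *)
Lemma count_nonsparse : (count (fun p => `[< exists h, [/\ (H0 <= h)%N, (4 * h <= n)%N &
   ~ sparse eps Theta [set b | ball p (2 * h) b]] >]) P0)%:R <= 25 * (eps * (size Q)%:R).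
Proof.
have H1 := H0_gt0.
set A := fun p => _; pose s := [seq p <- P0 | A p].
pose hh p := if pselect (exists h, [/\ (H0 <= h)%N, (4 * h <= n)%N &
   ~ sparse eps Theta [set b | ball p (2 * h) b]]) is left e
   then projT1 (cid e) else 0%N.
have hhP p : p \in s -> [/\ (H0 <= hh p)%N, (4 * hh p <= n)%N &
   ~ sparse eps Theta [set b | ball p (2 * hh p) b]].
  rewrite mem_filter => /andP[/asboolP ex _].
  by rewrite /hh; case: pselect => // e; case: (cid e).
have us : uniq s by apply: filter_uniq.
have sP0 p : p \in s -> p \in P0 by rewrite mem_filter => /andP[].
have [|s' [us' sub disj le]] := @vitali_card s (fun p => 2 * hh p)%N us.
  by move=> x /hhP[h1 _ _]; rewrite muln_gt0 /= (leq_trans H1).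
rewrite -size_filter -/s.
have inQ y : y \in s' -> forall b, ball y (2 * hh y) b -> cube a n b.
  by move=> /sub ys b; apply: P0_central; [exact: sP0 | have [] := hhP y ys].
apply: (@le_trans _ _ (25 * \sum_(y <- s') count (ball y (2 * hh y)) Q)%N%:R).
  rewrite ler_nat; apply: (leq_trans le); rewrite big_distrr.
  rewrite big_seq [leqRHS]big_seq; apply: leq_sum => y ys'.
  apply: leq_mul => //; apply: ball_card_ge; last exact: uniq_square_pts.
  by move=> b /(inQ y ys'); rewrite mem_square_pts.
rewrite natrM ler_wpM2l //.
apply: (regular_balls regTheta us' disj inQ) => y ys'.
by have [] := hhP y (sub y ys').
Qed.

(** Four obstructions can spoil a starting point: an exceptional or frozen site
    nearby, crowding, lack of sparsity, and failure of a strip. The first three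
    affect [O(eps)] of the points and the last at most half of them. *)
Lemma start_point : exists2 p, p \in P0 &
  [/\ forall b, ball p H0 b -> `|u b| <= 1,
      forall h, (H0 <= h)%N -> (4 * h <= n)%N ->
        (count (ball p (2 * h)) Bd)%:R <= h%:R ^+ 2 / C :> R,
      forall h, (H0 <= h)%N -> (4 * h <= n)%N -> sparse eps Theta [set b | ball p (2 * h) b] &
      forall h, (H0 <= h)%N -> (4 * h <= n)%N -> ~ fail_at Vb lam0 p h v].
Proof.
have key (x y z : R) : x <= z -> y <= z -> x + y <= 2 * z by lra.
have key2 (x1 x2 x3 x4 e q c P : R) : e * (2 * q + 100 * c + 25) < P / 2 ->
    x1 <= q * (2 * e) -> x2 <= 100 * c * e -> x3 <= 25 * e -> x4 <= P / 2 ->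
    x1 + (x2 + (x3 + x4)) < P by move=> *; lra.
pose Th := theta_pts a n Theta.
pose A1 p := has (ball p H0) (Bd ++ Th).
pose A2 p := `[< exists h, [/\ (H0 <= h)%N, (4 * h <= n)%N &
   h%:R ^+ 2 / C < (count (ball p (2 * h)) Bd)%:R :> R] >].
pose A3 p := `[< exists h, [/\ (H0 <= h)%N, (4 * h <= n)%N &
   ~ sparse eps Theta [set b | ball p (2 * h) b]] >].
pose A4 p := `[< exists h, [/\ (H0 <= h)%N, (4 * h <= n)%N &
    sparse eps Theta [set b | ball p (2 * h) b] /\ fail_at Vb lam0 p h v] >].
have union (A B : pred Z2) : (count (predU A B) P0 <= count A P0 + count B P0)%N.
  by rewrite -count_predUI leq_addr.
have c1 : (count A1 P0)%:R <= ((2 * H0).+1 ^ 2)%:R * (2 * (eps * (size Q)%:R)) :> R.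
  apply: (@le_trans _ _ ((2 * H0).+1 ^ 2 * size (Bd ++ Th))%N%:R).
    by rewrite ler_nat count_near.
  rewrite natrM ler_wpM2l // size_cat natrD.
  have := size_theta eps1 ThetaQ regTheta; move: Bd_small; rewrite -/Th -/Q.
  exact: key.
have c2 : (count A2 P0)%:R <= 100 * C * (eps * (size Q)%:R) :> R.
  apply: (le_trans count_crowded); apply: ler_wpM2l; last exact: Bd_small.
  by rewrite mulr_ge0 // ltW.
have c3 := count_nonsparse; rewrite -/A3 in c3.
have c4 := few_fail; rewrite -/A4 in c4.
have tot : (count (predU A1 (predU A2 (predU A3 A4))) P0)%:R < (size P0)%:R :> R.
  apply: (@le_lt_trans _ _ ((count A1 P0)%:R + ((count A2 P0)%:R + ((count A3 P0)%:R + (count A4 P0)%:R)))).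
    rewrite -!natrD ler_nat; apply: (leq_trans (union _ _)); rewrite leq_add2l.
    by apply: (leq_trans (union _ _)); rewrite leq_add2l; exact: union.
  move: hnum c1 c2 c3 c4; rewrite -/Q; set e := eps * (size Q)%:R.
  by move=> *; apply: key2; eassumption.
have : (0 < count (predC (predU A1 (predU A2 (predU A3 A4)))) P0)%N.
  by rewrite -(ltn_add2l (count (predU A1 (predU A2 (predU A3 A4))) P0)) addn0 count_predC -(ltr_nat R).
rewrite -has_count => /hasP[p pP0 hp].
have {hp} : ~~ (A1 p || (A2 p || (A3 p || A4 p))) := hp.
move=> /norP[n1 /norP[n2 /norP[n3 n4]]].
exists p => //; split.
- move=> b pb; apply: hu.
  + by apply: (P0_central pP0 H4n); apply: ball_le pb; rewrite leq_pmull.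
  + by apply: contra n1 => bB; apply/hasP; exists b => //; rewrite mem_cat bB.
  + move=> Tb; move/negP: n1; apply; apply/hasP; exists b => //.
    by rewrite mem_cat; apply/orP; right; rewrite (mem_theta ThetaQ); apply/asboolP.
- move=> h hH hn; rewrite leNgt; apply/negP => big; by move: n2; rewrite /A2 => /asboolPn; apply; exists h.
- move=> h hH hn; apply: contrapT => nsp; by move: n3; rewrite /A3 => /asboolPn; apply; exists h.
- move=> h hH hn f.
  have sp : sparse eps Theta [set b | ball p (2 * h) b].
    apply: contrapT => nsp; by move: n3; rewrite /A3 => /asboolPn; apply; exists h.
  by move: n4; rewrite /A4 => /asboolPn; apply; exists h.
Qed.

Hypothesis eC : C = 6000 * 5000.
Hypothesis Vb2 : 2 <= Vb.
Hypothesis lam08 : 0 <= lam0 <= 8.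
Hypothesis K1 : 1 <= K.
Hypothesis KW : 18 * (5 * n)%:R * Vb <= K.
Hypothesis hlam : `|lam - lam0| <= K ^- (8 * n).
Hypothesis heq : forall b, cube a n b ->
  schrodinger V u b = lam * u b /\ V b = (v b)%:R * Vb.

(** From a good starting point the controlled square grows until it reaches a
    fixed fraction of the box; the exponents of the bounds add up to the side. *)
Lemma growth_bound : exists2 p, p \in P0 &
  exists2 h, (n < 4 * h <= 2 * n)%N & forall b, ball p h b -> `|u b| <= K ^+ (64 * h).
Proof.
have [p pP0 [start crowd sp nf]] := start_point; exists p => //.
have step h : (H0 <= h)%N -> (4 * h <= n)%N ->
    (forall b, ball p h b -> `|u b| <= K ^+ (64 * h)) ->
    forall b, ball p (h + bstep h) b -> `|u b| <= K ^+ (64 * (h + bstep h)).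
  move=> hH hn known b pb.
  have h12 : 12000 <= h%:R :> R by apply: le_trans H012 _; rewrite ler_nat.
  have hn' : (h <= n)%N by apply: leq_trans hn; rewrite leq_pmull.
  rewrite mulnDr exprD.
  apply: (@grow R Vb lam0 lam K v V u p h Bd (theta_pts a n Theta)) pb => //.
  - apply: le_trans KW; rewrite ler_wpM2r //; first by apply: le_trans Vb2.
    by rewrite ler_wpM2l // ler_nat leq_mul2l hn'.
  - apply: (le_trans hlam); rewrite lef_pV2 ?posrE ?exprn_gt0 ?(lt_le_trans ltr01) //.
    by rewrite ler_weXn2l // leq_mul2l hn'.
  - by move=> c pc; apply: heq; exact: P0_central pc.
  - exact: nf.
  - move=> c pc nB nT; apply: hu => //; first exact: P0_central pc.
    by move=> Tc; move/negP: nT; apply; rewrite (mem_theta ThetaQ); apply/asboolP.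
  - by rewrite -eC; exact: crowd.
  - have inQ c : ball p (2 * h) c -> cube a n c by apply: P0_central.
    exact: (sparse_rows eps0 eps1 (leq_trans H0_gt0 hH) inQ (sp h hH hn)).
  - by rewrite exprn_ege1.
have [h [hH hn known]] : exists h, [/\ (H0 <= h)%N, (4 * h <= 2 * n)%N /\ (n < 4 * h)%N &
    forall b, ball p h b -> `|u b| <= K ^+ (64 * h)].
  (* Induction on [n - 4 h]; a step adds at most [h / 3000], so [4 h] stays below [2 n]. *)
  suff H k h : (n < 4 * h + k)%N -> (H0 <= h)%N -> (4 * h <= 2 * n)%N ->
      (forall b, ball p h b -> `|u b| <= K ^+ (64 * h)) ->
      exists h, [/\ (H0 <= h)%N, (4 * h <= 2 * n)%N /\ (n < 4 * h)%N &
        forall b, ball p h b -> `|u b| <= K ^+ (64 * h)].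
    apply: (H n.+1 H0) => //; first by rewrite addnS ltnS leq_addl.
      by apply: (leq_trans H4n); rewrite leq_pmull.
    by move=> b pb; apply: (le_trans (start b pb)); rewrite exprn_ege1.
  elim: k h => [|k IH] h hk hH hn known.
    by exists h; split=> //; split=> //; rewrite addn0 in hk.
  case: (leqP (4 * h) n) => hn4; last by exists h.
  have h12 : 12000 <= h%:R :> R by apply: le_trans H012 _; rewrite ler_nat.
  have [b0 _ b3 _ _] := bstep_prop h12.
  have b3n : (bstep h <= h)%N.
    have : (3000 * bstep h <= h)%N by rewrite -(ler_nat R) natrM.
    by apply: leq_trans; rewrite leq_pmull.
  apply: (IH (h + bstep h)%N); last exact: step.
  - by move: hk b0; clear; lia.
  - by apply: (leq_trans hH); rewrite leq_addr.
  - by move: hn4 b3n; clear; lia.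
by exists h => //; case: hn => -> ->.
Qed.

End Deterministic.

(** * Failures near a starting point *)

Section FewFailures.
Variables (R : realType) (eps Vb lam0 : R) (a : Z2) (n H0 : nat) (Theta : set Z2).
Hypothesis eps0 : 0 < eps.
Hypothesis eps1 : eps <= 1 / (1000 * 1000).
Hypothesis ThetaQ : Theta `<=` [set b | cube a n b].
Hypothesis H012 : 12000 <= H0%:R :> R.
Hypothesis Vb2 : 2 <= Vb.
Hypothesis lam08 : 0 <= lam0 <= 8.

Definition free_sites : seq Z2 := [seq b <- square_pts a n | ~~ `[< Theta b >]].

Definition scale_fail p h (v : Z2 -> bool) :=
  sparse eps Theta [set b | ball p (2 * h) b] /\ fail_at Vb lam0 p h v.

Definition central p := forall b h, (4 * h <= n)%N -> ball p (2 * h) b -> cube a n b.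

Lemma scale_fail_unlikely p h v : central p -> (H0 <= h)%N -> (4 * h <= n)%N ->
  avg free_sites (fun v => (`[< scale_fail p h v >])%:R) v <= expR (- (h%:R / 30)) :> R.
Proof.
move=> cp hH hn.
have h12 : 12000 <= h%:R :> R by apply: le_trans H012 _; rewrite ler_nat.
have h1 : (1 <= h)%N by have [_ _ _ _] := bstep_prop h12; apply: leq_trans.
have inQ b : ball p (2 * h) b -> cube a n b by apply: cp.
have [sp|nsp] := pselect (sparse eps Theta [set b | ball p (2 * h) b]); last first.
  rewrite (_ : (fun v => _) = (fun=> 0)) ?avg_cst ?expR_ge0 //.
  by apply/funext => v'; case: asboolP => // -[].
have rows := sparse_rows eps0 eps1 h1 inQ sp.
apply: (@le_trans _ _ (avg free_sites (fun v => (`[< fail_at Vb lam0 p h v >])%:R) v)).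
  by apply: avg_le => v'; case: asboolP => [[_ f]|_] //=; case: asboolP.
apply: (@fail_at_unlikely _ _ _ _ _ _ (theta_pts a n Theta)) => // b pb.
rewrite mem_filter mem_square_pts inQ // andbT negbK => Tb.
by rewrite mem_theta.
Qed.

(** Scales from [H0] on are so unlikely to fail that even their union is. *)
Lemma geometric_tail k : \sum_(H0 <= h < k) expR (- (h%:R / 30)) <= 1 / 16 :> R.
Proof.
have inv_le (x y : R) : 0 < x -> x <= y -> y^-1 <= x^-1.
  by move=> x0 xy; rewrite lef_pV2 ?posrE // (lt_le_trans x0).
pose q : R := expR (- (1 / 30)).
have q0 : 0 < q by exact: expR_gt0.
have q1 : q <= 30 / 31.
  rewrite /q expRN; have e : 31 / 30 <= expR (1 / 30) :> R by apply: le_trans (expR_ge1Dx _); lra.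
  rewrite -[30 / 31]invrK lef_pV2 ?posrE ?expR_gt0 ?invr_gt0 //.
  by apply: le_trans e; lra.
have eq h : expR (- (h%:R / 30)) = q ^+ h :> R.
  by rewrite /q -expRM_natl; congr expR; lra.
have tele j : \sum_(H0 <= h < H0 + j) q ^+ h <= 31 * q ^+ H0 * (1 - q ^+ j).
  elim: j => [|j IH]; first by rewrite addn0 big_geq // expr0 subrr mulr0.
  rewrite addnS big_nat_recr ?leq_addr //=; apply: (le_trans (lerD IH (lexx _))).
  have qj : 0 < q ^+ j by rewrite exprn_gt0.
  have qqj : q * q ^+ j <= 30 / 31 * q ^+ j by rewrite ler_wpM2r // ltW.
  rewrite exprD exprS -subr_ge0.
  have -> : 31 * q ^+ H0 * (1 - q * q ^+ j) - (31 * q ^+ H0 * (1 - q ^+ j) + q ^+ H0 * q ^+ j) =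
    q ^+ H0 * (30 * q ^+ j - 31 * (q * q ^+ j)) by ring.
  rewrite mulr_ge0 ?exprn_ge0 ?(ltW q0) //; lra.
have qH : q ^+ H0 <= 1 / 1000.
  rewrite -eq; have h400 : 400 <= H0%:R / 30 :> R by move: H012; lra.
  apply: (@le_trans _ _ (expR (- 400))); first by rewrite ler_expR lerN2.
  rewrite expRN; have e : 1000 <= expR 400 :> R.
    have -> : 400 = 2%:R * 200 :> R by rewrite -natrM.
    rewrite expRM_natl; apply: (@le_trans _ _ (200 ^+ 2)); first by rewrite -natrX ler_nat.
    by rewrite lerXn2r ?nnegrE ?expR_ge0 //; apply: le_trans (expR_ge1Dx _); lra.
  rewrite div1r; apply: inv_le e; exact: ltr0Sn.
case: (leqP H0 k) => hk; last by rewrite big_geq // ltnW.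
under eq_bigr do rewrite eq.
rewrite -(subnKC hk); apply: (le_trans (tele _)).
have qk : 0 < q ^+ (k - H0) by rewrite exprn_gt0.
have qH0 : 0 < q ^+ H0 by rewrite exprn_gt0.
have : 31 * q ^+ H0 * (1 - q ^+ (k - H0)) <= 31 * q ^+ H0 * 1.
  by rewrite ler_pM2l ?mulr_gt0 //; lra.
move: qH; move: (q ^+ H0) => z zz; lra.
Qed.

Definition small_fail k p v := exists h, [/\ (H0 <= h < k)%N, (4 * h <= n)%N & scale_fail p h v].

Lemma small_fail_unlikely k p v : central p ->
  avg free_sites (fun v => (`[< small_fail k p v >])%:R) v <= 1 / 16 :> R.
Proof.
move=> cp; apply: le_trans (geometric_tail k).
apply: (@le_trans _ _ (avg free_sites (fun v => \sum_(H0 <= h < k | (4 * h <= n)%N)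
    (`[< scale_fail p h v >])%:R) v)).
  apply: avg_le => v'; case: asboolP => [[h [hk hn f]]|_] /=; last exact: sumr_ge0.
  rewrite -big_filter (bigD1_seq h) /=; last by rewrite filter_uniq // iota_uniq.
    by case: asboolP => // _; rewrite ler_wpDr // sumr_ge0.
  by rewrite mem_filter mem_index_iota hn.
rewrite avg_sum big_mkcond; apply: ler_sum_nat => h /andP[hH _].
by case: ifP => [hn|_]; [apply: scale_fail_unlikely | rewrite expR_ge0].
Qed.

Lemma small_fail_dep k p : dep_on (ball p (2 * k)) (fun v => `[< small_fail k p v >]).
Proof.
have imp v v' : (forall q, ball p (2 * k) q -> v q = v' q) -> small_fail k p v -> small_fail k p v'.
  move=> vv' [h [/andP[hH hk] hn [sp f]]]; exists h; split=> //; first by rewrite hH.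
  split=> //; apply: fail_at_dep f; first by apply: le_trans H012 _; rewrite ler_nat.
  by move=> q hq; apply: vv'; apply: ball_le hq; rewrite leq_mul2l ltnW // orbT.
move=> v v' vv'; apply/asboolP/asboolP; apply: imp => // q /vv' //.
Qed.

(** Failures at distant points are independent; an exponential moment turns
    this into a bound for half of the points of a sparse class failing. *)
Lemma class_unlikely k (s : seq Z2) v : uniq s -> (forall p, p \in s -> central p) ->
  (forall p q b, p \in s -> q \in s -> p != q -> ball p (2 * k) b -> ball q (2 * k) b -> False) ->
  avg free_sites (fun v => ((size s < 2 * count (fun p => `[< small_fail k p v >]) s)%N)%:R) v
  <= 2^-1 ^+ size s :> R.
Proof.
move=> us cs disj.
have gen (P : pred Z2) (r : seq Z2) :
    \prod_(p <- r) (1 + 15 * (P p)%:R) = 16 ^+ count P r :> R.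
  elim: r => [|p r IH]; first by rewrite big_nil.
  rewrite big_cons IH /=; case: (P p) => /=.
    by rewrite add1n exprS; congr (_ * _); lra.
  by rewrite add0n mulr0 addr0 mul1r.
(* The weight [16] of a failing point makes the product at least [4 ^ size s] when half
   of the points fail, while its mean is at most [(1 + 15 / 16) ^ size s]. *)
pose f p v : R := 1 + 15 * (`[< small_fail k p v >])%:R.
have f1 p v' : 1 <= f p v' by rewrite /f; case: (`[< _ >]) => /=; lra.
apply: (@le_trans _ _ (avg free_sites (fun v => 4^-1 ^+ size s * \prod_(p <- s) f p v) v)).
  apply: avg_le => v'; case: ltnP => h /=; last first.
    rewrite mulr_ge0 // ?exprn_ge0 // prodr_ge0 // => p _; exact: le_trans (f1 p v').
  have -> : \prod_(p <- s) f p v' = 16 ^+ count (fun p => `[< small_fail k p v' >]) s.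
    exact: gen.
  have -> : 16 = 4 ^+ 2 :> R by rewrite -natrX.
  rewrite -exprM exprVn ler_pdivlMl ?exprn_gt0 // mulr1.
  by rewrite ler_weXn2l ?ler1n // ltnW.
rewrite avgZ (@avg_prod _ _ _ _ _ _ (fun p => ball p (2 * k))) //; last first.
  by move=> p _ w w' ww'; rewrite /f (small_fail_dep ww').
apply: (@le_trans _ _ (4^-1 ^+ size s * 2 ^+ size s)); last first.
  by rewrite -exprMn; rewrite (_ : 4^-1 * 2 = 2^-1 :> R) //; lra.
rewrite ler_wpM2l ?exprn_ge0 //.
have -> : 2 ^+ size s = \prod_(p <- s) 2 :> R by rewrite big_const_seq count_predT iter_mulr mulr1.
rewrite big_seq [leRHS]big_seq; apply: ler_prod => p ps; apply/andP; split.
  apply: le_trans (_ : avg free_sites (fun=> 0) v <= _); first by rewrite avg_cst.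
  by apply: avg_le => v'; apply: le_trans (f1 p v').
rewrite /f avgD avg_cst avgZ.
have := @small_fail_unlikely k p v (cs p ps); lra.
Qed.

End FewFailures.

(** * A grid of starting points *)

Definition residues (M : nat) : seq (nat * nat) := [seq (i, j) | i <- iota 0 M, j <- iota 0 M].

(** The point of the class [c] in the cell [ij] of a square grid of mesh [M]. *)
Definition grid_pt (a : Z2) M (c ij : nat * nat) : Z2 :=
  a + ((ij.1 * M + c.1)%N%:Z, (ij.2 * M + c.2)%N%:Z).

Definition class_pts a M k c : seq Z2 := [seq grid_pt a M c ij | ij <- residues k].

Definition start_pts a M k : seq Z2 := flatten [seq class_pts a M k c | c <- residues M].

Lemma residuesP M c : (c \in residues M) = (c.1 < M)%N && (c.2 < M)%N.
Proof.
apply/allpairsP/andP => [[[i j] [/=]]|[h1 h2]].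
  by rewrite !mem_iota => hi hj ->.
exists c; split; [by rewrite mem_iota|by rewrite mem_iota|by case: c {h1 h2}].
Qed.

Lemma uniq_residues M : uniq (residues M).
Proof. by apply: allpairs_uniq; rewrite ?iota_uniq // => -[i j] [i' j'] _ _ [-> ->]. Qed.

Lemma size_residues M : size (residues M) = (M ^ 2)%N.
Proof. by rewrite size_allpairs !size_iota mulnn. Qed.

Lemma grid_pt_inj a M c c' ij ij' : c \in residues M -> c' \in residues M ->
  grid_pt a M c ij = grid_pt a M c' ij' -> c = c' /\ ij = ij'.
Proof.
rewrite !residuesP => /andP[h1 h2] /andP[h1' h2'] /addrI [] e1 e2.
have dig i j x y : (x < M)%N -> (y < M)%N -> (i * M + x = j * M + y)%N -> i = j /\ x = y.
  move=> xM yM e; have M0 : (0 < M)%N by apply: leq_trans xM.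
  have e1' := congr1 (divn^~ M) e; have e2' := congr1 (modn^~ M) e.
  by rewrite /= !divnMDl // !divn_small // !addn0 in e1'; rewrite /= !modnMDl !modn_small // in e2'.
have [a1 a2] := dig _ _ _ _ h1 h1' e1; have [b1 b2] := dig _ _ _ _ h2 h2' e2.
by split; apply/eqP; rewrite -pair_eqE /= ?a1 ?a2 ?b1 ?b2 /pair_eq /= !eqxx.
Qed.

Lemma uniq_class a M k c : c \in residues M -> uniq (class_pts a M k c).
Proof.
move=> cM; rewrite map_inj_in_uniq ?uniq_residues // => x y _ _.
by case/(grid_pt_inj cM cM).
Qed.

Lemma uniq_start a M k : uniq (start_pts a M k).
Proof.
have -> : start_pts a M k = [seq grid_pt a M c ij | c <- residues M, ij <- residues k] by [].
apply: allpairs_uniq; rewrite ?uniq_residues // => -[c ij] [c' ij'].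
move=> /allpairsP[x [xM _ ->]] /allpairsP[y [yM _ ->]] /=.
by case/(grid_pt_inj xM yM) => -> ->.
Qed.

Lemma size_start a M k : size (start_pts a M k) = (M ^ 2 * k ^ 2)%N.
Proof.
have -> : start_pts a M k = [seq grid_pt a M c ij | c <- residues M, ij <- residues k] by [].
by rewrite size_allpairs !size_residues.
Qed.

Lemma class_start a M k c p : c \in residues M -> p \in class_pts a M k c -> p \in start_pts a M k.
Proof. by move=> cM pc; apply/flattenP; exists (class_pts a M k c) => //; apply: map_f. Qed.

Lemma start_near a M k p : p \in start_pts a M k -> cube a (k * M) p.
Proof.
move=> /flattenP[_ /mapP[c cM ->] /mapP[ij ijk ->]].
move: cM ijk; rewrite !residuesP => /andP[h1 h2] /andP[h3 h4].
have le i x : (i < k)%N -> (x < M)%N -> (i * M + x <= k * M)%N.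
  move=> ik xM; apply: (@leq_trans (i.+1 * M)); last by rewrite leq_mul2r ik orbT.
  by rewrite mulSn addnC leq_add2r ltnW.
have l1 := le _ _ h3 h1; have l2 := le _ _ h4 h2.
move: l1 l2; rewrite /cube /linf_norm /grid_pt; move: (_ + c.1)%N (_ + c.2)%N (k * M)%N.
by clear; case: a => ax ay /=; lia.
Qed.

Lemma cube_triangle a p b r r' : cube a r p -> ball p r' b -> cube a (r + r') b.
Proof. by move=> h /ball_cube; move: h; rewrite /cube /linf_norm /=; lia. Qed.

Lemma class_far a cut k c p q b : c \in residues (4 * cut).+1 ->
  p \in class_pts a (4 * cut).+1 k c -> q \in class_pts a (4 * cut).+1 k c -> p != q ->
  ball p (2 * cut) b -> ball q (2 * cut) b -> False.
Proof.
move=> cM /mapP[[i j] _ ->] /mapP[[i' j'] _ ->] ne hp hq.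
have hd : l1_norm (grid_pt a (4 * cut).+1 c (i, j) - grid_pt a (4 * cut).+1 c (i', j')) <= (4 * cut)%N%:Z.
  apply: (le_trans (l1_triangle _ b _)); rewrite l1_distC.
  by move: hp hq; rewrite /ball; clear; lia.
have far x y : x <> y -> ((4 * cut)%N%:Z < `|(x * (4 * cut).+1)%N%:Z - (y * (4 * cut).+1)%N%:Z|)%R.
  set M := (4 * cut).+1 => xy.
  have [lt|gt|//] := ltngtP x y.
    have : (x.+1 * M <= y * M)%N by rewrite leq_mul2r lt orbT.
    by rewrite mulSn /M; move: (x * _)%N (y * _)%N; clear; lia.
  have : (y.+1 * M <= x * M)%N by rewrite leq_mul2r gt orbT.
  by rewrite mulSn /M; move: (x * _)%N (y * _)%N; clear; lia.
have eq : l1_norm (grid_pt a (4 * cut).+1 c (i, j) - grid_pt a (4 * cut).+1 c (i', j')) =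
   `|(i * (4 * cut).+1)%N%:Z - (i' * (4 * cut).+1)%N%:Z| + `|(j * (4 * cut).+1)%N%:Z - (j' * (4 * cut).+1)%N%:Z|.
  rewrite /l1_norm /grid_pt; case: (a) => ax ay /=; move: (i * _)%N (i' * _)%N (j * _)%N (j' * _)%N; clear; lia.
rewrite eq in hd.
have [ei|ni] := eqVneq i i'; last first.
  by have := far _ _ (elimN eqP ni); move: hd; clear; lia.
have [ej|nj] := eqVneq j j'; last first.
  by have := far _ _ (elimN eqP nj); move: hd; clear; lia.
by rewrite ei ej eqxx in ne.
Qed.

Section Likely.
Variables (R : realType) (eps Vb lam0 : R) (a : Z2) (n H0 cut k : nat) (Theta : set Z2).
Hypothesis eps0 : 0 < eps.
Hypothesis eps1 : eps <= 1 / (1000 * 1000).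
Hypothesis ThetaQ : Theta `<=` [set b | cube a n b].
Hypothesis H012 : 12000 <= H0%:R :> R.
Hypothesis Vb2 : 2 <= Vb.
Hypothesis lam08 : 0 <= lam0 <= 8.
Hypothesis small_start : (2 * (k * (4 * cut).+1) <= n)%N.

Let P0 := start_pts a (4 * cut).+1 k.

Definition some_fail p v := exists h, [/\ (H0 <= h)%N, (4 * h <= n)%N &
  sparse eps Theta [set b | ball p (2 * h) b] /\ fail_at Vb lam0 p h v].

Definition many_fail v : bool :=
  (size P0 < 2 * count (fun p => `[< some_fail p v >]) P0)%N.

Lemma start_central p : p \in P0 -> central a n p.
Proof.
move=> /start_near hp b h hn pb; have := cube_triangle hp pb.
by move: small_start hn; rewrite /cube; move: (k * _)%N; clear; lia.
Qed.

(** If many points fail then some point fails at a scale of at least [cut], or in some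
    class half of the points fail at smaller scales. *)
Lemma many_fail_unlikely v : avg (free_sites a n Theta) (fun v => (many_fail v)%:R) v <=
  ((4 * cut).+1 ^ 2)%:R * 2^-1 ^+ (k ^ 2) + (size P0 * n.+1)%N%:R * expR (- (cut%:R / 30)) :> R.
Proof.
pose large p h v := [&& (cut <= h)%N, (H0 <= h)%N, (4 * h <= n)%N & `[< scale_fail eps Vb lam0 Theta p h v >]].
pose bad c v := (size (class_pts a (4 * cut).+1 k c) < 2 * count (fun p => `[< small_fail eps Vb lam0 n H0 Theta cut p v >])
   (class_pts a (4 * cut).+1 k c))%N.
apply: (@le_trans _ _ (avg (free_sites a n Theta) (fun v =>
   \sum_(c <- residues (4 * cut).+1) (bad c v)%:R + \sum_(p <- P0) \sum_(h < n.+1) (large p h v)%:R) v)).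
  apply: avg_le => v'.
  have s1 : 0 <= \sum_(c <- residues (4 * cut).+1) (bad c v')%:R :> R by apply: sumr_ge0.
  have s2 : 0 <= \sum_(p <- P0) \sum_(h < n.+1) (large p h v')%:R :> R.
    by apply: sumr_ge0 => p _; apply: sumr_ge0.
  case mf: (many_fail v'); last by rewrite addr_ge0.
  have [[p [pP0 [h lg]]]|nl] := pselect (exists p, p \in P0 /\ exists h : nat, large p h v').
    have hn : (h < n.+1)%N.
      by move: lg => /and4P[_ _ hn _]; rewrite ltnS; apply: leq_trans hn; rewrite leq_pmull.
    rewrite ler_wpDl // (bigD1_seq p) ?uniq_start //= (bigD1 (Ordinal hn)) //= lg.
    rewrite -addrA ler_wpDr // addr_ge0 //; first exact: sumr_ge0.
    by apply: sumr_ge0 => q _; apply: sumr_ge0.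
  have [[c [cM bc]]|nb] := pselect (exists c, c \in residues (4 * cut).+1 /\ bad c v').
    rewrite ler_wpDr // (bigD1_seq c) ?uniq_residues //= bc ler_wpDr //; exact: sumr_ge0.
  exfalso; move: mf; rewrite /many_fail; apply/negP; rewrite -leqNgt.
  have -> : count (fun p => `[< some_fail p v' >]) P0 =
     count (fun p => `[< small_fail eps Vb lam0 n H0 Theta cut p v' >]) P0.
    apply: eq_in_count => p pP0; apply/asboolP/asboolP => -[h].
      case=> hH hn f; exists h; split=> //; rewrite hH ltnNge; apply/negP => ch.
      by apply: nl; exists p; split=> //; exists h; rewrite /large ch hH hn; apply/asboolP.
    by case=> /andP[hH _] hn f; exists h.
  rewrite /P0 /start_pts count_flatten size_flatten /shape -!map_comp !sumnE !big_map big_distrr /=.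
  rewrite big_seq [leqRHS]big_seq; apply: leq_sum => c cM; rewrite leqNgt; apply/negP => bc.
  by apply: nb; exists c.
rewrite avgD !avg_sum lerD //.
  apply: (@le_trans _ _ (\sum_(c <- residues (4 * cut).+1) 2^-1 ^+ (k ^ 2))); last first.
    by rewrite big_const_seq count_predT size_residues iter_addr addr0 mulr_natl.
  rewrite big_seq [leRHS]big_seq; apply: ler_sum => c cM.
  rewrite -(size_residues k) -(size_map (grid_pt a (4 * cut).+1 c)).
  apply: class_unlikely => //; first exact: uniq_class.
    by move=> p pc; apply: start_central; apply: class_start pc.
  by move=> p q b; apply: class_far.
apply: (@le_trans _ _ (\sum_(p <- P0) \sum_(h < n.+1) expR (- (cut%:R / 30)))); last first.
  rewrite sumr_const card_ord big_const_seq count_predT iter_addr addr0 -mulrnA mulnC.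
  by rewrite [leRHS]mulr_natl.
rewrite big_seq [leRHS]big_seq; apply: ler_sum => p pP0.
rewrite avg_sum; apply: ler_sum => h _.
have [/and3P[ch hH hn]|no] := boolP [&& (cut <= h)%N, (H0 <= h)%N & (4 * h <= n)%N].
  apply: (@le_trans _ _ (expR (- (h%:R / 30)))); last first.
    by rewrite ler_expR lerN2 ler_pM2r ?invr_gt0 // ler_nat.
  have unl := scale_fail_unlikely eps0 eps1 ThetaQ H012 Vb2 lam08 v (start_central pP0) hH hn.
  apply: le_trans unl; by apply: avg_le => v'; rewrite /large ch hH hn.
rewrite (_ : (fun v => _) = (fun=> 0)) ?avg_cst ?expR_ge0 //.
apply/funext => v'; rewrite /large; case: and4P => // -[h1 h2 h3 _].
by rewrite h1 h2 h3 in no.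
Qed.

End Likely.

(** * Measurability *)

Section Measurability.
Variables (R : realType).

Lemma compact_positive (U : topologicalType) (A : set U) (f : U -> R) :
  compact A -> continuous f -> (forall x, A x -> 0 < f x) ->
  exists2 e, 0 < e & forall x, A x -> e <= f x.
Proof.
move=> cA cf fpos.
have cI : compact (f @` A).
  by apply: continuous_compact => //; apply: continuous_subspaceT.
have clI : closed (f @` A) by apply: compact_closed cI; exact: Rhausdorff.
have o0 : (~` (f @` A)) 0.
  by move=> [x Ax fx]; have := fpos x Ax; rewrite fx ltxx.
have : nbhs (0 : R) (~` (f @` A)) by apply: open_nbhs_nbhs; split=> //; rewrite openC.
rewrite -nbhs_ballE => -[e /= e0 he]; exists e => // x Ax.
rewrite leNgt; apply/negP => fe.
apply: (he (f x)) => /=; last by exists x.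
by rewrite -ball_normE /= sub0r normrN gtr0_norm // fpos.
Qed.

(** A potential, up to an error on finitely many sites, is a rational box; this
    makes sets that are closed in finitely many coordinates measurable. *)
Lemma measurable_closed_sites d (T : measurableType d) (V : Z2 -> T -> R) (r : seq Z2)
    (C : set (Z2 -> R)) :
  (forall b, measurable_fun setT (V b)) ->
  (forall v, ~ C v -> exists2 e, 0 < e & forall v', (forall b, b \in r -> `|v' b - v b| < e) -> ~ C v') ->
  measurable [set w | C (fun b => V b w)].
Proof.
move=> mV Cop.
pose box (qk : seq rat * nat) : set T :=
  \big[setI/setT]_(i < size r) [set w | `|V (nth 0 r i) w - ratr (nth 0 qk.1 i)| < qk.2.+1%:R^-1].
pose good (qk : seq rat * nat) := forall v : Z2 -> R,
  (forall i, (i < size r)%N -> `|v (nth 0 r i) - ratr (nth 0 qk.1 i)| < qk.2.+1%:R^-1) -> ~ C v.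
have boxP qk w : box qk w <->
    (forall i, (i < size r)%N -> `|V (nth 0 r i) w - ratr (nth 0 qk.1 i)| < qk.2.+1%:R^-1).
  rewrite /box -(bigcap_mkord _ (fun i => [set w | `|V (nth 0 r i) w - ratr (nth 0 qk.1 i)| < qk.2.+1%:R^-1])); split=> h.
    by move=> i hi; exact: (h i hi).
  by move=> i hi; apply: h.
have -> : [set w | C (fun b => V b w)] = ~` \bigcup_qk (if `[< good qk >] then box qk else set0).
  apply/seteqP; split=> w.
    move=> Cw [qk _]; case: asboolP => // gqk /boxP bw.
    exact: (gqk _ bw Cw).
  move=> nb; apply: contrapT => nC; apply: nb.
  have [e e0 he] := Cop _ nC.
  have [k hk] : exists k : nat, k.+1%:R^-1 <= e / 2.
    have e2 : 0 < e / 2 by rewrite divr_gt0.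
    exists (Num.truncn (e / 2)^-1); rewrite -[leRHS]invrK lef_pV2 ?posrE ?invr_gt0 //.
    by apply: ltW; exact: truncnS_gt.
  have approx (x : R) : exists q : rat, `|x - ratr q| < k.+1%:R^-1.
    have : x - k.+1%:R^-1 < x by rewrite ltrBlDr ltrDl invr_gt0.
    move=> /rat_in_itvoo[q]; rewrite in_itv /= => /andP[q1 q2]; exists q.
    by rewrite ger0_norm ?subr_ge0 ?(ltW q2) // ltrBlDl -ltrBlDr.
  pose q b : rat := projT1 (cid (approx (V b w))).
  have hq b : `|V b w - ratr (q b)| < k.+1%:R^-1 by rewrite /q; case: (cid _).
  exists ([seq q b | b <- r], k) => //.
  have nthq i : (i < size r)%N -> nth 0 [seq q b | b <- r] i = q (nth 0 r i).
    by move=> hi; rewrite (nth_map 0).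
  case: asboolP => [_|ng].
    by apply/boxP => i hi /=; rewrite nthq.
  exfalso; apply: ng => v hv; apply: he => b br.
  have hi : (index b r < size r)%N by rewrite index_mem.
  have := hv _ hi; rewrite /= nthq // nth_index // => h1.
  have h2 := hq b; rewrite (_ : v b - V b w = (v b - ratr (q b)) - (V b w - ratr (q b))); last by ring.
  apply: (le_lt_trans (ler_normB _ _)); apply: (lt_le_trans (ltrD h1 h2)).
  by rewrite [leRHS](splitr e) lerD.
apply: measurableC; apply: countable_bigcupT_measurable => [|qk]; first exact: countableP.
case: asboolP => // _; apply: bigsetI_measurable => i _.
set q := ratr _; set e := _^-1.
have := mV (nth 0 r i) measurableT `]q - e, q + e[%classic (measurable_itv _).
rewrite setTI; congr measurable; apply/seteqP; split=> w /=; rewrite in_itv /= ltr_norml.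
  by move=> /andP[h1 h2]; apply/andP; split; lra.
by move=> /andP[h1 h2]; apply/andP; split; lra.
Qed.

(** The defect in the equation, written without the infinite sum of the Laplacian
    so that it is visibly continuous in [u] and [lam]. *)
Definition eqn_residual (v u : Z2 -> R) (lam : R) (b : Z2) : R :=
  4 * u b - (u (b + (1, 0)) + u (b - (1, 0)) + u (b + (0, 1)) + u (b - (0, 1)))
  + v b * u b - lam * u b.

Lemma residual_eq0 v u lam b : (schrodinger v u b = lam * u b) <-> eqn_residual v u lam b = 0.
Proof.
rewrite /schrodinger /laplacian sum_neighbors /eqn_residual; split=> h; lra.
Qed.

Lemma cvg_residual (U : Type) (F : set_system U) (FF : Filter F) (g : U -> option Z2 -> R)
    (x : option Z2 -> R) v b : (forall i, g y i @[y --> F] --> x i) ->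
  `|eqn_residual v (fun c => g y (Some c)) (g y None) b| @[y --> F] -->
  `|eqn_residual v (fun c => x (Some c)) (x None) b|.
Proof.
move=> c.
have h : eqn_residual v (fun c => g y (Some c)) (g y None) b @[y --> F] -->
    eqn_residual v (fun c => x (Some c)) (x None) b.
  rewrite /eqn_residual; apply: cvgB; last by apply: cvgM; exact: c.
  apply: cvgD; last by apply: cvgM; [exact: cvg_cst | exact: c].
  apply: cvgB; first by apply: cvgM; [exact: cvg_cst | exact: c].
  by do 3 (apply: cvgD; last exact: c); exact: c.
exact: (cvg_norm h).
Qed.

Lemma cvg_seqsum (U : Type) (F : set_system U) (FF : Filter F) (r : seq Z2)
    (f : Z2 -> U -> R) (l : Z2 -> R) : (forall b, f b y @[y --> F] --> l b) ->
  \sum_(b <- r) f b y @[y --> F] --> \sum_(b <- r) l b.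
Proof.
move=> fl; elim: r => [|c r IH].
  have -> : (fun y => \sum_(b <- [::]) f b y) = (fun=> 0) by apply/funext => y; rewrite big_nil.
  by rewrite big_nil; exact: cvg_cst.
have -> : (fun y => \sum_(b <- c :: r) f b y) = (fun y => f c y + \sum_(b <- r) f b y).
  by apply/funext => y; rewrite big_cons.
by rewrite big_cons; apply: cvgD.
Qed.

Section Coordinates.
Import ArrowAsProduct.

Lemma continuous_residual v b :
  continuous (fun x : option Z2 -> R => `|eqn_residual v (fun c => x (Some c)) (x None) b|).
Proof.
move=> x; apply: (@cvg_residual _ (nbhs x) _ (fun y => y)) => i.
exact: (@proj_continuous (option Z2) (fun=> R) i x).
Qed.

(** The potentials for which some energy and some solution meet prescribed closed
    bounds form a set that is closed in the potential on [r]. *)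
Lemma solvable_closed (r : seq Z2) (lo hi : option Z2 -> R) (m : R) (v : Z2 -> R) :
  (forall b x, lo (Some b) <= x <= hi (Some b) -> `|x| <= m) ->
  let C := [set v | exists x : option Z2 -> R, (forall i, lo i <= x i <= hi i) /\
     forall b, b \in r -> eqn_residual v (fun c => x (Some c)) (x None) b = 0] in
  ~ C v -> exists2 e, 0 < e & forall v', (forall b, b \in r -> `|v' b - v b| < e) -> ~ C v'.
Proof.
move=> hm C nC.
(* The candidates for [u], with the energy as the coordinate [None], form a compact
   set; the total defect is bounded below on it when there is no solution, and it
   changes little with the potential. *)
pose K := [set x : option Z2 -> R | forall i, `[lo i, hi i]%classic (x i)].
have cK : compact K.
  by apply: (@tychonoff (option Z2) (fun=> R) (fun i => `[lo i, hi i]%classic)) => i; exact: segment_compact.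
pose f (x : option Z2 -> R) : R := \sum_(b <- r) `|eqn_residual v (fun c => x (Some c)) (x None) b|.
have cf : continuous f.
  move=> x; exact: (@cvg_seqsum _ (nbhs x) _ r
    (fun b y => `|eqn_residual v (fun c => y (Some c)) (y None) b|)
    (fun b => `|eqn_residual v (fun c => x (Some c)) (x None) b|)
    (fun b => @continuous_residual v b x)).
have fpos x : K x -> 0 < f x.
  move=> Kx; rewrite lt_neqAle sumr_ge0 // andbT eq_sym; apply/eqP => f0; apply: nC.
  exists x; split=> [i|b br]; first by have := Kx i; rewrite /= in_itv.
  apply/eqP; rewrite -normr_eq0; apply/eqP; move: f0; rewrite /f.
  rewrite (perm_big _ (perm_to_rem br)) big_cons => /eqP.
  by rewrite paddr_eq0 // ?sumr_ge0 // => /andP[/eqP].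
have [e e0 he] := compact_positive cK cf fpos.
pose m' := Num.max m 1.
have m1 : 0 < m' by rewrite /m' lt_max ltr01 orbT.
pose s1 : R := (size r).+1%:R.
have s0 : 0 < s1 by rewrite ltr0n.
exists (e / (s1 * m')); first by rewrite divr_gt0 // mulr_gt0.
move=> v' hv' [x [bx eqx]].
have Kx : K x by move=> i /=; rewrite in_itv /= bx.
have := he x Kx; apply/negP; rewrite -ltNge.
apply: (@le_lt_trans _ _ (\sum_(b <- r) e / s1)); last first.
  rewrite big_const_seq count_predT iter_addr addr0 -[_ *+ _]mulr_natr mulrAC ltr_pdivrMr //.
  by rewrite ltr_pM2l // ltr_nat.
rewrite /f big_seq [leRHS]big_seq; apply: ler_sum => b br.
have -> : eqn_residual v (fun c => x (Some c)) (x None) b =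
   (v b - v' b) * x (Some b).
  by have := eqx b br; rewrite /eqn_residual => h; rewrite -[LHS]subr0 -h; ring.
rewrite normrM distrC.
have xm : `|x (Some b)| <= m' by rewrite /m' le_max (hm b) // bx.
apply: (@le_trans _ _ (e / (s1 * m') * m')); first by rewrite ler_pM // ltW // hv'.
by rewrite invfM mulrA divfK // gt_eqF.
Qed.

End Coordinates.

End Measurability.

Section Event.
Context d (T : measurableType d) (R : realType) (P : probability T R).
Variables (V : Z2 -> {RV P >-> R}) (Vbar lam0 eps alpha l : R) (a : Z2) (n : nat) (Theta : set Z2).
Hypothesis boxE : forall b, box l a b <-> cube a n b.

(** Once a bound, a site where the solution is too large, and the set where it
    is small are fixed, a violation of unique continuation is a solution that meets
    closed bounds; there are countably many choices of these data. *)
Lemma event_measurable :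
  measurable (unique_continuation_event V Vbar lam0 eps alpha l a Theta).
Proof.
set kap := (side_length l * Vbar) `^ (- (alpha * side_length l)).
set M := (side_length l * Vbar) `^ (alpha * side_length l).
have M0 : 0 <= M by exact: powR_ge0.
(* In [x] the first component is the bound [j], the second a site [b0] with a value
   above [M + 1 / (j + 1)], and the third a set on which the modulus is at most [1]. *)
pose lo (x : nat * Z2 * {fset Z2}) (i : option Z2) : R := if i is Some b then
  (if b == x.1.2 then M + x.1.1.+1%:R^-1 else if b \in x.2 then -1 else - x.1.1.+1%:R)
  else lam0 - kap.
pose hi (x : nat * Z2 * {fset Z2}) (i : option Z2) : R := if i is Some b then
  (if b \in x.2 then 1 else x.1.1.+1%:R) else lam0 + kap.
pose ok (x : nat * Z2 * {fset Z2}) := [/\ scaled_box (1 / 100) l a x.1.2,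
  forall c, c \in x.2 -> (box l a `\` Theta) c &
  (1 - eps ^+ 3) * (ncard (box l a `\` Theta))%:R <= (#|` x.2|)%:R].
pose C x := [set v : Z2 -> R | exists y : option Z2 -> R, (forall i, lo x i <= y i <= hi x i) /\
   forall b, b \in square_pts a n -> eqn_residual v (fun c => y (Some c)) (y None) b = 0].
have -> : unique_continuation_event V Vbar lam0 eps alpha l a Theta =
    ~` \bigcup_x (if `[< ok x >] then [set w | C x (fun b => V b w)] else set0).
  apply/seteqP; split=> w.
    move=> Ew [[[j b0] G] _]; case: asboolP => // -[/= sb0 GQ Gcard] [y [ylh yeq]].
    have := Ew (y None) (fun c => y (Some c)) _ _ _ b0 sb0.
    have := ylh (Some b0); rewrite /= eqxx => /andP[yb0 _].
    have jpos : 0 < j.+1%:R^-1 :> R by rewrite invr_gt0.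
    move=> H; have : `|y (Some b0)| <= M.
      apply: H.
      - by have := ylh None; rewrite /= ler_distl.
      - by move=> b /boxE; rewrite -mem_square_pts => /yeq; rewrite -residual_eq0.
      - apply: (le_trans Gcard); rewrite ler_nat.
        rewrite (ncard_count (uniq_square_pts a n)); last first.
          by move=> b [[/boxE hb _] _]; rewrite mem_square_pts.
        rewrite -size_filter; apply: uniq_leq_size; first exact: fset_uniq.
        move=> c cG; have [bc Tc] := GQ c cG.
        rewrite mem_filter mem_square_pts; apply/andP; split; last exact/boxE.
        apply/asboolP; split=> //; have := ylh (Some c); rewrite /= cG ler_norml.
        case: eqP => _ /andP[h ->]; rewrite andbT; apply: le_trans h => //.
        by apply: (le_trans (lerN10 R)); rewrite addr_ge0 // ltW.
    by move=> h; have := le_trans yb0 (le_trans (ler_norm _) h); rewrite gerDl leNgt jpos.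
  move=> nb lam u hlam hu hcard b0 sb0; rewrite leNgt; apply/negP => big; apply: nb.
  pose F := b0 :: square_pts a n.+1.
  pose S := \sum_(c <- F) `|u c|.
  have uS c : c \in F -> `|u c| <= S.
    move=> cF; rewrite /S (perm_big _ (perm_to_rem cF)) big_cons.
    by rewrite lerDl sumr_ge0.
  have gap : 0 < `|u b0| - M by rewrite subr_gt0.
  pose j := Num.truncn (S + (`|u b0| - M)^-1).
  have S0 : 0 <= S by apply: sumr_ge0.
  have hj : S + (`|u b0| - M)^-1 < j.+1%:R by exact: truncnS_gt.
  have igap : 0 < (`|u b0| - M)^-1 by rewrite invr_gt0.
  have jS : S <= j.+1%:R by move: hj igap; lra.
  have jgap : M + j.+1%:R^-1 <= `|u b0|.
    rewrite addrC -lerBrDr -[leRHS]invrK lef_pV2 ?posrE ?ltr0n // ltW //.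
    by move: hj S0; lra.
  (* Replacing [u] by [- u] makes the large value positive; cutting [u] off away from
     the box makes it bounded and keeps the equation on the box. *)
  pose sg : R := Num.sg (u b0).
  have sgb : sg * u b0 = `|u b0| by rewrite -normrEsg.
  have sg1 : `|sg| = 1.
    rewrite normr_sg; case: eqP => // u0.
    by move: big; rewrite u0 normr0 ltNge M0.
  pose G : {fset Z2} := fset_set [set b | (box l a `\` Theta) b /\ `|u b| <= 1].
  have finG : finite_set [set b | (box l a `\` Theta) b /\ `|u b| <= 1].
    apply: (sub_finite_set (B := [set` square_pts a n])) => [b [[/boxE hb _] _]|]; last exact: finite_seq.
    by rewrite /= mem_square_pts.
  have memG c : c \in G -> (box l a `\` Theta) c /\ `|u c| <= 1.
    by rewrite in_fset_set // inE.
  exists (j, b0, G) => //; case: asboolP => [_|nok]; last first.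
    by exfalso; apply: nok; split=> // c /memG[].
  pose y (i : option Z2) : R := if i is Some c then (if c \in F then sg * u c else 0) else lam.
  have yle c : `|y (Some c)| <= j.+1%:R.
    rewrite /y; case: ifP => cF; last by rewrite normr0.
    by rewrite normrM sg1 mul1r (le_trans (uS c cF)).
  exists y; split=> [[c|]|b].
  - have yc := yle c; rewrite ler_norml in yc; case/andP: yc => yc1 yc2.
    have yG : c \in G -> -1 <= y (Some c) <= 1.
      move=> /memG[_ uc]; rewrite -ler_norml /y; case: ifP => _; last by rewrite normr0.
      by rewrite normrM sg1 mul1r.
    have yb : c = b0 -> y (Some c) = `|u b0|.
      by move=> ->; rewrite /y mem_head sgb.
    move: yc1 yc2 yG yb; move: (y (Some c)) => z yc1 yc2 yG yb.
    rewrite /lo /hi /=; have [cb|cb] := eqVneq c b0.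
      rewrite (yb cb) jgap /=; case: ifP => [/memG[_]|_]; first by rewrite cb.
      by apply: le_trans jS; apply: uS; exact: mem_head.
    by case: ifP => [/yG//|_]; rewrite yc1 yc2.
  - by rewrite /lo /hi /= -ler_distl.
  - rewrite mem_square_pts => hb; have := hu b ((boxE b).2 hb).
    rewrite residual_eq0.
    have inF c : cube a n.+1 c -> c \in F by rewrite in_cons mem_square_pts => ->; rewrite orbT.
    have near e : `|e.1| <= 1 -> `|e.2| <= 1 -> (b + e \in F).
      by move=> e1 e2; apply: inF; move: hb e1 e2; rewrite /cube /linf_norm /=; clear; lia.
    rewrite /eqn_residual /= (near (1, 0)) // (near (- (1, 0))) // (near (0, 1)) // (near (- (0, 1))) //.
    have -> : b \in F by have := near 0; rewrite addr0 => ->.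
    move=> h; rewrite -[RHS](mulr0 sg) -h; ring.
apply: measurableC; apply: countable_bigcupT_measurable => [|x]; first exact: countableP.
case: asboolP => // _; apply: (measurable_closed_sites (r := square_pts a n)).
  by move=> b; exact: measurable_funPT.
move=> v; apply: (solvable_closed (m := x.1.1.+1%:R)).
move=> b z; rewrite /lo /hi /= ler_norml => /andP[h1 h2].
have j1 : 1 <= x.1.1.+1%:R :> R by rewrite ler1n.
have jpos : 0 < x.1.1.+1%:R^-1 :> R by rewrite invr_gt0.
have key (J I : R) : 1 <= J -> 0 < I -> - J <= M + I by move: M0; lra.
have key' (J : R) : 1 <= J -> - J <= -1 by lra.
apply/andP; split.
  by apply: le_trans h1; case: eqP => _; [exact: key | case: ifP => _ //; exact: key'].
by apply: le_trans h2 _; case: ifP.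
Qed.

End Event.

(** * Conditioning on the potential *)

Section Cylinders.
Context d (T : measurableType d) (R : realType) (P : probability T R).
Variables (V : Z2 -> {RV P >-> R}) (Vbar : R).
Hypothesis iidV : iid_bernoulli Vbar V.

Definition cylinder (K : seq Z2) (v : Z2 -> bool) : set T :=
  [set w | forall q, q \in K -> V q w = (v q)%:R * Vbar].

Lemma value_measurable q x : measurable [set w | V q w = x].
Proof.
have := @measurable_funPT _ _ _ _ (V q) measurableT [set x] (measurable_set1 x).
by rewrite setTI.
Qed.

Lemma cylinder_measurable K v : measurable (cylinder K v).
Proof.
elim: K => [|q K IH].
  rewrite (_ : cylinder _ _ = setT); first exact: measurableT.
  by apply/seteqP; split=> w.
rewrite (_ : cylinder _ _ = [set w | V q w = (v q)%:R * Vbar] `&` cylinder K v).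
  by apply: measurableI => //; exact: value_measurable.
apply/seteqP; split=> w.
  move=> h; split; first by apply: h; exact: mem_head.
  by move=> q' hq'; apply: h; rewrite in_cons hq' orbT.
by move=> [h1 h2] q'; rewrite in_cons => /orP[/eqP -> //|]; exact: h2.
Qed.

Lemma cylinder_prob K v : uniq K -> P (cylinder K v) = (2^-1 ^+ size K)%:E.
Proof.
move=> uK; have [ind law] := iidV.
have := ind [fset q in K]%fset (fun q => [set (v q)%:R * Vbar]).
have -> : [set w | forall i, i \in [fset q in K]%fset -> [set (v i)%:R * Vbar] (V i w)] = cylinder K v.
  apply/seteqP; split=> w h q; first by move=> qK; apply: h; rewrite inE.
  by rewrite inE => qK; apply: h.
move=> ->; last by move=> i _; exact: measurable_set1.
rewrite (perm_big K) /=; last first.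
  apply: uniq_perm; [exact: fset_uniq|by []|move=> q; by rewrite inE].
have half q : P (V q @^-1` [set (v q)%:R * Vbar]) = (2^-1)%:E.
  have [h0 h1] := law q; case: (v q); rewrite ?mul1r ?mul0r; [exact: h1 | exact: h0].
under eq_bigr do rewrite half.
rewrite big_const_seq count_predT; elim: (size K) => [|k IH] /=; first by rewrite expr0.
by rewrite IH exprS EFinM.
Qed.

(** Conditioning on a site splits a cylinder into two of half the mass, up to a
    null set: probabilities are averages over the bits. *)
Lemma cylinder_average (E : set T) (bad : (Z2 -> bool) -> bool) (L K : seq Z2) v :
  Vbar != 0 -> measurable E -> uniq (K ++ L) ->
  (forall v', (forall q, q \notin L -> v' q = v q) -> ~~ bad v' -> cylinder (K ++ L) v' `<=` E) ->
  (((1 - avg L (fun v => (bad v)%:R) v) * 2^-1 ^+ size K)%:E <= P (E `&` cylinder K v))%E.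
Proof.
move=> Vb0 mE; elim: L K v => [|q L IH] K v uKL good /=.
  have mI : measurable (E `&` cylinder K v) by apply: measurableI => //; exact: cylinder_measurable.
  case b: (bad v); first by rewrite subrr mul0r; exact: measure_ge0.
  rewrite subr0 mul1r -(cylinder_prob v) //; last by rewrite cats0 in uKL.
  rewrite (_ : E `&` cylinder K v = cylinder K v) //.
  by apply: setIidr; have := good v (fun _ _ => erefl) (negbT b); rewrite cats0.
pose vc c := upd v q c.
have qK : q \notin K by move: uKL; rewrite cat_uniq /= negb_or => /and3P[_ /andP[]].
have uKq : uniq (rcons K q ++ L) by rewrite cat_rcons.
have sub c : (((1 - avg L (fun v => (bad v)%:R) (vc c)) * 2^-1 ^+ (size K).+1)%:E
    <= P (E `&` cylinder (rcons K q) (vc c)))%E.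
  rewrite -(size_rcons K q); apply: IH => // v' hv'; rewrite cat_rcons; apply: good.
  move=> q'; rewrite in_cons negb_or => /andP[q'q q'L]; rewrite hv' // /vc /upd.
  by rewrite (negbTE q'q).
have cylE c : cylinder (rcons K q) (vc c) = cylinder K v `&` [set w | V q w = c%:R * Vbar].
  apply/seteqP; split=> w.
    move=> h; split.
      move=> q' q'K; rewrite h ?mem_rcons ?in_cons ?q'K ?orbT // /vc /upd.
      case: eqP => // qq; by rewrite -qq q'K in qK.
    by have := h q; rewrite mem_rcons mem_head /vc /upd eqxx; apply.
  move=> [h1 h2] q'; rewrite mem_rcons in_cons /vc /upd; case: eqP => [-> //|_] /=; exact: h1.
have m c : measurable (E `&` cylinder (rcons K q) (vc c)).
  by apply: measurableI => //; exact: cylinder_measurable.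
have disj : (E `&` cylinder (rcons K q) (vc false)) `&` (E `&` cylinder (rcons K q) (vc true)) = set0.
  apply/seteqP; split=> // w [[_]]; rewrite !cylE => -[_ h0] [_ [_ h1]].
  by move: h0; rewrite /= h1 mul1r mul0r => /eqP; rewrite (negbTE Vb0).
have le : (P ((E `&` cylinder (rcons K q) (vc false)) `|` (E `&` cylinder (rcons K q) (vc true)))
    <= P (E `&` cylinder K v))%E.
  apply: le_measure; rewrite ?inE.
  - by apply: measurableU.
  - by apply: measurableI => //; exact: cylinder_measurable.
  - by move=> w [] [Ew]; rewrite cylE => -[h _].
apply: le_trans le; rewrite measureU //.
apply: le_trans (leeD (sub false) (sub true)).
rewrite -EFinD lee_fin /avg1 -/(vc false) -/(vc true) exprS.
by rewrite le_eqVlt; apply/orP; left; apply/eqP; move: (2^-1 ^+ size K) => z; field.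
Qed.

(** Conditionally on the bits on [K], the event has at least the probability that
    fresh bits on [L] are not bad. *)
Lemma cond_prob_lower (E : set T) (bad : (Z2 -> bool) -> bool) (L K : seq Z2) v :
  Vbar != 0 -> measurable E -> uniq (K ++ L) ->
  (forall v', (forall q, q \notin L -> v' q = v q) -> ~~ bad v' -> cylinder (K ++ L) v' `<=` E) ->
  1 - avg L (fun v => (bad v)%:R) v <= cond_prob P E (cylinder K v).
Proof.
move=> Vb0 mE uKL good.
have uK : uniq K by move: uKL; rewrite cat_uniq => /andP[].
have h := cylinder_average Vb0 mE uKL good.
have mI : measurable (E `&` cylinder K v) by apply: measurableI => //; exact: cylinder_measurable.
rewrite /cond_prob (cylinder_prob v uK) /= ler_pdivlMr ?exprn_gt0 ?invr_gt0 //.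
by rewrite -lee_fin fineK ?fin_num_measure.
Qed.

End Cylinders.

(** * Numerical estimates *)

Lemma cube_root n : exists k, (k ^ 3 <= n < k.+1 ^ 3)%N.
Proof.
have ex : exists k, (k ^ 3 <= n)%N by exists 0%N.
have bd k : (k ^ 3 <= n)%N -> (k <= n)%N.
  by case: k => // k; apply: leq_trans; rewrite expnS leq_pmulr // expn_gt0.
case: (ex_maxnP ex bd) => k hk max; exists k; rewrite hk /= ltnNge; apply/negP => /max.
by rewrite ltnn.
Qed.

Section Numerics.
Variable R : realType.

(** For a box of side about [k ^ 3], a mesh of about [4 k ^ 2] leaves room for a grid
    of starting points with about [k / 100] cells a side, inside the middle part of
    the box. *)
Lemma start_dims (n k k' : nat) : (200 <= k)%N -> (k ^ 3 <= n < k.+1 ^ 3)%N ->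
  (100 * k' <= k < 100 * k' + 100)%N ->
  [/\ (20 * (k' * (4 * k ^ 2).+1) <= n)%N, (k <= 200 * k')%N,
      n%:R ^+ 2 <= (400 * 400) * ((4 * k ^ 2).+1 ^ 2 * k' ^ 2)%N%:R :> R &
      n%:R <= 8 * k%:R ^+ 3 :> R].
Proof.
move=> k200 /andP[kn nk] /andP[k1 k2].
have kk : (k <= 200 * k')%N by move: k200 k2; clear; lia.
have M5 : ((4 * k ^ 2).+1 <= 5 * k ^ 2)%N.
  have : (1 <= k ^ 2)%N by rewrite expn_gt0; move: k200; clear; lia.
  by clear; lia.
have n8 : (n <= 8 * k ^ 3)%N.
  have : (k.+1 ^ 3 <= (2 * k) ^ 3)%N by rewrite leq_exp2r //; move: k200; clear; lia.
  rewrite expnMn (_ : 2 ^ 3 = 8)%N //; move: nk; clear; lia.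
split=> //.
- apply: leq_trans kn; apply: (@leq_trans (20 * (k' * (5 * k ^ 2)))).
    by rewrite !leq_mul2l M5 !orbT.
  rewrite [in leqRHS]expnS; have : (100 * k' * k ^ 2 <= k * k ^ 2)%N by rewrite leq_mul2r k1 orbT.
  by move: (k ^ 2)%N => x; clear; nia.
- rewrite -natrX; have -> : 400 * 400 = (400 * 400)%N%:R :> R by rewrite natrM.
  rewrite -natrM ler_nat; apply: (@leq_trans ((8 * k ^ 3) ^ 2)); first by rewrite leq_exp2r.
  apply: (@leq_trans (400 * 400 * ((4 * k ^ 2) ^ 2 * k' ^ 2))); last first.
    by rewrite leq_mul2l leq_mul2r leq_exp2r // leqnSn !orbT.
  have -> : (400 * 400 * ((4 * k ^ 2) ^ 2 * k' ^ 2) = (k ^ 2) ^ 2 * (8 * (200 * k')) ^ 2)%N.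
    by move: (k ^ 2)%N => x; clear; nia.
  have -> : ((8 * k ^ 3) ^ 2 = (k ^ 2) ^ 2 * (8 * k) ^ 2)%N.
    by rewrite [(k ^ 3)%N]expnS; move: (k ^ 2)%N => x; clear; nia.
  by rewrite leq_mul2l leq_exp2r // leq_mul2l kk !orbT.
- by rewrite -natrX -natrM ler_nat.
Qed.

(** [expR z >= z ^ 10] with [z = x ^ 2 / (10 D)] turns the exponential into a power
    of degree [20]. *)
Lemma power_le_exp (D x : R) : 0 < D -> 1 <= x -> 226 * (10 * D) ^+ 10 <= x ->
  226 * x ^+ 9 <= expR (x ^+ 2 / D).
Proof.
move=> D0 x1 hx.
have x0 : 0 < x by apply: lt_le_trans x1.
have E0 : 0 < 10 * D by rewrite mulr_gt0.
have -> : x ^+ 2 / D = 10 * (x ^+ 2 / (10 * D)) by field; apply: lt0r_neq0.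
rewrite expRM_natl; apply: (@le_trans _ _ ((x ^+ 2 / (10 * D)) ^+ 10)); last first.
  rewrite lerXn2r ?nnegrE ?expR_ge0 //; first by rewrite divr_ge0 // ?exprn_ge0 // ltW.
  by apply: le_trans (expR_ge1Dx _); rewrite lerDr.
rewrite expr_div_n ler_pdivlMr ?exprn_gt0 // mulrAC -exprM.
apply: (@le_trans _ _ (x * x ^+ 9)); first by rewrite ler_wpM2r // exprn_ge0 // ltW.
by rewrite -exprS ler_weXn2l.
Qed.

(** Both probabilities are at most a polynomial in [k] times [exp (- k ^ 2 / 80000)], by
    [1 / 2 <= exp (- 1 / 2)]; half of the exponent absorbs the polynomial. The side
    of the box is at most [(4 k) ^ 3], so its power [2 / 3] is at most [16 k ^ 2]. *)
Lemma rate_bound (n k k' : nat) (eps c : R) : 0 <= eps -> c = 400 ->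
  16 * eps <= (c * c)^-1 -> (200 <= k)%N -> (k ^ 3 <= n < k.+1 ^ 3)%N ->
  (100 * k' <= k < 100 * k' + 100)%N -> 226 * (10 * (c * c)) ^+ 10 <= k%:R ->
  ((4 * k ^ 2).+1 ^ 2)%:R * 2^-1 ^+ (k' ^ 2) +
  ((4 * k ^ 2).+1 ^ 2 * k' ^ 2 * n.+1)%N%:R * expR (- ((k ^ 2)%:R / 30)) <=
  expR (- (eps * (2 * n%:R) `^ (2 / 3))).
Proof.
set D := c * c; move=> eps0 cE epsD k200 nk k'k kbig.
have [_ kk _ n8] := start_dims k200 nk k'k.
have c0 : 0 < c by rewrite cE ltr0n.
have D0 : 0 < D by rewrite mulr_gt0.
pose x : R := k%:R; pose y := x ^+ 2 / D.
have x1 : 1 <= x by rewrite ler1n; move: k200; clear; lia.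
have x0 : 0 <= x by apply: le_trans x1.
have y0 : 0 <= y by rewrite divr_ge0 ?exprn_ge0 // ltW.
have main := power_le_exp D0 x1 kbig; rewrite -/x -/y in main.
have t1 : 2^-1 ^+ (k' ^ 2) <= expR (- (2 * y)).
  have half : 2^-1 <= expR (- 2^-1) :> R.
    apply: le_trans (expR_ge1Dx _); lra.
  apply: (@le_trans _ _ (expR (- 2^-1) ^+ (k' ^ 2))).
    by rewrite lerXn2r ?nnegrE ?expR_ge0 // invr_ge0.
  rewrite -expRM_natl ler_expR mulrN lerN2.
  have : x ^+ 2 <= (200 * k'%:R) ^+ 2.
    rewrite lerXn2r ?nnegrE ?mulr_ge0 // /x -natrM ler_nat //.
  rewrite /y mulrA ler_pdivrMr //.
  move=> hx; apply: (le_trans (ler_wpM2l _ hx)) => //.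
  have half_c : 200 = c / 2 :> R by rewrite cE; lra.
  by rewrite half_c natrX /D; move: (k'%:R) => z; lra.
have t2 : expR (- ((k ^ 2)%:R / 30)) <= expR (- (2 * y)).
  rewrite ler_expR lerN2 natrX -/x /y.
  have D60 : 60 <= D.
    have c60 : 60 <= c by rewrite cE ler_nat.
    by apply: (le_trans c60); rewrite ler_peMl ?(ltW c0) //; move: c60; lra.
  rewrite mulrCA ler_wpM2l ?exprn_ge0 // ler_pdivrMr //; lra.
have pre : ((4 * k ^ 2).+1 ^ 2)%:R + ((4 * k ^ 2).+1 ^ 2 * k' ^ 2 * n.+1)%N%:R <= 226 * x ^+ 9 :> R.
  rewrite /x -natrD -natrX -natrM ler_nat.
  have M5 : ((4 * k ^ 2).+1 <= 5 * k ^ 2)%N.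
    have : (1 <= k ^ 2)%N by rewrite expn_gt0; move: k200; clear; lia.
    by clear; lia.
  have M25 : ((4 * k ^ 2).+1 ^ 2 <= 25 * k ^ 4)%N.
    have : ((4 * k ^ 2).+1 ^ 2 <= (5 * k ^ 2) ^ 2)%N by rewrite leq_exp2r.
    by move=> h; apply: (leq_trans h); rewrite expnMn -expnM; exact: leqnn.
  have n9 : (n.+1 <= 9 * k ^ 3)%N.
    have : (1 <= k ^ 3)%N by rewrite expn_gt0; move: k200; clear; lia.
    by move: n8; rewrite -natrX -natrM ler_nat; clear; lia.
  have k2 : (k' ^ 2 <= k ^ 2)%N by rewrite leq_exp2r //; move: k'k; clear; lia.
  have lead : ((4 * k ^ 2).+1 ^ 2 * k' ^ 2 * n.+1 <= 25 * k ^ 4 * k ^ 2 * (9 * k ^ 3))%N.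
    exact: leq_mul (leq_mul M25 k2) n9.
  have low : (25 * k ^ 4 <= k ^ 9)%N.
    rewrite -[(k ^ 9)%N]/(k ^ (5 + 4))%N expnD leq_mul2r; apply/orP; right.
    apply: (@leq_trans (k ^ 1)); first by rewrite expn1; move: k200; clear; lia.
    by rewrite leq_pexp2l //; move: k200; clear; lia.
  have k9 : (25 * k ^ 4 * k ^ 2 * (9 * k ^ 3) = 225 * k ^ 9)%N.
    by rewrite -[(k ^ 9)%N]/(k ^ (4 + 2 + 3))%N !expnD; clear; lia.
  by move: M25 lead low; rewrite k9; move: (_ ^ 2)%N (_ * n.+1)%N (k ^ 4)%N (k ^ 9)%N; clear; lia.
apply: (@le_trans _ _ (226 * x ^+ 9 * expR (- (2 * y)))).
  apply: le_trans (ler_wpM2r (expR_ge0 _) pre); rewrite mulrDl.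
  by apply: lerD; rewrite ler_wpM2l.
apply: (@le_trans _ _ (expR y * expR (- (2 * y)))); first by rewrite ler_wpM2r ?expR_ge0.
rewrite -expRD ler_expR.
have pw : (2 * n%:R) `^ (2 / 3) <= 16 * x ^+ 2.
  apply: (@le_trans _ _ (((4 * x) ^+ 3) `^ (2 / 3))).
    apply: ge0_ler_powR; rewrite ?nnegrE ?exprn_ge0 ?mulr_ge0 //.
    by rewrite exprMn; have x3 : 0 <= x ^+ 3 by [apply: exprn_ge0]; move: n8 x3; rewrite -/x; lra.
  rewrite -powR_mulrn ?mulr_ge0 // -powRrM.
  rewrite (_ : 3%:R * (2 / 3) = 2%:R :> R); last by field.
  by rewrite powR_mulrn ?mulr_ge0 // exprMn (_ : 4 ^+ 2 = 16 :> R) //; ring.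
apply: (@le_trans _ _ (- y)); first by lra.
rewrite lerN2; apply: (le_trans (ler_wpM2l eps0 pw)).
rewrite mulrA /y [leRHS]mulrC ler_wpM2r ?exprn_ge0 // mulrC //.
Qed.

End Numerics.

(** * Good configurations *)

Section GoodConfigurations.
Variables (R : realType) (C eps Vb lam0 alpha l : R) (a : Z2) (n H0 cut k : nat) (Theta : set Z2).
Hypothesis C0 : 0 < C.
Hypothesis eC : C = 6000 * 5000.
Hypothesis eps0 : 0 < eps.
Hypothesis eps1 : eps <= 1 / (1000 * 1000).
Hypothesis boxE : forall b, box l a b <-> cube a n b.
Hypothesis sideE : side_length l = 2 * n%:R.
Hypothesis scaledE : forall b, scaled_box (1 / 100) l a b -> 100 * linf_norm (a - b) <= n%:Z.
Hypothesis alpha_big : 200 <= alpha.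
Hypothesis n100 : (100 <= n)%N.
Hypothesis ThetaQ : Theta `<=` [set b | cube a n b].
Hypothesis regTheta : regular eps Theta [set b | cube a n b].
Hypothesis H012 : 12000 <= H0%:R :> R.
Hypothesis H4n : (4 * H0 <= n)%N.
Hypothesis Vb2 : 2 <= Vb.
Hypothesis lam08 : 0 <= lam0 <= 8.
Hypothesis small_start : (20 * (k * (4 * cut).+1) <= n)%N.
Hypothesis hnum : eps * (size (square_pts a n))%:R *
  (2 * ((2 * H0).+1 ^ 2)%:R + 100 * C + 25)
  < (size (start_pts a (4 * cut).+1 k))%:R / 2.

Let W : R := side_length l * Vb.

Lemma W_big : 45 <= W.
Proof.
have h : 100 <= n%:R :> R by rewrite ler_nat.
have key (x y : R) : 100 <= x -> 2 <= y -> 45 <= 2 * x * y by move=> hx hy; nra.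
by rewrite /W sideE; apply: key.
Qed.

(** The exceptional free sites are a fraction [eps ^ 3 <= eps] of the free sites. *)
Lemma large_sites_few (u : Z2 -> R) :
  (1 - eps ^+ 3) * (ncard (box l a `\` Theta))%:R
      <= (ncard [set b | (box l a `\` Theta) b /\ `|u b| <= 1])%:R ->
  (size [seq b <- square_pts a n | ~~ `[< Theta b >] && (1 < `|u b|)])%:R
    <= eps * (size (square_pts a n))%:R.
Proof.
set Q := square_pts a n; have uQ : uniq Q by exact: uniq_square_pts.
rewrite (ncard_count uQ); last by move=> b [/boxE hb _]; rewrite mem_square_pts.
rewrite (ncard_count uQ); last by move=> b [[/boxE hb _] _]; rewrite mem_square_pts.
set N := count _ Q; set G := count _ Q; rewrite size_filter => frac.
set B := count _ Q.
have NG : (B + G = N)%N.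
  rewrite /N -size_filter -(count_predC (fun b => (1 < `|u b|)%R)) !count_filter.
  congr addn; apply: eq_in_count => b; rewrite mem_square_pts => /boxE hb /=.
    by rewrite andbC; congr andb; apply/idP/asboolP => [/asboolPn //|[_ nT]]; apply/asboolPn.
  rewrite -leNgt; apply/asboolP/andP => [[h1 h2]|[h2 /asboolP h1] //].
  by split=> //; apply/asboolP.
have NQ : (N <= size Q)%N by exact: count_size.
have small (e m : R) : 1 <= m -> e <= 1 / (m * m) -> e <= 1.
  move=> m1 h; have m0 : 0 < m by apply: lt_le_trans m1.
  apply: (le_trans h); rewrite div1r invf_le1 ?mulr_gt0 //; exact: mulr_ege1.
have e1 : eps <= 1 by apply: small eps1; rewrite ler1n.
have e3 : eps ^+ 3 <= eps by rewrite -[leRHS]expr1; apply: ler_wiXn2l => //; exact: ltW.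
have := congr1 (fun m => m%:R : R) NG; rewrite natrD => /= NGR.
have NQR : N%:R <= (size Q)%:R :> R by rewrite ler_nat.
have key (e e' c g m q : R) : 0 <= e' -> e' <= e -> 0 <= m -> m <= q -> c + g = m ->
    (1 - e') * m <= g -> c <= e * q.
  by move=> h0 h1 h2 h3 h4 h5; apply: (@le_trans _ _ (e' * m)); [lra|apply: ler_pM].
by apply: (key _ (eps ^+ 3) _ G%:R N%:R) => //; rewrite exprn_ge0 // ltW.
Qed.

(** The centre of the box is close to every starting point, so the ball reached
    by the growth covers the central hundredth. *)
Lemma good_event d (T : measurableType d) (P : probability T R) (V : Z2 -> {RV P >-> R})
    (v : Z2 -> bool) w :
  (forall b, cube a n b -> V b w = (v b)%:R * Vb) ->
  ~~ many_fail eps Vb lam0 a n H0 cut k Theta v ->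
  unique_continuation_event V Vb lam0 eps alpha l a Theta w.
Proof.
move=> hV few lam u hlam hu frac b cb.
have W45 := W_big; have W1 : 1 <= W by apply: le_trans W45; rewrite ler1n.
have W0 : 0 <= W by apply: le_trans W1.
have toW (m : nat) : m%:R <= alpha * side_length l -> W ^+ m <= W `^ (alpha * side_length l).
  by move=> h; rewrite -powR_mulrn //; apply: ler_powR.
have side0 : 0 <= n%:R :> R by [].
have lamK : `|lam - lam0| <= (W ^+ 2) ^- (8 * n).
  apply: (le_trans hlam); rewrite powRN -exprM lef_pV2 ?posrE ?powR_gt0 ?exprn_gt0 //; last 2 first.
  - by apply: lt_le_trans W1.
  - by apply: lt_le_trans W1.
  apply: toW; rewrite sideE mulrCA mulrA !natrM; move: alpha_big side0.
  move: (n%:R : R) => x h1 h2; rewrite -[_ * alpha]mulrC; nra.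
have few' : (count (fun p => `[< exists h, [/\ (H0 <= h)%N, (4 * h <= n)%N &
    sparse eps Theta [set b | ball p (2 * h) b] /\ fail_at Vb lam0 p h v] >])
    (start_pts a (4 * cut).+1 k))%:R <= (size (start_pts a (4 * cut).+1 k))%:R / 2 :> R.
  by rewrite ler_pdivlMr // -natrM ler_nat mulnC leqNgt.
have [p pP0 [h /andP[nh hn] bound]] : exists2 p, p \in start_pts a (4 * cut).+1 k &
  exists2 h, (n < 4 * h <= 2 * n)%N & forall b, ball p h b -> `|u b| <= (W ^+ 2) ^+ (64 * h).
  apply: (@growth_bound R C eps Vb lam0 lam (W ^+ 2) a n H0 Theta v (fun c => V c w) u
     (start_pts a (4 * cut).+1 k) [seq b <- square_pts a n | ~~ `[< Theta b >] && (1 < `|u b|)]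
     C0 eps0 eps1 ThetaQ regTheta H012 (large_sites_few frac) _ H4n (uniq_start _ _ _) _
     few' hnum eC Vb2 lam08 _ _ lamK).
  - move=> c hc; rewrite mem_filter mem_square_pts hc andbT negb_and negbK -leNgt.
    by case/orP => [/asboolP|].
  - move=> q c r qP0; apply: (start_central (n := n) (cut := cut) (k := k)); last exact: qP0.
    by apply: leq_trans small_start; rewrite leq_mul2r orbT.
  - exact: exprn_ege1.
  - have -> : 18 * (5 * n)%:R * Vb = 45 * W by rewrite /W sideE natrM; ring.
    by rewrite expr2 ler_wpM2r.
  - by move=> c hc; split; [apply: hu; apply/boxE | apply: hV].
have pb : ball p h b.
  have := start_near pP0; have := scaledE cb; move: small_start nh.
  rewrite /cube /ball /linf_norm /l1_norm; move: (k * _)%N => m; clear.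
  by case: a p b => a1 a2 [p1 p2] [b1 b2] /=; lia.
apply: (le_trans (bound b pb)); rewrite -exprM; apply: toW.
rewrite sideE; apply: (@le_trans _ _ (64 * n)%N%:R); first by rewrite ler_nat; move: hn; clear; lia.
rewrite natrM; move: alpha_big side0; move: (n%:R : R) => x h1 h2; nra.
Qed.

End GoodConfigurations.

(** A box depends on [l] only through the integer part of [(l - 1) / 2]; the central
    hundredth of the box has radius at most [n / 100]. *)
Lemma box_cube (R : realType) (l : R) a : 1 <= l -> exists n,
  [/\ forall b, box l a b <-> cube a n b, side_length l = 2 * n%:R &
    (100 <= n)%N -> forall b, scaled_box (1 / 100) l a b -> 100 * linf_norm (a - b) <= n%:Z].
Proof.
move=> l1; have fl0 : 0 <= Num.floor ((l - 1) / 2) by rewrite floor_ge0 divr_ge0 // subr_ge0.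
have [n En] : exists n : nat, Num.floor ((l - 1) / 2) = n%:Z.
  by exists `|Num.floor ((l - 1) / 2)|%N; rewrite gez0_abs.
exists n; split.
- by move=> b; rewrite /box /cube /= -floor_ge_int En.
- by rewrite /side_length En.
move=> n100 b; rewrite /scaled_box /box /= => hb.
have hl : (l - 1) / 2 < n%:R + 1.
  by have := lt_succ_floor ((l - 1) / 2); rewrite En intrD.
rewrite -(@ler_int R) intrM.
have n100R : 100 <= n%:R :> R by rewrite ler_nat.
have key (x y z : R) : x <= (1 / 100 * y - 1) / 2 -> (y - 1) / 2 < z + 1 -> 100 <= z -> 100 * x <= z.
  by lra.
exact: key hb hl n100R.
Qed.

(** The bound [1 / (3 m ^ 2 K)] on [eps] leaves a positive fraction of the at
    least [n ^ 2 / c ^ 2] starting points once the deterministic obstructions, whose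
    weight is [K], are removed. *)
Lemma small_constants (R : realType) (K m c : R) : 25 <= K -> m = 1000 -> c = 400 ->
  [/\ 0 < 1 / (m * m * (3 * K)) < 1 / 100, 1 / (m * m * (3 * K)) <= 1 / (m * m),
      16 * (1 / (m * m * (3 * K))) <= (c * c)^-1 &
      forall (eps : R) (n : nat) (S : R), 0 < eps <= 1 / (m * m * (3 * K)) -> (1 <= n)%N ->
        0 < S -> n%:R ^+ 2 <= c * c * S ->
        eps * ((2 * n).+1 ^ 2)%N%:R * K < S / 2].
Proof.
move=> K25 mE cE; have m0 : 0 < m by rewrite mE ltr0n.
have cm : c = 2 / 5 * m by rewrite mE cE; lra.
have m_ge : 1000 <= m by rewrite mE.
have K0 : 0 < K by apply: lt_le_trans K25; rewrite ltr0n.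
set t := 1 / (m * m); have t0 : 0 < t by rewrite divr_gt0 // mulr_gt0.
have tm : t * (m * m) = 1 by rewrite /t; field; exact: lt0r_neq0.
have m1 : 1 <= m by apply: le_trans m_ge; rewrite ler1n.
have t1 : t * 1000 <= 1.
  have mm : m <= m * m by rewrite ler_peMl // ltW.
  by move: (ler_wpM2l (ltW t0) (le_trans m_ge mm)); rewrite tm.
set e := 1 / (m * m * (3 * K)).
have m0' := lt0r_neq0 m0; have K0' := lt0r_neq0 K0.
have eK : e * K = t / 3 by rewrite /e /t; field; rewrite m0' K0'.
have e0 : 0 < e by rewrite divr_gt0 // !mulr_gt0.
have e75 : 75 * e <= t by have := ler_wpM2l (ltW e0) K25; rewrite eK; lra.
have tc : t * (c * c) = 4 / 25 by rewrite /t cm; field.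
have c0 : 0 < c by rewrite cm mulr_gt0.
split; first by apply/andP; split=> //; move: e0 e75 t1; lra.
- by move: e0 e75; lra.
- have -> : (c * c)^-1 = 25 / 4 * t by rewrite /t cm; field.
  by move: e0 e75; lra.
move=> eps n S /andP[eps0 epse] n1 S0 nS.
have n1R : 1 <= n%:R :> R by rewrite ler1n.
have sq : ((2 * n).+1 ^ 2)%N%:R <= 9 * n%:R ^+ 2 :> R.
  rewrite natrX -addn1 natrD natrM; move: n1R; move: (n%:R : R) => x; nra.
apply: (@le_lt_trans _ _ (e * (9 * (c * c * S)) * K)).
  rewrite ler_wpM2r ?(ltW K0) //; apply: ler_pM => //; first exact: ltW.
  by apply: (le_trans sq); rewrite ler_wpM2l.
have -> : e * (9 * (c * c * S)) * K = 3 * (t * (c * c)) * S.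
  by transitivity (e * K * (9 * (c * c * S))); [ring|rewrite eK; field].
by rewrite tc; move: S0; lra.
Qed.

Lemma nat_above (R : realType) (x : R) (m : nat) : exists k : nat, x <= k%:R /\ (m <= k)%N.
Proof.
exists (maxn (Num.truncn x).+1 m); rewrite leq_maxr; split=> //.
by apply: ltW; apply: (lt_le_trans (truncnS_gt x)); rewrite ler_nat leq_maxl.
Qed.

(** * Unique continuation *)

Theorem lemma3p5 (R : realType) :
  exists eps1 : R, 0 < eps1 < 1 / 100 /\
  forall eps : R, 0 < eps <= eps1 ->
  exists alpha : R, 1 < alpha /\
  forall (d : measure_display) (T : measurableType d) (P : probability T R)
    (Vbar lambda0 : R) (V : Z2 -> {RV P >-> R})
    (l : R) (a : Z2) (Theta : set Z2) (V' : Z2 -> R),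
    iid_bernoulli Vbar V ->
    1 <= l ->
    alpha <= side_length l ->
    Theta `<=` box l a ->
    regular eps Theta (box l a) ->
    2 <= Vbar ->
    0 <= lambda0 <= 8 ->
    (forall b, Theta b -> V' b = 0 \/ V' b = Vbar) ->
    1 - expR (- (eps * side_length l `^ (2 / 3)))
      <= cond_prob P
           (unique_continuation_event V Vbar lambda0 eps alpha l a Theta)
           [set w | forall b, Theta b -> V b w = V' b].
Proof.
(* [H0] is the smallest scale: a tilted square of radius [H0] free of exceptional and
   frozen sites starts the growth. *)
have [H0 [H012 _]] := nat_above (12000 : R) 0.
have [m mE] : exists m : R, m = 1000 by exists 1000.
have [c cE] : exists c : R, c = 400 by exists 400.
have [C [C0 CE]] : exists C : R, 0 < C /\ C = 6000 * 5000.
  have [x xE] : exists x : R, x = 6000 by exists 6000.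
  have [y yE] : exists y : R, y = 5000 by exists 5000.
  have x0 : 0 < x by rewrite xE ltr0n.
  have y0 : 0 < y by rewrite yE ltr0n.
  by exists (x * y); split; [exact: mulr_gt0 | exact: (congr2 *%R xE yE)].
(* From [k0] on the polynomial prefactors are absorbed by the exponential. *)
have [k0 [k0_big k0_200]] := nat_above (226 * (10 * (c * c)) ^+ 10) 200.
pose K : R := 2 * ((2 * H0).+1 ^ 2)%:R + 100 * C + 25.
have K25 : 25 <= K by rewrite /K lerDr addr_ge0 // mulr_ge0 // ltW.
have [eps1_01 eps1_m eps1_c starts] := small_constants K25 mE cE.
set eps1 := 1 / (m * m * (3 * K)) in eps1_01 eps1_m eps1_c starts.
exists eps1; split=> // eps epsP; have /andP[eps0 eps_le] := epsP.
have eps_m : eps <= 1 / (1000 * 1000) by rewrite -mE; apply: le_trans eps1_m.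
have eps_c : 16 * eps <= (c * c)^-1 by apply: le_trans eps1_c; rewrite ler_wpM2l.
(* As an exponent [alpha] must exceed [32], the cost of the growth; as a lower bound
   for the side it makes [k >= k0] and lets the scale [H0] fit into the box. *)
exists (2 * k0 ^ 3 + 8 * H0 + 200)%N%:R; split; first by rewrite ltr1n addnS ltnS addnS.
move=> d T P Vbar lam0 V l a Theta V' iidV l1 side_big ThetaQ regTheta Vbar2 lam08 V'_val.
have [n [boxE sideE scaledE]] := box_cube a l1.
have : (2 * k0 ^ 3 + 8 * H0 + 200 <= 2 * n)%N by rewrite -(ler_nat R) [leRHS]natrM -sideE.
move=> n_big.
have n100 : (100 <= n)%N by move: n_big; move: (k0 ^ 3)%N; clear; lia.
have H4n : (4 * H0 <= n)%N by move: n_big; move: (k0 ^ 3)%N; clear; lia.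
have k0n : (k0 ^ 3 <= n)%N by move: n_big; move: (k0 ^ 3)%N; clear; lia.
(* Scales up to [k ^ 2] are treated as independent, larger ones by a union bound. *)
have [k kn] := cube_root n.
have k0k : (k0 <= k)%N.
  rewrite -ltnS -(@ltn_exp2r _ _ 3) //; apply: (leq_ltn_trans k0n).
  by case/andP: kn.
have k200 : (200 <= k)%N by apply: leq_trans k0k.
pose k' := (k %/ 100)%N.
have k'k : (100 * k' <= k < 100 * k' + 100)%N by rewrite /k'; clear; lia.
have [small kk' n2 _] := start_dims R k200 kn k'k.
have boxS : box l a = [set b | cube a n b] by apply/seteqP; split=> b /boxE.
rewrite boxS in ThetaQ regTheta.
have few := starts eps n ((4 * k ^ 2).+1 ^ 2 * k' ^ 2)%N%:R epsP.
have hnum : eps * (size (square_pts a n))%:R * K < (size (start_pts a (4 * k ^ 2).+1 k'))%:R / 2.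
  rewrite size_square_pts size_start; apply: few; first by apply: leq_trans n100.
    rewrite ltr0n muln_gt0 !expn_gt0 /=; move: kk' k200; clear; lia.
  by rewrite cE.
pose v0 b := `[< V' b = Vbar >].
have Vbar0 : Vbar != 0 by rewrite gt_eqF //; apply: lt_le_trans Vbar2.
have -> : [set w | forall b, Theta b -> V b w = V' b] = cylinder V Vbar (theta_pts a n Theta) v0.
  have v0E b : Theta b -> (v0 b)%:R * Vbar = V' b.
    move=> Tb; rewrite /v0; case: asboolP => [->|ne]; first by rewrite mul1r.
    by rewrite mul0r; case: (V'_val b Tb) => // /ne.
  apply/seteqP; split=> w hw b.
    by rewrite mem_filter => /andP[/asboolP Tb _]; rewrite hw // v0E.
  move=> Tb; rewrite hw ?v0E // mem_filter; apply/andP; split; first exact/asboolP.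
  by rewrite mem_square_pts; exact: ThetaQ.
have unlikely := many_fail_unlikely (k := k') eps0 eps_m ThetaQ H012 Vbar2 lam08
  (cut := k ^ 2) (leq_trans (leq_mul (isT : 2 <= 20)%N (leqnn _)) small) v0.
have k_big : 226 * (10 * (c * c)) ^+ 10 <= k%:R by apply: le_trans k0_big _; rewrite ler_nat.
have rate := rate_bound (ltW eps0) cE eps_c k200 kn k'k k_big.
rewrite size_start in unlikely.
apply: (@le_trans _ _ (1 - avg (free_sites a n Theta)
    (fun v => (many_fail eps Vbar lam0 a n H0 (k ^ 2) k' Theta v)%:R) v0)).
  by rewrite lerD2l lerN2 sideE; exact: le_trans unlikely rate.
apply: (cond_prob_lower iidV Vbar0 (event_measurable V Vbar lam0 eps _ Theta boxE)).
  rewrite cat_uniq !filter_uniq ?uniq_square_pts // andbT.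
  apply/hasPn => b; rewrite mem_filter => /andP[nT _].
  by rewrite mem_filter (negbTE nT).
move=> v _ good w cyl.
apply: (good_event C0 CE eps0 eps_m boxE sideE (scaledE n100) _ n100 ThetaQ regTheta H012 H4n
  Vbar2 lam08 small hnum _ good).
  by rewrite ler_nat leq_addl.
move=> b hb; apply: cyl; rewrite mem_cat !mem_filter mem_square_pts hb !andbT.
by case: `[< Theta b >].
Qed.
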